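(* Let $X_1, X_2, \ldots$ be i.i.d. real random variables and let $f_1, \ldots, f_m : \mathbb R \to \mathbb R$ be measurable functions with $\mathcal K(f_i) = \mathbb E[f_i^4(X)] < \infty$ and $s(f_i) > 0$ for $i = 1, \ldots, m$. Fix an integer $K \ge 1$. Then, as $N \to \infty$, $$ N^{1/2}\left[\hat{\mathbb C}_1, \ldots, \hat{\mathbb C}_K\right] \Rightarrow (\tilde\Xi_1, \ldots, \tilde\Xi_K), $$ where $\tilde\Xi_1, \ldots, \tilde\Xi_K$ are i.i.d. $\mathcal N_{m^2}(\mathbf 0, \mathbf C)$ random vectors and $$ \mathbf C_{(ij),(i'j')} = C(f_i, f_{i'})\,C(f_j, f_{j'}),\quad i,j,i',j' = 1, \ldots, m, $$ i.e. $\mathbf C = \mathcal C \otimes \mathcal C$.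
   Context: Let $X_1, X_2, \ldots$ be i.i.d. real random variables and $X$ a random variable with the same law as $X_1$. For measurable $f : \mathbb R \to \mathbb R$ write $m(f) = \mathbb E[f(X)]$, $Q(f) = \mathrm{Var}(f(X))$, $s(f) = Q(f)^{1/2}$, $\mathcal K(f) = \mathbb E[f^4(X)]$, and for two functions $Q(f,g) = \mathrm{Cov}(f(X), g(X))$, $C(f,g) = Q(f,g)/(s(f)s(g))$. For a sample size $N$ define $\hat m(f) = \frac1N\sum_{k=1}^N f(X_k)$, $\hat s^2(f) = \frac1N\sum_{i=1}^N (f(X_i) - \hat m(f))^2$, and for a lag $0 \le k < N$, $\hat\gamma_k(f,g) = \frac{1}{N-k}\sum_{i=1}^{N-k}(f(X_i) - \hat m(f))(g(X_{i+k}) - \hat m(g))$ and $\hat\rho_k(f,g) = \hat\gamma_k(f,g)/(\hat s(f)\hat s(g))$ (assigned an arbitrary value, say $0$, when a denominator vanishes); for $k = 0$ the subscript is omitted. For functions $f_1, \ldots, f_m$, set $\hat{\mathbb Q}_k = [\hat\gamma_k(f_i, f_j)]_{i,j=1,\ldots,m} \in \mathbb R^{m^2}$ and $\hat{\mathbb C}_k = [\hat\rho_k(f_i, f_j)]_{i,j=1,\ldots,m} \in \mathbb R^{m^2}$, with coordinates indexed by pairs $(i,j)$ in lexicographic order; $[\hat{\mathbb C}_1, \ldots, \hat{\mathbb C}_K] \in \mathbb R^{m^2K}$ denotes concatenation. Let $\mathcal Q = (Q(f_i,f_j))_{i,j=1}^m$ and $\mathcal C = (C(f_i,f_j))_{i,j=1}^m$.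 $\otimes$ is the Kronecker product, so $(A \otimes B)_{(ij),(i'j')} = A_{ii'}B_{jj'}$. $\Rightarrow$ denotes convergence in distribution as $N \to \infty$. *)

(* Defs.v *)
From HB Require Import structures.
From mathcomp Require Import all_boot all_order all_algebra.
From mathcomp Require Import all_classical all_reals all_analysis.
From mathcomp Require Import mxtens.
Set Implicit Arguments.
Unset Strict Implicit.
Unset Printing Implicit Defensive.
Import Order.TTheory GRing.Theory Num.Theory.
Import numFieldNormedType.Exports.
Local Open Scope classical_set_scope.
Local Open Scope ring_scope.

Definition iid_seq (d : measure_display) (T : measurableType d) (R : realType)
  (P : probability T R) (X : nat -> T -> R) : Prop :=
  (forall n, measurable_fun setT (X n)) /\
  (forall n (A : set R), measurable A -> P (X n @^-1` A) = P (X 0%N @^-1` A)) /\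
  (forall (s : seq nat) (A : nat -> set R), uniq s ->
     (forall n, measurable (A n)) ->
     P (\big[setI/setT]_(n <- s) (X n @^-1` A n)) =
     (\prod_(n <- s) P (X n @^-1` A n))%E).

Definition popcov (d : measure_display) (T : measurableType d) (R : realType)
  (P : probability T R) (Y Z : T -> R) : R := fine (covariance P Y Z).

Definition popsd (d : measure_display) (T : measurableType d) (R : realType)
  (P : probability T R) (Y : T -> R) : R := Num.sqrt (fine ('V_P[Y])%E).

Definition popcorr (d : measure_display) (T : measurableType d) (R : realType)
  (P : probability T R) (Y Z : T -> R) : R :=
  popcov P Y Z / (popsd P Y * popsd P Z).

Definition corr_matrix (d : measure_display) (T : measurableType d)
  (R : realType) (P : probability T R) (X : nat -> T -> R) (m : nat)
  (f : 'I_m -> R -> R) : 'M[R]_m :=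
  \matrix_(i, j) popcorr P (f i \o X 0%N) (f j \o X 0%N).

(* (the paper's X_1..X_N are X 0 .. X (N-1) here) *)
Definition hat_m (R : realType) (N : nat) (y : nat -> R) : R :=
  N%:R^-1 * \sum_(k < N) y k.

Definition hat_s2 (R : realType) (N : nat) (y : nat -> R) : R :=
  N%:R^-1 * \sum_(i < N) (y i - hat_m N y) ^+ 2.

Definition hat_s (R : realType) (N : nat) (y : nat -> R) : R :=
  Num.sqrt (hat_s2 N y).

Definition hat_gamma (R : realType) (N k : nat) (y z : nat -> R) : R :=
  (N - k)%:R^-1 *
  \sum_(i < N - k) (y i - hat_m N y) * (z (i + k)%N - hat_m N z).

Definition hat_rho (R : realType) (N k : nat) (y z : nat -> R) : R :=
  if hat_s N y * hat_s N z == 0 then 0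
  else hat_gamma N k y z / (hat_s N y * hat_s N z).

(* [\hat C_1, ..., \hat C_K] in R^{m^2 K}: coordinate k*m^2 + (i*m + j)
   (lexicographic, via mxtens_unindex) is \hat rho_{k+1}(f_i, f_j). *)
Definition hat_C_vec (d : measure_display) (T : measurableType d)
  (R : realType) (X : nat -> T -> R) (m K : nat) (f : 'I_m -> R -> R)
  (N : nat) (w : T) : 'rV[R]_(K * (m * m)) :=
  \row_p hat_rho N (mxtens_unindex p).1.+1
     (fun n => f (mxtens_unindex (mxtens_unindex p).2).1 (X n w))
     (fun n => f (mxtens_unindex (mxtens_unindex p).2).2 (X n w)).

(* defined through its characteristic function:
   E[exp(i t.Z)] = exp(-t Sigma t^T / 2), i.e. E[cos(t.Z)] = exp(-tSt^T/2)
   and E[sin(t.Z)] = 0 for all t. *)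
Definition centered_gaussian_vec (d : measure_display) (T : measurableType d)
  (R : realType) (P : probability T R) (D : nat) (Z : T -> 'rV[R]_D)
  (Sigma : 'M[R]_D) : Prop :=
  (forall p, measurable_fun setT (fun w => Z w 0 p)) /\
  (forall t : 'rV[R]_D,
     ('E_P[fun w => cos ((t *m (Z w)^T) 0 0)%R])%E =
       (expR (- ((t *m Sigma *m t^T) 0 0) / 2))%:E /\
     ('E_P[fun w => sin ((t *m (Z w)^T) 0 0)%R])%E = 0%E).

Definition conv_in_distribution (d : measure_display) (T : measurableType d)
  (d' : measure_display) (T' : measurableType d') (R : realType)
  (P : probability T R) (P' : probability T' R) (D : nat)
  (Y : nat -> T -> 'rV[R]_D) (Z : T' -> 'rV[R]_D) : Prop :=
  forall h : 'rV[R]_D -> R, continuous h ->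
    (exists M : R, forall x, `|h x| <= M) ->
    ('E_P[h \o Y N])%E @[N --> \oo] --> ('E_P'[h \o Z])%E.

(* Main.v *)
(* The empirical correlations are invariant under affine changes of the [f i], so
   one may take [g i = (f i - mean) / sd].  For these, [sqrt N * hat_rho] differs
   from [lag_sum N = N^(-1/2) * sum_n g_i (X_(n-k)) g_j (X_n)] by an error that
   tends to 0 in probability (second moments and the law of large numbers in L1).
   For a fixed [t] the linear combination [t . lag_sum] is [N^(-1/2)] times the
   sum of a stationary martingale difference sequence [xi_n] that depends only on
   X_(n-K), ..., X_n.  With [c_n = E cos (N^(-1/2) (xi_0 + ... + xi_(n-1)) + a)], a
   Taylor expansion gives [c_(n+1) = (1 - q / 2N) c_n + O(N^(-3/2))]: the linear
   term vanishes by the martingale property, and in the quadratic term going back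
   K steps, at a cost of O(N^(-1/2)), makes [xi_n ^+ 2] independent of the cosine.
   Hence [c_N] tends to [cos a * exp (- q / 2)] with
   [q = E xi_0 ^+ 2 = t (1 (x) C (x) C) t^T].  Convergence of all these cosine
   means, together with tightness, gives convergence in distribution because
   trigonometric polynomials approximate bounded continuous functions on cubes
   without increasing their supremum. *)
Require Import Defs.
From HB Require Import structures.
From mathcomp Require Import all_boot all_order all_algebra.
From mathcomp Require Import all_classical all_reals all_analysis.
From mathcomp Require Import mxtens measurable_realfun.
From mathcomp Require Import ring lra zify.
Set Implicit Arguments.
Unset Strict Implicit.
Unset Printing Implicit Defensive.
Import Order.TTheory GRing.Theory Num.Theory.
Import numFieldNormedType.Exports.
Local Open Scope classical_set_scope.
Local Open Scope ring_scope.

(** * Integrable random variables and their means *)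

(** Laws enter only through the real numbers E cos (t.Y + a) with a free phase a: a = 0 gives the
    cosine and a = - pi / 2 the sine, so no complex exponentials occur and the family is stable
    under products. Finite fourth moments of the [f i] suffice although each summand is a product of
    two of them: its two factors are independent, so the fourth moment of the product is the product
    of the fourth moments. Correlations are ratios, whose moments are not controlled; tightness and
    convergence in probability are therefore both expressed by means of quantities truncated at 1,
    which are always integrable and cost at most 1 on the exceptional event where a denominator is
    small. The limit must exist as a random vector on some space, and its covariance may be
    singular, so a Gaussian vector is built from independent standard normals by successive Schur
    complements. *)

Definition integ (d : measure_display) (T : measurableType d) (R : realType)
  (P : probability T R) (F : T -> R) : Prop := P.-integrable setT (EFin \o F).

(** A plain real number, so that ring and linear arithmetic apply. It represents the expectation
    only for integrable functions, hence the integrability side conditions throughout. *)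
Definition mean (d : measure_display) (T : measurableType d) (R : realType)
  (P : probability T R) (F : T -> R) : R := (\int[P]_w F w)%R.

Section Mean.
Context (d : measure_display) (T : measurableType d) (R : realType).
Variable P : probability T R.
Implicit Types F G H : T -> R.

Lemma integ_meas F : integ P F -> measurable_fun setT F.
Proof. by move=> /integrableP[] /measurable_EFinP. Qed.

Lemma integ_le F G : measurable_fun setT F -> integ P G ->
  (forall w, `|F w| <= G w) -> integ P F.
Proof.
move=> mF iG FG; apply: (le_integrable _ _ _ iG) => //.
  exact/measurable_EFinP.
by move=> w _ /=; rewrite lee_fin (le_trans (FG w))// ler_norm.
Qed.

Lemma integ_cst c : integ P (fun=> c).
Proof. exact: finite_measure_integrable_cst. Qed.

Lemma integ_bounded F c : measurable_fun setT F -> (forall w, `|F w| <= c) ->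
  integ P F.
Proof. by move=> mF Fc; apply: (integ_le mF (integ_cst c)). Qed.

Lemma integ_norm F : integ P F -> integ P (fun w => `|F w|).
Proof.
move=> iF; apply: integ_le (integrable_norm iF) _.
  by apply: measurableT_comp => //; exact: integ_meas.
by move=> w; rewrite /= normr_id.
Qed.

Lemma integD F G : integ P F -> integ P G -> integ P (fun w => F w + G w).
Proof.
move=> iF iG; have := integrableD measurableT iF iG.
by apply: eq_integrable => // w _ /=; rewrite EFinD.
Qed.

Lemma integZ c F : integ P F -> integ P (fun w => c * F w).
Proof.
move=> iF; have := integrableZl measurableT c iF.
by apply: eq_integrable => // w _ /=; rewrite EFinM.
Qed.

Lemma integB F G : integ P F -> integ P G -> integ P (fun w => F w - G w).
Proof.
move=> iF iG; have := integrableB measurableT iF iG.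
by apply: eq_integrable => // w _ /=; rewrite EFinB.
Qed.

Lemma integ_sum (I : Type) (s : seq I) (p : pred I) (F : I -> T -> R) :
  (forall i, p i -> integ P (F i)) -> integ P (fun w => \sum_(i <- s | p i) F i w).
Proof.
move=> iF; elim: s => [|i s IH].
  by under eq_fun do rewrite big_nil; exact: integ_cst.
under eq_fun do rewrite big_cons; case: (boolP (p i)) => // pi.
by apply: integD => //; exact: iF.
Qed.

Lemma mean_cst c : mean P (fun=> c) = c.
Proof. by rewrite /mean Rintegral_cst//; have := probability_setT P; rewrite /= => ->; rewrite mulr1. Qed.

Lemma meanD F G : integ P F -> integ P G ->
  mean P (fun w => F w + G w) = mean P F + mean P G.
Proof. by move=> iF iG; rewrite /mean RintegralD. Qed.

Lemma meanB F G : integ P F -> integ P G ->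
  mean P (fun w => F w - G w) = mean P F - mean P G.
Proof. by move=> iF iG; rewrite /mean RintegralB. Qed.

Lemma meanZ c F : integ P F -> mean P (fun w => c * F w) = c * mean P F.
Proof. by move=> iF; rewrite /mean RintegralZl. Qed.

Lemma mean_sum (I : Type) (s : seq I) (p : pred I) (F : I -> T -> R) :
  (forall i, p i -> integ P (F i)) ->
  mean P (fun w => \sum_(i <- s | p i) F i w) = \sum_(i <- s | p i) mean P (F i).
Proof.
move=> iF; elim: s => [|i s IH].
  by under eq_fun do rewrite big_nil; rewrite mean_cst big_nil.
under eq_fun do rewrite big_cons; rewrite big_cons.
case: (boolP (p i)) => // pi.
by rewrite meanD ?IH//; [exact: iF|exact: integ_sum].
Qed.

Lemma mean_le F G : integ P F -> integ P G -> (forall w, F w <= G w) ->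
  mean P F <= mean P G.
Proof. by move=> iF iG FG; apply: le_Rintegral. Qed.

Lemma mean_ge0 F : (forall w, 0 <= F w) -> 0 <= mean P F.
Proof. by move=> F0; apply: Rintegral_ge0. Qed.

Lemma mean_norm F : integ P F -> `|mean P F| <= mean P (fun w => `|F w|).
Proof. by move=> iF; apply: le_normr_Rintegral. Qed.

Lemma mean_le_norm F G : measurable_fun setT F -> integ P G ->
  (forall w, `|F w| <= G w) -> `|mean P F| <= mean P G.
Proof.
move=> mF iG FG; have iF := integ_le mF iG FG.
by apply: le_trans (mean_norm iF) _; apply: mean_le => //; exact: integ_norm.
Qed.

Lemma eq_mean F G : F =1 G -> mean P F = mean P G.
Proof. by move=> /funext ->. Qed.

Lemma meanE F : integ P F -> ('E_P[F] = (mean P F)%:E)%E.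
Proof.
by move=> iF; rewrite unlock /mean /Rintegral fineK//; exact: integrable_fin_num.
Qed.

Lemma integ_sqr F : measurable_fun setT F ->
  integ P (fun w => F w ^+ 2) -> integ P F.
Proof.
move=> mF iF2; apply: integ_le mF (integD (integ_cst 1) iF2) _ => w.
rewrite -(ger0_norm (sqr_ge0 (F w))) normrX; nra.
Qed.

Lemma integ_mul F G : measurable_fun setT F -> measurable_fun setT G ->
  integ P (fun w => F w ^+ 2) -> integ P (fun w => G w ^+ 2) ->
  integ P (fun w => F w * G w).
Proof.
move=> mF mG iF iG; apply: integ_le (integD iF iG) _.
  exact: measurable_funM.
move=> w; rewrite normrM -(real_normK (num_real (F w))).
rewrite -(real_normK (num_real (G w))).
have := sqr_ge0 (`|F w| - `|G w|).
have : 0 <= `|F w| by []. have : 0 <= `|G w| by []. nra.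
Qed.

Lemma integ_pow4 F : measurable_fun setT F ->
  integ P (fun w => F w ^+ 4) -> integ P (fun w => F w ^+ 2).
Proof.
move=> mF iF; apply: integ_sqr; first exact: measurable_funX.
by under eq_fun do rewrite -exprM.
Qed.

(** The variance of [|F|] is nonnegative; expanding the square gives the bound. *)
Lemma mean_normr_le F : measurable_fun setT F -> integ P (fun w => F w ^+ 2) ->
  mean P (fun w => `|F w|) ^+ 2 <= mean P (fun w => F w ^+ 2).
Proof.
move=> mF iF2; have iF := integ_norm (integ_sqr mF iF2).
set a := mean P _.
have : 0 <= mean P (fun w => F w ^+ 2 - 2 * a * `|F w| + a ^+ 2).
  apply: mean_ge0 => w; rewrite -(real_normK (num_real (F w))).
  have := sqr_ge0 (`|F w| - a); nra.
rewrite meanD; [|apply: integB => //; exact: integZ|exact: integ_cst].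
rewrite meanB//; last exact: integZ.
by rewrite mean_cst meanZ// -/a; nra.
Qed.

Lemma integ_sqrD F G : measurable_fun setT F -> measurable_fun setT G ->
  integ P (fun w => F w ^+ 2) -> integ P (fun w => G w ^+ 2) ->
  integ P (fun w => (F w + G w) ^+ 2).
Proof.
move=> mF mG iF iG; apply: integ_le (integZ 2 (integD iF iG)) _.
  by apply: measurable_funX; exact: measurable_funD.
move=> w; rewrite ger0_norm ?sqr_ge0//.
have := sqr_ge0 (F w - G w); nra.
Qed.

End Mean.

(** Tonelli for the absolute value, whose inner integral is [|F x|] times a constant, gives
    integrability; Fubini then gives the product. *)
Lemma mean_prod (d1 d2 : measure_display) (T1 : measurableType d1)
  (T2 : measurableType d2) (R : realType) (P1 : probability T1 R)
  (P2 : probability T2 R) (F : T1 -> R) (G : T2 -> R) :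
  integ P1 F -> integ P2 G ->
  integ (P1 \x P2)%E (fun z => F z.1 * G z.2) /\
  mean (P1 \x P2)%E (fun z => F z.1 * G z.2) = mean P1 F * mean P2 G.
Proof.
move=> iF iG; have mF := integ_meas iF; have mG := integ_meas iG.
have mFG : measurable_fun setT (fun z : T1 * T2 => F z.1 * G z.2).
  by apply: measurable_funM; apply: measurableT_comp.
have iFG : integ (P1 \x P2)%E (fun z => F z.1 * G z.2).
  apply/integrable12ltyP; first exact/measurable_EFinP.
  have -> : (\int[P1]_x \int[P2]_y `|(EFin \o (fun z => (F z.1 * G z.2)%R)) (x, y)|
    = \int[P1]_x ((mean P2 (fun y => `|G y|) * `|F x|)%R)%:E)%E.
    apply: eq_integral => x _ /=.
    have -> : (\int[P2]_y (`|F x * G y|%R)%:E = \int[P2]_y ((`|F x|%R)%:E * (`|G y|%R)%:E))%E.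
      by apply: eq_integral => y _; rewrite normrM EFinM.
    have iGn := integ_norm iG.
    rewrite integralZl//; rewrite /mean /Rintegral mulrC EFinM fineK//.
    exact: integrable_fin_num.
  have := integ_norm (integZ (mean P2 (fun y => `|G y|)) (integ_norm iF)).
  move=> /integrableP[_]; apply: le_lt_trans; apply: ge0_le_integral => //=.
  - by move=> x _; rewrite lee_fin mulr_ge0//; exact: mean_ge0.
  - by apply/measurable_EFinP; apply: measurable_funM => //; apply: measurableT_comp.
  - by apply/measurable_EFinP; do 2 apply: measurableT_comp => //;
      apply: measurable_funM => //; apply: measurableT_comp.
  - by move=> x _; rewrite lee_fin normr_id ler_norm.
split => //; rewrite /mean /Rintegral -integral12_prod_meas1//.
rewrite -[RHS]/(fine (mean P1 F * mean P2 G)%:E); congr fine.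
transitivity (\int[P1]_x ((mean P2 G * F x)%R)%:E)%E.
  apply: eq_integral => x _; rewrite /fubini_F /=.
  under eq_integral do rewrite EFinM.
  rewrite integralZl//; rewrite /mean /Rintegral mulrC EFinM fineK//.
  exact: integrable_fin_num.
have := meanE (integZ (mean P2 G) iF).
rewrite unlock meanZ// mulrC => ->.
by [].
Qed.

(** * Product formula for the mean of two independent variables *)

Section Indep.
Context (d : measure_display) (T : measurableType d) (R : realType).
Variable P : probability T R.
Implicit Types F G H : T -> R.

Definition indep2 F G := forall A B : set R, measurable A -> measurable B ->
  P (F @^-1` A `&` G @^-1` B) = (P (F @^-1` A) * P (G @^-1` B))%E.

(** The law of the pair and the product of the two laws agree on rectangles, hence everywhere; the
    product formula for the two coordinate functions is then pulled back. *)
Lemma mean_indep F G : indep2 F G -> integ P F -> integ P G ->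
  integ P (fun w => F w * G w) /\
  mean P (fun w => F w * G w) = mean P F * mean P G.
Proof.
move=> FG iF iG; have mF := integ_meas iF; have mG := integ_meas iG.
pose f : {mfun T >-> R} := mfun_Sub (mem_set mF).
pose g : {mfun T >-> R} := mfun_Sub (mem_set mG).
have mW : measurable_fun setT (fun w => (F w, G w)).
  exact/measurable_fun_pair.
pose W : {mfun T >-> (R * R)%type} := mfun_Sub (mem_set mW).
have WE (A : set (R * R)) : measurable A ->
    (distribution P f \x distribution P g)%E A = distribution P W A.
  by move=> mA; apply: product_measure_unique => // B C mB mC; exact: FG.
have iid (X : {mfun T >-> R}) : integ P X -> integ (distribution P X) id.
  move=> iX; apply: integrable_pushforward => //.
  exact/measurable_EFinP.
have mid (X : {mfun T >-> R}) : integ P X -> mean (distribution P X) id = mean P X.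
  by move=> iX; rewrite /mean /Rintegral integral_distribution//; exact/measurable_EFinP.
have [iM eM] := mean_prod (iid f iF) (iid g iG).
have mM : measurable_fun setT (fun z : R * R => (z.1 * z.2)%:E).
  by apply/measurable_EFinP; apply: measurable_funM.
have iFG : integ P (fun w => F w * G w).
  apply/integrableP; split; first by apply/measurable_EFinP; exact: measurable_funM.
  have /integrableP[_] := iM; rewrite (eq_measure_integral (distribution P W)).
    rewrite ge0_integral_distribution//; exact: measurableT_comp.
  by move=> A mA _; exact: WE.
split => //; rewrite -(mid f iF) -(mid g iG) -eM /mean /Rintegral.
rewrite [in RHS](eq_measure_integral (distribution P W)); last first.
  by move=> A mA _; exact: WE.
by rewrite integral_distribution.
Qed.

End Indep.

(** * Independence of disjoint windows of observations *)

(** The sets independent of a fixed [B] form a Dynkin system, so independence passes from a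
    pi-system to the sigma-algebra it generates. *)
Lemma indep_dynkin (d : measure_display) (T : measurableType d) (R : realType)
  (P : probability T R) (G : set (set T)) (B : set T) :
  G `<=` measurable -> setI_closed G -> measurable B ->
  (forall A, G A -> P (A `&` B) = (P A * P B)%E) ->
  forall A, <<s G >> A -> P (A `&` B) = (P A * P B)%E.
Proof.
move=> mG GI mB GB.
have sG : <<s G >> `<=` (measurable : set (set T)).
  by apply: smallest_sub => //; exact: sigma_algebra_measurable.
have fB := fin_num_measure P _ mB.
have keyC (A : set T) : measurable A -> P (A `&` B) = (P A * P B)%E ->
    P (~` A `&` B) = (P (~` A) * P B)%E.
  move=> mA IH.
  have -> : ~` A `&` B = B `\` A by rewrite setDE setIC.
  rewrite measureD//; last by rewrite ltey_eq fB.
  transitivity (P B - P A * P B)%E; first by congr (_ - _)%E; rewrite setIC.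
  by rewrite probability_setC// muleBl ?mul1e.
have keyU (F : (set T)^nat) : (forall n, measurable (F n)) -> trivIset setT F ->
    (forall n, P (F n `&` B) = (P (F n) * P B)%E) ->
    P (\bigcup_k F k `&` B) = (P (\bigcup_k F k) * P B)%E.
  move=> mF tF IH; rewrite setI_bigcupl !measure_semi_bigcup//.
  - rewrite muleC -(fineK fB) -nneseriesZl//; apply: eq_eseriesr => n _.
    by rewrite fineK// muleC; exact: IH.
  - exact: bigcup_measurable.
  - by move=> n; exact: measurableI.
  - exact: trivIset_setIr.
  - by apply: bigcup_measurable => n _; exact: measurableI.
apply: (@dynkin_induction _ (g_sigma_algebraType G) G
  (fun A => P (A `&` B) = (P A * P B)%E)) => //.
- by rewrite setTI probability_setT mul1e.
- by move=> A mA; apply: keyC; exact: sG.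
- by move=> F mF tF IH; exact: keyU (fun n => sG _ (mF n)) tF IH.
Qed.

Section Windows.
Context (d : measure_display) (T : measurableType d) (R : realType).
Variables (P : probability T R) (X : nat -> T -> R).
Hypothesis iidX : iid_seq P X.

(** Finite cylinders form a pi-system generating the sigma-algebra of the observations indexed by
    [s]; taking lists for windows lets the product formula of [iid_seq] apply directly. *)
Definition cyl (s : seq nat) : set (set T) :=
  [set C | exists2 A : nat -> set R, (forall n, measurable (A n)) &
     C = \big[setI/setT]_(n <- s) (X n @^-1` A n)].

(* [F] is measurable for the sigma-algebra generated by the [X n], [n] in [s]. *)
Definition smeas (s : seq nat) (F : T -> R) : Prop :=
  measurable_fun setT (F : g_sigma_algebraType (cyl s) -> R).

Let mX n : measurable_fun setT (X n). Proof. by have [] := iidX. Qed.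

Lemma cyl_measurable s : cyl s `<=` measurable.
Proof.
move=> _ [A mA ->]; apply: bigsetI_measurable => n _.
by rewrite -[X in measurable X]setTI; exact: mX.
Qed.

Lemma cyl_setI s : setI_closed (cyl s).
Proof.
move=> _ _ [A mA ->] [B mB ->]; exists (fun n => A n `&` B n).
  by move=> n; exact: measurableI.
by rewrite -big_split; apply: eq_bigr => n _; rewrite preimage_setI.
Qed.

Lemma cyl_indep s1 s2 A B : uniq (s1 ++ s2) -> cyl s1 A -> cyl s2 B ->
  P (A `&` B) = (P A * P B)%E.
Proof.
move=> us [A1 mA1 ->] [A2 mA2 ->]; have [_ [_ ind]] := iidX.
(* The product formula takes a single family of sets, so the two families are glued along membership
   in [s1]; this is consistent because the lists are disjoint. *)
pose A3 n := if n \in s1 then A1 n else A2 n.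
have mA3 n : measurable (A3 n) by rewrite /A3; case: ifP.
have e1 : \big[setI/setT]_(n <- s1) (X n @^-1` A1 n) =
          \big[setI/setT]_(n <- s1) (X n @^-1` A3 n).
  by apply: eq_big_seq => n ns; rewrite /A3 ns.
have := us; rewrite cat_uniq => /and3P[us1 /hasPn s12 us2].
have e2 : \big[setI/setT]_(n <- s2) (X n @^-1` A2 n) =
          \big[setI/setT]_(n <- s2) (X n @^-1` A3 n).
  by apply: eq_big_seq => n ns; rewrite /A3 (negbTE (s12 _ ns)).
by rewrite e1 e2 -big_cat !ind// big_cat.
Qed.

(** The Dynkin argument is used twice, freeing one of the two sets at a time. *)
Lemma sigma_cyl_indep s1 s2 A B : uniq (s1 ++ s2) ->
  <<s cyl s1 >> A -> <<s cyl s2 >> B -> P (A `&` B) = (P A * P B)%E.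
Proof.
move=> us sA sB.
have sG s : <<s cyl s >> `<=` (measurable : set (set T)).
  apply: smallest_sub; first exact: sigma_algebra_measurable.
  exact: cyl_measurable.
rewrite setIC muleC; apply: indep_dynkin (sB) => //.
- exact: cyl_measurable.
- exact: cyl_setI.
- exact: sG sA.
move=> C cC; rewrite setIC muleC; apply: indep_dynkin (sA) => //.
- exact: cyl_measurable.
- exact: cyl_setI.
- exact: cyl_measurable cC.
by move=> D cD; apply: cyl_indep cD cC.
Qed.

Lemma smeas_indep s1 s2 F G : uniq (s1 ++ s2) -> smeas s1 F -> smeas s2 G ->
  indep2 P F G.
Proof.
move=> us mF mG A B mA mB; apply: (sigma_cyl_indep us).
  by have := mF measurableT _ mA; rewrite setTI.
by have := mG measurableT _ mB; rewrite setTI.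
Qed.

Lemma smeas_meas s F : smeas s F -> measurable_fun setT F.
Proof.
move=> mF _ A mA; have := mF measurableT _ mA; rewrite !setTI.
apply: smallest_sub; first exact: sigma_algebra_measurable.
exact: cyl_measurable.
Qed.

Lemma smeas_X s n : uniq s -> n \in s -> smeas s (X n).
Proof.
move=> us ns _ A mA; rewrite setTI; apply: sub_gen_smallest.
exists (fun k => if k == n then A else setT); first by move=> k; case: ifP.
rewrite (bigD1_seq n)//= eqxx big1 ?setIT// => k /negbTE ->.
by rewrite preimage_setT.
Qed.

(** Each generator for [s1] is a finite intersection of preimages, every one of which is measurable
    for [s2]. *)
Lemma smeas_sub s1 s2 F : uniq s2 -> {subset s1 <= s2} -> smeas s1 F ->
  smeas s2 F.
Proof.
move=> us s12 mF _ A mA; have := mF measurableT _ mA.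
rewrite !setTI; apply: smallest_sub; first exact: smallest_sigma_algebra.
move=> _ [B mB ->].
elim: s1 s12 {mF} => [|n s1 IH] s12.
  by rewrite big_nil; exact: (@measurableT _ (g_sigma_algebraType (cyl s2))).
rewrite big_cons; apply: (@measurableI _ (g_sigma_algebraType (cyl s2))).
  have ns : n \in s2 by apply: s12; rewrite inE eqxx.
  by have := smeas_X us ns measurableT (mB n); rewrite setTI.
by apply: IH => k ks; apply: s12; rewrite inE ks orbT.
Qed.

Lemma smeas_comp s (f : R -> R) F : measurable_fun setT f -> smeas s F ->
  smeas s (fun w => f (F w)).
Proof. by move=> mf mF; apply: measurableT_comp. Qed.

Lemma smeas_cst s c : smeas s (fun=> c).
Proof. exact: measurable_cst. Qed.

Lemma smeasD s F G : smeas s F -> smeas s G -> smeas s (fun w => F w + G w).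
Proof. exact: measurable_funD. Qed.

Lemma smeasM s F G : smeas s F -> smeas s G -> smeas s (fun w => F w * G w).
Proof. exact: measurable_funM. Qed.

Lemma smeas_sum s (I : Type) (r : seq I) (p : pred I) (F : I -> T -> R) :
  (forall i, p i -> smeas s (F i)) ->
  smeas s (fun w => \sum_(i <- r | p i) F i w).
Proof.
move=> mF; elim: r => [|i r IH].
  by under eq_fun do rewrite big_nil; exact: smeas_cst.
under eq_fun do rewrite big_cons; case: (boolP (p i)) => // pi.
by apply: smeasD => //; exact: mF.
Qed.

Lemma mean_window s1 s2 F G : uniq (s1 ++ s2) -> smeas s1 F -> smeas s2 G ->
  integ P F -> integ P G -> integ P (fun w => F w * G w) /\
  mean P (fun w => F w * G w) = mean P F * mean P G.
Proof. by move=> us mF mG; apply: mean_indep; exact: smeas_indep us mF mG. Qed.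

(** A change of variables turns both means into integrals against the common law of the
    observations. *)
Lemma ident_int n (f : R -> R) : measurable_fun setT f ->
  integ P (fun w => f (X 0%N w)) -> integ P (fun w => f (X n w)) /\
  mean P (fun w => f (X n w)) = mean P (fun w => f (X 0%N w)).
Proof.
move=> mf i0; have [_ [idX _]] := iidX.
pose x k : {mfun T >-> R} := mfun_Sub (mem_set (mX k)).
have E A : measurable A -> distribution P (x n) A = distribution P (x 0%N) A.
  exact: idX.
have mEf : measurable_fun setT (EFin \o f) by apply/measurable_EFinP.
have i_n : integ P (fun w => f (X n w)).
  apply/integrableP; split.
    by apply/measurable_EFinP; exact: measurableT_comp (mX n).
  have /integrableP[_] := i0.
  have e k : (\int[P]_w `|(EFin \o (fun w => f (X k w))) w|)%E =
      (\int[distribution P (x k)]_y `|(EFin \o f) y|)%E.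
    by rewrite ge0_integral_distribution//; exact: measurableT_comp.
  rewrite !e; apply: le_lt_trans; rewrite le_eqVlt; apply/orP; left; apply/eqP.
  apply: eq_measure_integral => A mA _; exact/E.
split => //; rewrite /mean /Rintegral.
rewrite -[in LHS](integral_distribution (X := x n) (f := EFin \o f))//.
rewrite -[in RHS](integral_distribution (X := x 0%N) (f := EFin \o f))//.
by congr fine; apply: eq_measure_integral => A mA _; exact/E.
Qed.

End Windows.

(** * A central limit theorem for K-dependent martingale differences *)

Section TrigBounds.
Context {R : realType}.
Implicit Types x y t : R.

Lemma norm_sin_le x : `|sin x| <= `|x|.
Proof.
wlog x0 : x / 0 <= x => [H|].
  have [/H//|/ltW x0] := lerP 0 x.
  by rewrite -normrN -sinN -[leRHS]normrN; apply: H; rewrite oppr_ge0.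
have [->|xN0] := eqVneq x 0; first by rewrite sin0.
have x_gt0 : 0 < x by rewrite lt_neqAle eq_sym xN0.
have [c _] := @MVT R sin cos 0 x x_gt0 (fun y _ => is_derive_sin y)
  (continuous_subspaceT (@continuous_sin R)).
rewrite sin0 !subr0 => ->; rewrite normrM ler_piMl//; exact: cos_max.
Qed.

Lemma cos_half x : cos x = 1 - 2 * sin (x / 2) ^+ 2.
Proof.
rewrite {1}(_ : x = (x / 2) *+ 2); last by rewrite -mulr_natr; field.
by rewrite cos_mulr2n cos2sin2 -mulr_natr; ring.
Qed.

Lemma cos_ge_quad x : 1 - x ^+ 2 / 2 <= cos x.
Proof.
rewrite cos_half; have := norm_sin_le (x / 2).
rewrite -ler_sqr ?nnegrE// !real_normK ?num_real//; lra.
Qed.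

(** By the mean value theorem sin x - x = - (1 - cos c) x for some c between 0 and x, and 1 - cos c
    <= c^2 / 2. The crude constant 1 is all that is needed. *)
Lemma norm_sin_sub x : `|sin x - x| <= `|x| ^+ 3.
Proof.
wlog x0 : x / 0 <= x => [H|].
  have [/H//|/ltW x0] := lerP 0 x.
  rewrite -normrN opprD -sinN -[`|x|]normrN; apply: H; by rewrite oppr_ge0.
have [->|xN0] := eqVneq x 0; first by rewrite sin0 subr0 normr0 expr0n.
have x_gt0 : 0 < x by rewrite lt_neqAle eq_sym xN0.
have [c] := @MVT R sin cos 0 x x_gt0 (fun y _ => is_derive_sin y)
  (continuous_subspaceT (@continuous_sin R)).
rewrite sin0 !subr0 in_itv/= => /andP[c0 cx] ->.
rewrite (_ : cos c * x - x = - ((1 - cos c) * x)); last by ring.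
rewrite normrN ger0_norm; last by rewrite mulr_ge0// subr_ge0 cos_le1.
rewrite ger0_norm// exprSr ler_wpM2r//.
have := cos_ge_quad c; have : c ^+ 2 <= x ^+ 2 by rewrite ler_sqr ?nnegrE// ltW.
have := sqr_ge0 x; lra.
Qed.

Lemma norm_cosB x y : `|cos x - cos y| <= `|x - y|.
Proof.
have -> : cos x - cos y = - 2 * sin ((x + y) / 2) * sin ((x - y) / 2).
  have -> : cos x - cos y =
      cos ((x + y) / 2 + (x - y) / 2) - cos ((x + y) / 2 - (x - y) / 2).
    by congr (cos _ - cos _); field.
  by rewrite cosD cosB; ring.
rewrite !normrM normrN.
apply: le_trans (_ : 2 * 1 * (`|(x - y) / 2|) <= _).
  rewrite ler_pM//; last exact: norm_sin_le.
  by rewrite ler_pM// ?sin_max// ger0_norm.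
  by rewrite normrM normfV (ger0_norm (x := 2))// mulr1 mulrC divfK.
Qed.

(** The addition formula separates [x] from [y] and leaves the remainders of sin y and cos y. With z
    = y / 2 and s = sin z the second one is - 2 (s - z) (s + z), which reduces it to the bound on s
    - z. *)
Lemma cos_taylor x y :
  `|cos (x + y) - (cos x - y * sin x - y ^+ 2 / 2 * cos x)| <= `|y| ^+ 3 + y ^+ 4.
Proof.
have -> : cos (x + y) - (cos x - y * sin x - y ^+ 2 / 2 * cos x) =
  cos x * (cos y - 1 + y ^+ 2 / 2) - sin x * (sin y - y).
  by rewrite cosD; field.
apply: le_trans (ler_normB _ _) _; rewrite addrC !normrM; apply: lerD.
  apply: le_trans (norm_sin_sub y).
  by rewrite ler_piMl// sin_max.
apply: le_trans (_ : `|cos y - 1 + y ^+ 2 / 2| <= _).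
  by rewrite ler_piMl// cos_max.
rewrite ger0_norm; last by have := cos_ge_quad y; lra.
rewrite cos_half.
have := norm_sin_sub (y / 2); have := norm_sin_le (y / 2).
set s := sin _; set z := y / 2; have -> : y = 2 * z by rewrite /z; field.
move=> h1 h2.
have -> : 1 - 2 * s ^+ 2 - 1 + (2 * z) ^+ 2 / 2 = - 2 * ((s - z) * (s + z)).
  by field.
have h3 : `|s + z| <= 2 * `|z| by have := ler_normD s z; lra.
have : `|(s - z) * (s + z)| <= `|z| ^+ 3 * (2 * `|z|).
  by rewrite normrM ler_pM.
have -> : (2 * z) ^+ 4 = 16 * (`|z| ^+ 4).
  by rewrite exprMn -[in RHS]normrX ger0_norm ?exprn_even_ge0//; ring.
have -> : `|z| ^+ 3 * (2 * `|z|) = 2 * `|z| ^+ 4 by ring.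
have : 0 <= `|z| ^+ 4 by apply: exprn_ge0.
by move=> h4; rewrite ler_norml => /andP[h5 h6]; lra.
Qed.

(** Since [expR (- y) <= 1 / (1 + y)], the difference is at most [y ^+ 2 / (1 + y)]. *)
Lemma expR_quad y : 0 <= y -> `|expR (- y) - (1 - y)| <= y ^+ 2.
Proof.
move=> y0; rewrite ger0_norm; last by have := expR_ge1Dx (- y); lra.
have h : expR (- y) * (1 + y) <= 1.
  rewrite expRN ler_pdivrMl ?expR_gt0// mulr1; exact: expR_ge1Dx.
have e1 : expR (- y) <= 1 by rewrite expR_le1 oppr_le0.
have e0 := expR_ge0 (- y); nra.
Qed.

Lemma cvg_lt_sqrt (B e : R) : 0 < e -> \forall N \near \oo, B / Num.sqrt N%:R < e.
Proof.
move=> e0; near=> N.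
have N0 : 0 < Num.sqrt (N%:R : R).
  by rewrite sqrtr_gt0 ltr0n; near: N; exact: nbhs_infty_gt.
rewrite ltr_pdivrMr//.
apply: le_lt_trans (ler_norm B) _.
have -> : `|B| = e * Num.sqrt ((`|B| / e) ^+ 2).
  by rewrite sqrtr_sqr [`|_ / _|]ger0_norm ?divr_ge0 ?(ltW e0)// mulrC divfK// gt_eqF.
rewrite ltr_pM2l// ltr_sqrt; near: N; first exact: nbhs_infty_gtr.
by exists 1%N => // n; rewrite /= ltr0n.
Unshelve. all: end_near. Qed.

End TrigBounds.

(** * Recursion for the cosine means of the partial sums *)

Section CLT.
Context (d : measure_display) (T : measurableType d) (R : realType).
Variables (P : probability T R) (X : nat -> T -> R).
Hypothesis iidX : iid_seq P X.
Variables (K : nat) (xi : nat -> T -> R) (q M : R).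
Hypothesis xi_win : forall n, smeas X (iota n K.+1) (xi n).
Hypothesis xi_4 : forall n, integ P (fun w => xi n w ^+ 4).
Hypothesis xi_M : forall n, mean P (fun w => xi n w ^+ 4) <= M.
Hypothesis xi_q : forall n, mean P (fun w => xi n w ^+ 2) = q.
(** The martingale property: the newest observation in [xi n] is [X (n + K)], so its past consists
    of the observations with index below [n + K]. Bounded test functions suffice, because only sines
    of partial sums are inserted. *)
Hypothesis xi_md : forall n F (c : R), smeas X (iota 0 (n + K)) F ->
  (forall w, `|F w| <= c) -> mean P (fun w => F w * xi n w) = 0.

Let S n w := \sum_(0 <= l < n) xi l w.

Let mxi n : measurable_fun setT (xi n).
Proof. exact (smeas_meas iidX (@xi_win n)). Qed.

Let M0 : 0 <= M.
Proof.
apply: le_trans (xi_M 0%N); apply: mean_ge0 => w; exact: exprn_even_ge0.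
Qed.

Let q0 : 0 <= q.
Proof. by rewrite -(xi_q 0%N); apply: mean_ge0 => w; exact: sqr_ge0. Qed.

Let xi_2 n : integ P (fun w => xi n w ^+ 2).
Proof. exact: integ_pow4. Qed.

Let xi_1 n : integ P (xi n).
Proof. exact: integ_sqr. Qed.

(** This bound and the next two dominate lower-order products by fourth powers, so that the single
    constant [M] controls all error terms. *)
Let pow1 (x : R) : `|x| <= 1 + x ^+ 4.
Proof.
have -> : x ^+ 4 = `|x| ^+ 4 by rewrite -normrX ger0_norm ?exprn_even_ge0.
have := sqr_ge0 (`|x| - 1); have := sqr_ge0 (`|x| ^+ 2 - 1).
have : 0 <= `|x| := normr_ge0 x; set y := `|x| => y0; nra.
Qed.

Let pow3 (x : R) : `|x| ^+ 3 <= 1 + x ^+ 4.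
Proof.
have -> : x ^+ 4 = `|x| ^+ 4 by rewrite -normrX ger0_norm ?exprn_even_ge0.
have : 0 <= `|x| := normr_ge0 x; set y := `|x| => y0.
have := sqr_ge0 (y - 1); have := sqr_ge0 (y ^+ 2 - y); have := sqr_ge0 (y ^+ 2 - 1); nra.
Qed.

Let pow12 (x y : R) : `|x| * y ^+ 2 <= 1 + x ^+ 4 + y ^+ 4.
Proof.
have -> : x ^+ 4 = `|x| ^+ 4 by rewrite -normrX ger0_norm ?exprn_even_ge0.
have -> : y ^+ 4 = (y ^+ 2) ^+ 2 by rewrite -exprM.
have : 0 <= `|x| := normr_ge0 x; set z := `|x| => z0; have := sqr_ge0 y; set u := y ^+ 2 => u0.
have := sqr_ge0 (z - u); have := sqr_ge0 (z ^+ 2 - 1); nra.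
Qed.

Let S_win n : smeas X (iota 0 (n + K)) (S n).
Proof.
rewrite /S; under eq_fun do rewrite big_nat.
apply: smeas_sum => l /= ln; apply: smeas_sub (@xi_win l) => //; first exact: iota_uniq.
by move=> j; rewrite !mem_iota; lia.
Qed.

Section Step.
Variables (dl alpha : R).
Hypotheses (dl0 : 0 < dl) (dl1 : dl <= 1).

Let dlge0 : 0 <= dl. Proof. exact: ltW. Qed.
Let dl3 : 0 <= dl ^+ 3. Proof. exact: exprn_ge0. Qed.

(** The step size and the phase stay fixed while [n] grows; [dl] becomes the inverse square root of
    the number of terms only at the very end. *)
Let th n w := dl * S n w + alpha.
Let c n := mean P (fun w => cos (th n w)).

Let th_win n : smeas X (iota 0 (n + K)) (th n).
Proof.
apply: smeasD; last exact: smeas_cst.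
by apply: smeasM; [exact: smeas_cst|exact: S_win].
Qed.

Let mcos : measurable_fun setT (@cos R).
Proof. exact: continuous_measurable_fun (@continuous_cos R). Qed.
Let msin : measurable_fun setT (@sin R).
Proof. exact: continuous_measurable_fun (@continuous_sin R). Qed.

Let mth n : measurable_fun setT (th n).
Proof. exact (smeas_meas iidX (@th_win n)). Qed.
Let mcth n : measurable_fun setT (fun w => cos (th n w)).
Proof. exact: measurableT_comp mcos (@mth n). Qed.
Let msth n : measurable_fun setT (fun w => sin (th n w)).
Proof. exact: measurableT_comp msin (@mth n). Qed.
Let icth n : integ P (fun w => cos (th n w)).
Proof. by apply: (integ_bounded _ (@mcth n)) => w; exact: cos_max. Qed.

Let icx2 n k : integ P (fun w => cos (th k w) * xi n w ^+ 2).
Proof.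
apply: integ_le (xi_2 n) _.
  by apply: measurable_funM => //; exact: measurable_funX.
move=> w; rewrite normrM (ger0_norm (sqr_ge0 _)).
by rewrite ler_piMl ?sqr_ge0// cos_max.
Qed.

Let isx n : integ P (fun w => sin (th n w) * xi n w).
Proof.
apply: integ_le (integ_norm (xi_1 n)) _; first exact: measurable_funM.
by move=> w; rewrite normrM ler_piMl// sin_max.
Qed.

(** The remainder of the expansion is [dl ^+ 3 * |xi| ^+ 3 + dl ^+ 4 * xi ^+ 4]; as [dl <= 1], the
    quartic part is absorbed into order [dl ^+ 3]. *)
Let main_step n : `|c n.+1 - (c n - dl ^+ 2 / 2 *
   mean P (fun w => cos (th n w) * xi n w ^+ 2))| <= dl ^+ 3 * (1 + 2 * M).
Proof.
have z : mean P (fun w => sin (th n w) * xi n w) = 0.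
  apply: (xi_md (c := 1)); last by move=> w; exact: sin_max.
  exact: smeas_comp msin (@th_win n).
pose H w := cos (th n w) - dl * (sin (th n w) * xi n w)
            - dl ^+ 2 / 2 * (cos (th n w) * xi n w ^+ 2).
have iH : integ P H.
  by apply: integB; [apply: integB => //; exact: integZ|exact: integZ].
have -> : c n - dl ^+ 2 / 2 * mean P (fun w => cos (th n w) * xi n w ^+ 2) = mean P H.
  rewrite /H meanB; [|by apply: integB => //; exact: integZ|exact: integZ].
  rewrite meanB//; last exact: integZ.
  by rewrite !meanZ// z mulr0 subr0.
rewrite /c -meanB//.
have i4 : integ P (fun w => dl ^+ 3 * (1 + 2 * xi n w ^+ 4)).
  by apply: integZ; apply: integD; [exact: integ_cst|exact: integZ].
apply: le_trans (mean_le_norm _ i4 _) _.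
- by apply: measurable_funB => //; exact: integ_meas iH.
- move=> w; rewrite /H.
  have -> : th n.+1 w = th n w + dl * xi n w.
    by rewrite /th /S big_nat_recr//=; ring.
  have -> : cos (th n w) - dl * (sin (th n w) * xi n w)
     - dl ^+ 2 / 2 * (cos (th n w) * xi n w ^+ 2) =
     cos (th n w) - (dl * xi n w) * sin (th n w)
     - (dl * xi n w) ^+ 2 / 2 * cos (th n w) by rewrite exprMn; ring.
  apply: le_trans (cos_taylor _ _) _.
  rewrite normrM !exprMn (ger0_norm dlge0).
  have -> : dl ^+ 4 = dl ^+ 3 * dl by rewrite exprSr.
  rewrite -[dl ^+ 3 * dl * _]mulrA -mulrDr ler_wpM2l//.
  have := pow3 (xi n w).
  have : 0 <= xi n w ^+ 4 by apply: exprn_even_ge0.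
  by move=> x4 h; have h' : dl * xi n w ^+ 4 <= xi n w ^+ 4 := ler_piMl x4 dl1; lra.
rewrite meanZ; last by apply: integD; [exact: integ_cst|exact: integZ].
rewrite meanD; [|exact: integ_cst|exact: integZ].
rewrite mean_cst meanZ// ler_wpM2l//.
by have := xi_M n; lra.
Qed.

Let th_back n w : `|th n w - th (n - K) w| <=
  dl * \sum_(n - K <= l < n) `|xi l w|.
Proof.
have -> : th n w - th (n - K) w = dl * \sum_(n - K <= l < n) xi l w.
  rewrite /th /S (@big_cat_nat _ _ _ (n - K)%N 0%N n)//= ?leq_subr//; ring.
by rewrite normrM ger0_norm// ler_wpM2l// ler_norm_sum.
Qed.

Let sum_le n (a : R) : 0 <= a -> \sum_(n - K <= l < n) a <= K%:R * a.
Proof.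
move=> a0; rewrite sumr_const_nat -[leLHS]mulr_natl ler_wpM2r// ler_nat; lia.
Qed.

(* [xi n] depends only on X_n, ..., X_(n+K), hence is independent of [th (n - K)]. *)
Let back1 n : `|c n - c (n - K)| <= dl * (K%:R * (1 + M)).
Proof.
have i4 l : integ P (fun w => 1 + xi l w ^+ 4) by apply: integD => //; exact: integ_cst.
rewrite /c -meanB//; apply: le_trans (mean_le_norm _
  (integZ dl (integ_sum (index_iota (n - K) n) (p := predT) (fun l _ => i4 l))) _) _.
- exact: measurable_funB.
- move=> w; apply: le_trans (norm_cosB _ _) _; apply: le_trans (th_back _ _) _.
  by rewrite ler_wpM2l ?ler_sum.
rewrite meanZ; last by apply: integ_sum.
rewrite ler_wpM2l//.
rewrite mean_sum//; apply: le_trans (sum_le n _); last by have := M0; lra.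
apply: ler_sum => l _; rewrite meanD//; last exact: integ_cst.
by rewrite mean_cst lerD2l.
Qed.

(** Replacing [th n] by [th (n - K)] changes the angle by at most [K] increments of [xi] times [dl];
    after that the mean factorizes and [xi n ^+ 2] contributes [q]. *)
Let back2 n : `|mean P (fun w => cos (th n w) * xi n w ^+ 2) -
   q * c (n - K)| <= dl * (K%:R * (1 + 2 * M)).
Proof.
have -> : q * c (n - K) = mean P (fun w => cos (th (n - K) w) * xi n w ^+ 2).
  have [nK|nK] := leqP K n.
    (* [th (n - K)] depends on indices below [n] and [xi n] on [n, ..., n + K], so the two windows
       are disjoint. *)
    have us : uniq (iota 0 n ++ iota n K.+1) by rewrite -iotaD iota_uniq.
    have w1 : smeas X (iota 0 n) (fun w => cos (th (n - K) w)).
      by apply: smeas_comp => //; have := @th_win (n - K); rewrite subnK.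
    have w2 : smeas X (iota n K.+1) (fun w => xi n w ^+ 2).
      by apply: (smeas_comp (f := fun x => x ^+ 2)) => //; exact: measurable_funX.
    by have [_ ->] := mean_window iidX us w1 w2 (icth _) (xi_2 n); rewrite xi_q mulrC.
  (* For [n < K] the truncated difference [n - K] is 0, the partial sum is empty and the cosine is a
     constant. *)
  have E w : th (n - K) w = alpha.
    by rewrite /th /S big_geq ?mulr0 ?add0r//; lia.
  rewrite /c; under eq_mean do rewrite E.
  by under [RHS]eq_mean do rewrite E; rewrite mean_cst meanZ// xi_q mulrC.
have i4 l : integ P (fun w => 1 + xi l w ^+ 4 + xi n w ^+ 4).
  by do 2 apply: integD => //; exact: integ_cst.
rewrite -meanB//; apply: le_trans (mean_le_norm _
  (integZ dl (integ_sum (index_iota (n - K) n) (p := predT) (fun l _ => i4 l))) _) _.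
- by apply: measurable_funB => //; apply: measurable_funM => //; exact: measurable_funX.
- move=> w; rewrite -mulrBl normrM (ger0_norm (sqr_ge0 _)).
  apply: le_trans (_ : (dl * \sum_(n - K <= l < n) `|xi l w|) * xi n w ^+ 2 <= _).
    rewrite ler_wpM2r ?sqr_ge0//; apply: le_trans (norm_cosB _ _) _; exact: th_back.
  rewrite -mulrA ler_wpM2l//.
  by rewrite mulr_suml ler_sum.
rewrite meanZ; last by apply: integ_sum.
rewrite ler_wpM2l//.
rewrite mean_sum//; apply: le_trans (sum_le n _); last by have := M0; lra.
apply: ler_sum => l _; rewrite meanD//; last by apply: integD => //; exact: integ_cst.
rewrite meanD//; last exact: integ_cst.
by rewrite mean_cst; have := xi_M l; have := xi_M n; lra.
Qed.

(** The three summands come from the Taylor remainder, from going back in the quadratic term and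
    from going forward again in the cosine mean. *)
Let B := (1 + 2 * M) + K%:R * (1 + 2 * M) + q * (K%:R * (1 + M)).

Let step n : `|c n.+1 - (1 - dl ^+ 2 * q / 2) * c n| <= dl ^+ 3 * B.
Proof.
have := main_step n; have := back1 n; have := back2 n.
set m := mean P _; set c' := c (n - K).
set D1 := K%:R * (1 + 2 * M); set D2 := K%:R * (1 + M) => h2 h1 h0.
have -> : c n.+1 - (1 - dl ^+ 2 * q / 2) * c n =
  (c n.+1 - (c n - dl ^+ 2 / 2 * m)) - dl ^+ 2 / 2 * (m - q * c')
  + dl ^+ 2 / 2 * q * (c n - c') by field.
have d2 : 0 <= dl ^+ 2 / 2 by rewrite divr_ge0// sqr_ge0.
apply: le_trans (ler_normD _ _) _; apply: le_trans (lerD (ler_normB _ _) (lexx _)) _.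
rewrite [in X in _ + X + _]normrM [in X in _ + _ + X]normrM.
rewrite (ger0_norm d2) (ger0_norm (x := _ * q)) ?mulr_ge0//.
have D10 : 0 <= D1 by rewrite mulr_ge0//; have := M0; lra.
have D20 : 0 <= D2 by rewrite mulr_ge0//; have := M0; lra.
have k1 : dl ^+ 2 / 2 * `|m - q * c'| <= dl ^+ 2 * (dl * D1).
  apply: ler_pM => //; have := sqr_ge0 dl; lra.
have k2 : dl ^+ 2 / 2 * q * `|c n - c'| <= dl ^+ 2 * q * (dl * D2).
  apply: ler_pM => //; first by rewrite mulr_ge0.
  by rewrite ler_wpM2r//; have := sqr_ge0 dl; lra.
rewrite /B -/D1 -/D2; have -> : dl ^+ 3 * (1 + 2 * M + D1 + q * D2) =
  dl ^+ 3 * (1 + 2 * M) + dl ^+ 2 * (dl * D1) + dl ^+ 2 * q * (dl * D2) by ring.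
by rewrite !lerD.
Qed.

Let B' := B + q ^+ 2.

(** With [y = dl ^+ 2 * q / 2], replacing [1 - y] by [expR (- y)] costs
    [y ^+ 2 <= dl ^+ 3 * q ^+ 2]. The multiplier then lies in [0, 1] whatever [q] is, and its powers
    are exact exponentials. *)
Let step_exp n : `|c n.+1 - expR (- (dl ^+ 2 * q / 2)) * c n| <= dl ^+ 3 * B'.
Proof.
set y := dl ^+ 2 * q / 2.
have y0 : 0 <= y by rewrite divr_ge0// mulr_ge0// sqr_ge0.
have -> : c n.+1 - expR (- y) * c n = (c n.+1 - (1 - y) * c n) - (expR (- y) - (1 - y)) * c n.
  by ring.
apply: le_trans (ler_normB _ _) _; rewrite /B' mulrDr lerD//.
rewrite normrM; apply: le_trans (_ : y ^+ 2 * 1 <= _).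
  rewrite ler_pM//; first exact: expR_quad.
  apply: le_trans (mean_norm (icth n)) _; rewrite -[leRHS](mean_cst P).
  apply: mean_le; [exact: integ_norm|exact: integ_cst|].
  by move=> w; exact: cos_max.
rewrite /y mulr1 expr_div_n exprMn -exprM.
have -> : dl ^+ (2 * 2) = dl ^+ 3 * dl by rewrite -exprSr.
have -> : dl ^+ 3 * dl * q ^+ 2 / 2 ^+ 2 = dl ^+ 3 * (q ^+ 2 * (dl / 4)) by field.
by rewrite ler_wpM2l// ler_piMr ?sqr_ge0// ler_pdivrMr// mul1r (le_trans dl1)// ler1n.
Qed.

(** The multiplier is at most 1, so the one-step errors merely add up; for [n = 0] there is no
    error. *)
Lemma char_step n : `|mean P (fun w => cos (dl * S n w + alpha)) -
   cos alpha * expR (- (dl ^+ 2 * q / 2)) ^+ n| <= n%:R * (dl ^+ 3 * B').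
Proof.
elim: n => [|n IH].
  rewrite mul0r expr0 mulr1; under eq_mean do rewrite /S big_geq// mulr0 add0r.
  by rewrite mean_cst subrr normr0.
set a := expR _ in IH *.
have a01 : 0 <= a <= 1.
  rewrite expR_ge0 expR_le1 oppr_le0 divr_ge0// mulr_ge0// sqr_ge0//.
rewrite -/(th _ _) -/(c n.+1).
have -> : mean P (fun w => cos (dl * S n.+1 w + alpha)) - cos alpha * a ^+ n.+1 =
  (c n.+1 - a * c n) + a * (c n - cos alpha * a ^+ n).
  by rewrite exprS /c /th; ring.
apply: le_trans (ler_normD _ _) _; rewrite -[in leRHS]natr1 mulrDl mul1r addrC lerD//.
  rewrite normrM -[leRHS]mul1r ler_pM//; rewrite ger0_norm; lra.
Qed.

End Step.

Lemma char_clt : exists B : R, forall (alpha : R) (N : nat), (0 < N)%N ->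
  `|mean P (fun w => cos ((Num.sqrt N%:R)^-1 * (\sum_(0 <= l < N) xi l w) + alpha)) -
    cos alpha * expR (- q / 2)| <= B / Num.sqrt N%:R.
Proof.
eexists => alpha N N0; set dl := (Num.sqrt N%:R)^-1.
have N1 : 1 <= N%:R :> R by rewrite ler1n.
have s1 : 1 <= Num.sqrt (N%:R : R) by rewrite -[leLHS]sqrtr1 ler_wsqrtr.
have dl0 : 0 < dl by rewrite invr_gt0; lra.
have dl1 : dl <= 1 by rewrite invf_le1//; lra.
have dlN : N%:R * dl ^+ 2 = 1.
  by rewrite exprVn sqr_sqrtr ?divff//; lra.
have := char_step alpha dl0 dl1 N; rewrite -expRM_natl.
have -> : N%:R * - (dl ^+ 2 * q / 2) = - q / 2 * (N%:R * dl ^+ 2) by ring.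
rewrite dlN mulr1 => /le_trans; apply.
(* [N * dl ^+ 3 = dl]: the accumulated error has order N^(-1/2). The pending constant is fixed here
   and depends only on [K], [M] and [q]. *)
rewrite mulrA (exprS dl 2) mulrCA dlN mulr1 mulrC; exact: lexx.
Qed.

End CLT.

(** * Approximation by trigonometric polynomials *)

(* The binomial weight ['C(n, k) * u ^+ k * (1 - u) ^+ (n - k)]. *)
Fixpoint bern (R : realType) (u : R) (n k : nat) : R :=
  if n is n'.+1 then
    (if k is k'.+1 then u * bern u n' k' else 0) + (1 - u) * bern u n' k
  else (k == 0%N)%:R.

Section Bernstein.
Context {R : realType}.
Implicit Types u : R.

Lemma bern_small u n k : (n < k)%N -> bern u n k = 0.
Proof.
elim: n k => [|n IH] [|k]//= nk.
by rewrite !IH ?mulr0 ?addr0//; exact: ltnW.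
Qed.

(** Conditioning on one of [n + 1] independent trials: with probability [u] it succeeds and shifts
    the count by one. *)
Lemma bern_rec u n (phi : nat -> R) :
  \sum_(k < n.+2) bern u n.+1 k * phi k =
  u * (\sum_(k < n.+1) bern u n k * phi k.+1) +
  (1 - u) * \sum_(k < n.+1) bern u n k * phi k.
Proof.
under eq_bigr do rewrite /= mulrDl.
rewrite big_split/=; congr (_ + _).
  rewrite big_ord_recl/= mul0r add0r mulr_sumr.
  by apply: eq_bigr => i _; rewrite mulrA.
rewrite big_ord_recr/= bern_small// mulr0 mul0r addr0 mulr_sumr.
by apply: eq_bigr => i _; rewrite mulrA.
Qed.

Lemma bern_ge0 u n k : 0 <= u <= 1 -> 0 <= bern u n k.
Proof.
move=> /andP[u0 u1]; elim: n k => [|n IH] k /=; first by rewrite ler0n.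
rewrite addr_ge0// ?mulr_ge0// ?subr_ge0//.
by case: k => // k; rewrite mulr_ge0.
Qed.

Lemma bern_sum u n : \sum_(k < n.+1) bern u n k = 1.
Proof.
elim: n => [|n IH]; first by rewrite big_ord1.
have := bern_rec u n (fun=> 1).
under eq_bigr do rewrite mulr1.
by under [in RHS]eq_bigr do rewrite mulr1; rewrite IH => ->; ring.
Qed.

(** The binomial variance. The first centered moment [A] enters the two branches with opposite
    weights and cancels, so its value is never computed. *)
Lemma bern_var u n :
  \sum_(k < n.+1) bern u n k * (k%:R - n%:R * u) ^+ 2 = n%:R * (u * (1 - u)).
Proof.
elim: n => [|n IH]; first by rewrite big_ord1/= !mul0r subr0 expr0n mulr0.
rewrite (bern_rec u n (fun k => (k%:R - n.+1%:R * u) ^+ 2)).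
set A := \sum_(k < n.+1) bern u n k * (k%:R - n%:R * u).
have E (c : R) : \sum_(k < n.+1) bern u n k * (k%:R - n%:R * u + c) ^+ 2 =
    n%:R * (u * (1 - u)) + 2 * c * A + c ^+ 2.
  have e1 : c ^+ 2 = c ^+ 2 * \sum_(k < n.+1) bern u n k by rewrite bern_sum mulr1.
  rewrite -IH /A [in RHS]e1 !mulr_sumr -!big_split/=.
  by apply: eq_bigr => k _; ring.
have -> : \sum_(k < n.+1) bern u n k * (k.+1%:R - n.+1%:R * u) ^+ 2 =
    n%:R * (u * (1 - u)) + 2 * (1 - u) * A + (1 - u) ^+ 2.
  by rewrite -E; apply: eq_bigr => k _; congr (_ * _ ^+ 2); rewrite -!natr1; ring.
have -> : \sum_(k < n.+1) bern u n k * (k%:R - n.+1%:R * u) ^+ 2 =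
    n%:R * (u * (1 - u)) + 2 * (- u) * A + (- u) ^+ 2.
  by rewrite -E; apply: eq_bigr => k _; congr (_ * _ ^+ 2); rewrite -!natr1; ring.
by rewrite -natr1; ring.
Qed.

Lemma bern_var_le u n : (0 < n)%N -> 0 <= u <= 1 ->
  \sum_(k < n.+1) bern u n k * (u - k%:R / n%:R) ^+ 2 <= n%:R^-1.
Proof.
move=> n0 /andP[u0 u1]; have n1 : 0 < n%:R :> R by rewrite ltr0n.
have -> : \sum_(k < n.+1) bern u n k * (u - k%:R / n%:R) ^+ 2 =
    n%:R ^- 2 * (n%:R * (u * (1 - u))).
  rewrite -bern_var mulr_sumr; apply: eq_bigr => k _; field.
  by rewrite gt_eqF.
have -> : n%:R ^- 2 * (n%:R * (u * (1 - u))) = n%:R^-1 * (u * (1 - u)).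
  by field; rewrite gt_eqF.
rewrite ler_piMr ?invr_ge0 ?(ltW n1)//; nra.
Qed.

End Bernstein.

(** With a free phase, cosines alone are enough: constants have frequency 0, sines have phase
    [- (pi / 2)], and a product of two cosines is again a sum of cosines. *)
Inductive trigpoly (R : realType) (D : nat) : ('rV[R]_D -> R) -> Prop :=
| trig_cos (c : R) (t : 'rV[R]_D) (a : R) : trigpoly (fun x => c * cos ((t *m x^T) 0 0 + a))
| trig_add f g : trigpoly f -> trigpoly g -> trigpoly (fun x => f x + g x).

Section Trig.
Context {R : realType} {D : nat}.
Implicit Types f g : 'rV[R]_D -> R.

Lemma trig_cst c : trigpoly (fun _ : 'rV[R]_D => c).
Proof.
have := trig_cos c (0 : 'rV[R]_D) 0.
by under eq_fun do rewrite mul0mx mxE addr0 cos0 mulr1.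
Qed.

Lemma trig_mul f g : trigpoly f -> trigpoly g -> trigpoly (fun x => f x * g x).
Proof.
move=> tf tg; elim: tf => [c t a|f1 f2 _ h1 _ h2]; last first.
  by under eq_fun do rewrite mulrDl; exact: trig_add.
elim: tg => [c' t' a'|g1 g2 _ h1 _ h2]; last first.
  by under eq_fun do rewrite mulrDr; exact: trig_add.
have := trig_add (trig_cos (c * c' / 2) (t + t') (a + a'))
                 (trig_cos (c * c' / 2) (t - t') (a - a')).
congr trigpoly; apply/funext => x; rewrite mulmxDl mulmxBl !mxE.
set p := \sum_j _; set q := \sum_j _.
rewrite (_ : p + q + (a + a') = (p + a) + (q + a')); last by ring.
rewrite (_ : p - q + (a - a') = (p + a) - (q + a')); last by ring.
by rewrite cosD cosB; field.
Qed.

Lemma trig_sum (I : Type) (s : seq I) (p : pred I) (F : I -> 'rV[R]_D -> R) :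
  (forall i, p i -> trigpoly (F i)) ->
  trigpoly (fun x => \sum_(i <- s | p i) F i x).
Proof.
move=> tF; elim: s => [|i s IH].
  by under eq_fun do rewrite big_nil; exact: trig_cst.
under eq_fun do rewrite big_cons; case: (boolP (p i)) => // pi.
by apply: trig_add => //; exact: tF.
Qed.

Lemma trig_prod (I : Type) (s : seq I) (p : pred I) (F : I -> 'rV[R]_D -> R) :
  (forall i, p i -> trigpoly (F i)) ->
  trigpoly (fun x => \prod_(i <- s | p i) F i x).
Proof.
move=> tF; elim: s => [|i s IH].
  by under eq_fun do rewrite big_nil; exact: trig_cst.
under eq_fun do rewrite big_cons; case: (boolP (p i)) => // pi.
by apply: trig_mul => //; exact: tF.
Qed.

(** The recursion defining [bern] uses only sums and products, under which trigonometric polynomials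
    are closed. *)
Lemma trig_bern (u : 'rV[R]_D -> R) n k : trigpoly u -> trigpoly (fun x => bern (u x) n k).
Proof.
move=> tu; elim: n k => [|n IH] k /=; first exact: trig_cst.
apply: trig_add.
  by case: k => [|k]; [exact: trig_cst|exact: trig_mul].
apply: trig_mul => //.
have := trig_add (trig_cst 1) (trig_mul (trig_cst (-1)) tu).
by under eq_fun do rewrite mulN1r.
Qed.

Lemma trig_sin (c : R) (p : 'I_D) : trigpoly (fun x => (1 + sin (c * x 0 p)) / 2).
Proof.
have := trig_mul (trig_add (trig_cst 1) (trig_cos 1 (c *: delta_mx 0 p) (- (pi / 2))))
  (trig_cst 2^-1).
congr trigpoly; apply/funext => x; rewrite cosBpihalf mul1r.
congr ((1 + sin _) / 2); rewrite -scalemxAl mxE -rowE mxE.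
by rewrite [in LHS]mxE.
Qed.

End Trig.

(** * Approximation on a cube with a bound valid everywhere *)

Section Approx.
Context {R : realType} {D : nat}.
Variables (h : 'rV[R]_D -> R) (M L : R).
Hypotheses (ch : continuous h) (hM : forall x, `|h x| <= M) (L0 : 0 < L).

(** Scales [[-L, L]] to [[- pi / 2, pi / 2]], where the sine is injective. *)
Let tau := pi / 2 / L.
(** A trigonometric coordinate, injective on [[-L, L]], with values in [0, 1] on the whole line; the
    latter keeps the Bernstein weights nonnegative outside the cube as well. *)
Let v (t : R) := (1 + sin (tau * t)) / 2.
Let cube (x : 'rV[R]_D) := forall p, `|x 0 p| <= L.

Let tau0 : 0 < tau.
Proof. by rewrite !divr_gt0// pi_gt0. Qed.

Let tauL : tau * L = pi / 2.
Proof. by rewrite /tau divfK// gt_eqF. Qed.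

Let in_tau t : `|t| <= L -> tau * t \in `[- (pi / 2), pi / 2].
Proof.
rewrite in_itv/= -ler_norml normrM (ger0_norm (ltW tau0)) -tauL.
by rewrite ler_pM2l.
Qed.

Let v_inj s t : `|s| <= L -> `|t| <= L -> v s = v t -> s = t.
Proof.
move=> sL tL /(congr1 (fun z => z * 2 - 1)); rewrite /v.
rewrite !divfK// !(addrC 1) !addrK => /(sin_inj (in_tau sL) (in_tau tL)).
by apply: mulfI; rewrite gt_eqF.
Qed.

Let v01 t : 0 <= v t <= 1.
Proof. by rewrite /v; have := sin_geN1 (tau * t); have := sin_le1 (tau * t); lra. Qed.

Let cv : continuous v.
Proof.
move=> t; apply: cvgM; last exact: cvg_cst.
apply: cvgD; first exact: cvg_cst.
by apply: continuous_comp; [exact: mulrl_continuous|exact: continuous_sin].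
Qed.

Let M0 : 0 <= M. Proof. by apply: le_trans (hM 0). Qed.

(* [v] is injective on [-L, L], so [h] is uniformly continuous on the cube with
   respect to the pseudo-distance read off [v]. *)
Let modulus (eps : R) : 0 < eps -> exists2 C : R, 0 <= C & forall x y, cube x -> cube y ->
  `|h x - h y| <= eps + C * \sum_p (v (x 0 p) - v (y 0 p)) ^+ 2.
Proof.
move=> e0; apply: contrapT => nC.
(* If no constant works, [C = n] fails for every [n]; the violating pairs stay in a compact set and
   have a cluster point. *)
have H (n : nat) : exists z : 'rV[R]_D * 'rV[R]_D, [/\ cube z.1, cube z.2 &
    eps + n%:R * \sum_p (v (z.1 0 p) - v (z.2 0 p)) ^+ 2 < `|h z.1 - h z.2|].
  apply: contrapT => nz; apply: nC; exists n%:R => // x y cx cy.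
  by rewrite leNgt; apply/negP => xy; apply: nz; exists (x, y).
have [u uP] := choice H.
have cub : compact [set x : 'rV[R]_D | forall p, `[- L, L]%classic (x 0 p)].
  exact: (@rV_compact R D (fun=> `[- L, L]%classic) (fun=> @segment_compact R _ _)).
have cube_in x : cube x -> forall p, `[- L, L]%classic (x 0 p).
  by move=> cx p; rewrite /= in_itv/= -ler_norml.
have [z [[/= z1 z2] clz]] : (([set x : 'rV[R]_D | forall p, `[- L, L]%classic (x 0 p)] `*`
    [set x : 'rV[R]_D | forall p, `[- L, L]%classic (x 0 p)]) `&` cluster (u @ \oo)) !=set0.
  apply: (compact_setX cub cub); exists 0%N => // n _ /=.
  by have [/cube_in c1 /cube_in c2 _] := uP n.
have cw p : continuous (fun y : 'rV[R]_D * 'rV[R]_D => v (y.1 0 p) - v (y.2 0 p)).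
  move=> y; apply: cvgB.
    apply: (@continuous_comp _ _ _ (fun y : 'rV[R]_D * 'rV[R]_D => y.1 0 p) v); last exact: cv.
    by apply: (@continuous_comp _ _ _ fst (fun x : 'rV[R]_D => x 0 p));
      [exact: cvg_fst|exact: coord_continuous].
  apply: (@continuous_comp _ _ _ (fun y : 'rV[R]_D * 'rV[R]_D => y.2 0 p) v); last exact: cv.
  by apply: (@continuous_comp _ _ _ snd (fun x : 'rV[R]_D => x 0 p));
    [exact: cvg_snd|exact: coord_continuous].
have ck : continuous (fun y : 'rV[R]_D * 'rV[R]_D => `|h y.1 - h y.2|).
  move=> y; apply: cvg_norm; apply: cvgB.
    by apply: (@continuous_comp _ _ _ fst h); [exact: cvg_fst|exact: ch].
  by apply: (@continuous_comp _ _ _ snd h); [exact: cvg_snd|exact: ch].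
(* The cluster point is on the diagonal: if its coordinates [p] differed, the sum of squares would
   stay above [(|w| / 2) ^+ 2] at nearby pairs, and multiplied by a large [n] it would exceed
   [2 * M], which bounds the oscillation of [h]. *)
have z12 : z.1 = z.2.
  apply/rowP => p; apply: v_inj; [have := z1 p|have := z2 p|];
    rewrite ?(in_itv, ler_norml)//=.
  apply: contrapT => vp; set w := v (z.1 0 p) - v (z.2 0 p).
  have w0 : 0 < `|w| by rewrite normr_gt0 subr_eq0; apply/eqP.
  have B : nbhs z [set y : 'rV[R]_D * 'rV[R]_D | `|w| / 2 < `|v (y.1 0 p) - v (y.2 0 p)|].
    have cn : (fun y : 'rV[R]_D * 'rV[R]_D => `|v (y.1 0 p) - v (y.2 0 p)|) @ z --> `|w|.
      by apply: cvg_norm; exact: cw.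
    by apply: (cvgr_gt _ cn); rewrite ltr_pdivrMr// ltr_pMr// ltr1n.
  have [N] : exists N : nat, 2 * M / (`|w| / 2) ^+ 2 <= N%:R.
    exists (Num.trunc (2 * M / (`|w| / 2) ^+ 2)).+1.
    by apply: ltW; rewrite truncnS_gt.
  rewrite ler_pdivrMr ?exprn_gt0 ?divr_gt0// => HN.
  have A : (u @ \oo) [set u n | n in [set n | (N <= n)%N]].
    by exists N => // n /= Nn; exists n.
  have [_ [[n /= Nn <-] /=]] := clz _ _ A B.
  have [_ _] := uP n; set S := \sum_p _; set a := v _ - v _ => h1 h2.
  have h3 : a ^+ 2 <= S.
    by rewrite /S (bigD1 p)//= lerDl sumr_ge0// => j _; exact: sqr_ge0.
  have h4 : (`|w| / 2) ^+ 2 <= a ^+ 2.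
    rewrite -[leRHS]real_normK ?num_real// ler_sqr ?nnegrE ?divr_ge0//; exact: ltW.
  have h5 : `|h (u n).1 - h (u n).2| <= 2 * M.
    apply: le_trans (ler_normB _ _) _.
    by have := hM (u n).1; have := hM (u n).2; lra.
  have h6 : N%:R * (`|w| / 2) ^+ 2 <= n%:R * S.
    by rewrite ler_pM ?ler_nat ?exprn_ge0 ?divr_ge0// (le_trans h4).
  lra.
(* On the diagonal, continuity makes the oscillation smaller than [eps] near the cluster point,
   against the choice of the violating pairs. *)
have B : nbhs z [set y : 'rV[R]_D * 'rV[R]_D | `|h y.1 - h y.2| < eps].
  by apply: (cvgr_lt _ (ck z)); rewrite z12 subrr normr0.
have A : (u @ \oo) (range u) by exists 0%N => // n _; exists n.
have [_ [[n _ <-] /=]] := clz _ _ A B.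
have [_ _] := uP n; set S := \sum_p _ => h1 h2.
have : 0 <= n%:R * S by rewrite mulr_ge0// sumr_ge0// => j _; exact: sqr_ge0.
lra.
Qed.

(* Bernstein polynomials in the variables [v (x 0 p)]; being averages of values of
   [h], they keep its bound [M] on the whole space. *)
Lemma trig_approx (eps : R) : 0 < eps -> exists2 f : 'rV[R]_D -> R, trigpoly f &
  (forall x, `|f x| <= M) /\ (forall x : 'rV[R]_D, (forall p, `|x 0 p| <= L) -> `|h x - f x| <= eps).
Proof.
move=> e0; have [|C C0 hC] := modulus (eps := eps / 2); first by rewrite divr_gt0.
(* The degree is such that [D] coordinate variances of size at most [1 / n], multiplied by the
   modulus constant [C], add up to at most [eps / 2]. *)
pose n := (Num.trunc (C * D%:R / (eps / 2))).+1.
have n0 : (0 < n)%N by [].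
have nC : C * (D%:R / n%:R) <= eps / 2.
  have : C * D%:R / (eps / 2) < n%:R by exact: truncnS_gt.
  rewrite ltr_pdivrMr ?divr_gt0// => /ltW.
  by rewrite [C * (_ / _)]mulrA ler_pdivrMr ?ltr0n// [_ * n%:R]mulrC.
(* The grid point of [[-L, L]] whose image under [v] is [k / n]. *)
pose y (k : 'I_n.+1) : R := asin (2 * (k%:R / n%:R) - 1) / tau.
have k01 (k : 'I_n.+1) : 0 <= (k%:R / n%:R : R) <= 1.
  by rewrite divr_ge0//= ler_pdivrMr ?ltr0n// mul1r ler_nat -ltnS.
have yL k : `|y k| <= L.
  have r := k01 k; rewrite /y normrM normfV (ger0_norm (ltW tau0)).
  rewrite ler_pdivrMr// [L * _]mulrC tauL ler_norml.
  by rewrite asin_geNpi2 ?asin_lepi2//; lra.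
have vy k : v (y k) = k%:R / n%:R.
  have r := k01 k; rewrite /v /y [tau * _]mulrC divfK ?gt_eqF// asinK ?in_itv/=; last by lra.
  by field; rewrite pnatr_eq0.
pose W (x : 'rV[R]_D) (k : {ffun 'I_D -> 'I_n.+1}) := \prod_p bern (v (x 0 p)) n (k p).
pose Y (k : {ffun 'I_D -> 'I_n.+1}) : 'rV[R]_D := \row_p y (k p).
have W0 x k : 0 <= W x k by apply: prodr_ge0 => p _; exact: bern_ge0.
have W1 x : \sum_k W x k = 1.
  rewrite /W -(bigA_distr_bigA (fun p (k : 'I_n.+1) => bern (v (x 0 p)) n k))/=.
  by rewrite big1// => p _; exact: bern_sum.
have W2 x p0 : \sum_k W x k * (v (x 0 p0) - v (Y k 0 p0)) ^+ 2 <= n%:R^-1.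
  (* The squared deviation is moved into the factor of index [p0], so the sum over multi-indices
     becomes a product of one-dimensional sums, all equal to 1 except the one at [p0]. *)
  pose G p (k : 'I_n.+1) := bern (v (x 0 p)) n k *
    (if p == p0 then (v (x 0 p0) - k%:R / n%:R) ^+ 2 else 1).
  have -> : \sum_k W x k * (v (x 0 p0) - v (Y k 0 p0)) ^+ 2 =
      \sum_(k : {ffun 'I_D -> 'I_n.+1}) \prod_p G p (k p).
    apply: eq_bigr => k _; rewrite /G big_split/= -/(W x k); congr (_ * _).
    rewrite (bigD1 p0)//= eqxx big1 ?mulr1; last by move=> p /negbTE ->.
    by rewrite mxE vy.
  rewrite -(bigA_distr_bigA G) (bigD1 p0)//= [X in _ * X]big1 ?mulr1; last first.
    move=> p /negbTE pp0; rewrite /G pp0 -[RHS](bern_sum (v (x 0 p)) n).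
    by apply: eq_bigr => k _; rewrite mulr1.
  by rewrite /G eqxx; apply: bern_var_le.
exists (fun x => \sum_k h (Y k) * W x k); last split.
- apply: trig_sum => k _; apply: trig_mul; first exact: trig_cst.
  by apply: trig_prod => p _; apply: trig_bern; exact: trig_sin.
- move=> x; apply: le_trans (ler_norm_sum _ _ _) _.
  rewrite -[M]mulr1 -(W1 x) mulr_sumr; apply: ler_sum => k _.
  by rewrite normrM (ger0_norm (W0 _ _)) ler_wpM2r.
move=> x cx; have -> : h x - \sum_k h (Y k) * W x k = \sum_k W x k * (h x - h (Y k)).
  rewrite -[h x in LHS]mul1r -(W1 x) mulr_suml -sumrB.
  by apply: eq_bigr => k _; ring.
apply: le_trans (ler_norm_sum _ _ _) _.
apply: le_trans (_ : \sum_k (W x k * (eps / 2) +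
    C * \sum_p W x k * (v (x 0 p) - v (Y k 0 p)) ^+ 2) <= _).
  apply: ler_sum => k _; rewrite normrM (ger0_norm (W0 _ _)).
  have -> : W x k * (eps / 2) + C * (\sum_p W x k * (v (x 0 p) - v (Y k 0 p)) ^+ 2) =
     W x k * (eps / 2 + C * \sum_p (v (x 0 p) - v (Y k 0 p)) ^+ 2).
    by rewrite -mulr_sumr; ring.
  rewrite ler_wpM2l// hC// => p; rewrite mxE; exact: yL.
rewrite big_split/= -mulr_suml W1 mul1r -mulr_sumr exchange_big/=.
have : \sum_(p < D) \sum_k W x k * (v (x 0 p) - v (Y k 0 p)) ^+ 2 <= D%:R / n%:R.
  apply: le_trans (ler_sum _ (fun p _ => W2 x p)) _.
  by rewrite sumr_const card_ord mulr_natl.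
move=> /(ler_wpM2l C0); lra.
Qed.

End Approx.

(** * From cosine means to convergence in distribution *)

Lemma min1_le (R : realType) (z L : R) : 0 < L -> Num.min 1 (`|z| / L) <= `|z| / L.
Proof. by move=> L0; rewrite ge_min lexx orbT. Qed.

Lemma min1_ge0 (R : realType) (z L : R) : 0 < L -> 0 <= Num.min 1 (`|z| / L).
Proof. by move=> L0; rewrite le_min ler01 divr_ge0// ltW. Qed.

Section WeakLimits.
Context (d : measure_display) (T : measurableType d) (R : realType).
Variable P : probability T R.

Lemma measurable_min1 (F : T -> R) (L : R) : measurable_fun setT F ->
  measurable_fun setT (fun w => Num.min 1 (`|F w| / L)).
Proof.
move=> mF; apply: measurable_minr => //.
by apply: measurable_funM => //; exact: measurableT_comp.
Qed.

Lemma integ_min1 (F : T -> R) (L : R) : 0 < L -> measurable_fun setT F ->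
  integ P (fun w => Num.min 1 (`|F w| / L)).
Proof.
move=> L0 mF; apply: (@integ_bounded _ _ _ P _ 1); first exact: measurable_min1.
by move=> w; rewrite ger0_norm ?min1_ge0// ge_min lexx.
Qed.

(** Dominated convergence along [L = n + 1] makes the truncated mean small for some [n]; it
    decreases in [L], so all larger [L] follow. *)
Lemma tight1 (F : T -> R) (eps : R) : measurable_fun setT F -> 0 < eps ->
  \forall L \near +oo, mean P (fun w => Num.min 1 (`|F w| / L)) <= eps.
Proof.
move=> mF e0.
pose f n w := (Num.min 1 (`|F w| / n.+1%:R))%:E.
have mf n : measurable_fun setT (f n).
  by apply/measurable_EFinP; exact: measurable_min1.
have cf0 : {ae P, forall w, setT w -> f ^~ w @ \oo --> 0%E}.
  apply: aeW => w _; apply: cvg_EFin; first exact: nearW.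
  apply: (@squeeze_cvgr _ _ _ _ (cst 0) (fun n => `|F w| * n.+1%:R^-1)).
  - by apply: nearW => n; rewrite /= min1_ge0//= min1_le.
  - exact: cvg_cst.
  - rewrite -(mulr0 `|F w|); apply: cvgM; first exact: cvg_cst.
    exact: cvg_harmonic.
have b1 : {ae P, forall w n, setT w -> (`|f n w| <= cst 1%E w)%E}.
  by apply: aeW => w n _; rewrite /= lee_fin ger0_norm ?min1_ge0// ge_min lexx.
have [_ _] := dominated_convergence measurableT mf (measurable_cst 0%E) cf0
  (finite_measure_integrable_cst P 1 measurableT) b1.
rewrite integral0 => /fine_cvgP[_ /cvgrPdist_le/(_ _ e0)[n _ /(_ n (leqnn n))]].
rewrite /= sub0r normrN => hn; near=> L.
have nL : n.+1%:R <= L by near: L; exact: nbhs_pinfty_ge.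
have L0 : 0 < L by apply: lt_le_trans nL; rewrite ltr0n.
apply: le_trans (le_trans (ler_norm _) hn).
apply: mean_le; [exact: integ_min1|exact: integ_min1|] => w.
rewrite le_min !ge_min lexx/=; apply/orP; right.
by rewrite ler_wpM2l// lef_pV2 ?posrE// ltr0n.
Unshelve. all: end_near. Qed.

End WeakLimits.

Section TrigMeas.
Context (d : measure_display) (T : measurableType d) (R : realType).
Variables (P : probability T R) (D : nat) (Y : T -> 'rV[R]_D).
Hypothesis mY : forall p, measurable_fun setT (fun w => Y w 0 p).

Lemma measurable_dot (t : 'rV[R]_D) (a : R) :
  measurable_fun setT (fun w => (t *m (Y w)^T) 0 0 + a).
Proof.
apply: measurable_funD => //; under eq_fun do rewrite mxE.
apply: measurable_sum => j; apply: measurable_funM => //.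
by under eq_fun do rewrite mxE; exact: mY.
Qed.

Lemma measurable_cos_dot (t : 'rV[R]_D) (a : R) :
  measurable_fun setT (fun w => cos ((t *m (Y w)^T) 0 0 + a)).
Proof.
apply: measurableT_comp; last exact: measurable_dot.
exact: continuous_measurable_fun (@continuous_cos R).
Qed.

Lemma integ_cos_dot (t : 'rV[R]_D) (a : R) :
  integ P (fun w => cos ((t *m (Y w)^T) 0 0 + a)).
Proof.
by apply: (integ_bounded P (measurable_cos_dot t a)) => w; exact: cos_max.
Qed.

Lemma integ_trig f : trigpoly f -> integ P (fun w => f (Y w)).
Proof.
elim=> [c t a|f1 f2 _ h1 _ h2]; last exact: integD.
by apply: integZ; exact: integ_cos_dot.
Qed.

(** Measurability is assumed for the coordinates of [Y] only. A pointwise limit of trigonometric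
    polynomials in [Y w] gives [h (Y w)]: the [n]-th is within [1 / (n + 1)] of [h] on the cube of
    half-side [n + 1]. *)
Lemma measurable_cont (h : 'rV[R]_D -> R) (M : R) : continuous h ->
  (forall x, `|h x| <= M) -> measurable_fun setT (fun w => h (Y w)).
Proof.
move=> ch hM.
have H (n : nat) : exists f : 'rV[R]_D -> R, trigpoly f /\
    forall x : 'rV[R]_D, (forall p, `|x 0 p| <= n.+1%:R) -> `|h x - f x| <= n.+1%:R^-1.
  have n0 : 0 < n.+1%:R :> R by rewrite ltr0n.
  have [|f tf [_ hf]] := trig_approx ch hM n0 (eps := n.+1%:R^-1).
    by rewrite invr_gt0.
  by exists f.
have [f fP] := choice H.
apply: (measurable_fun_cvg (h := fun n w => f n (Y w))).
  by move=> n; apply: (integ_meas (P := P)); apply: integ_trig; have [] := fP n.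
move=> w _; apply/cvgrPdist_le => eps e0.
near=> n; have [_ /(_ (Y w))] := fP n.
move=> hn; apply: le_trans (hn _) _.
  move=> p; apply: le_trans (_ : \sum_p `|Y w 0 p| <= _).
    by rewrite (bigD1 p)//= lerDl sumr_ge0.
  apply: le_trans (_ : n%:R <= _); last by rewrite ler_nat.
  near: n; exact: nbhs_infty_ger.
rewrite invf_ple ?posrE//; apply: le_trans (_ : n%:R <= _); last by rewrite ler_nat.
near: n; exact: nbhs_infty_ger.
Unshelve. all: end_near. Qed.

End TrigMeas.

Section WeakConv.
Context (d : measure_display) (T : measurableType d) (d' : measure_display)
  (T' : measurableType d') (R : realType) (P : probability T R) (P' : probability T' R)
  (D : nat) (Y : nat -> T -> 'rV[R]_D) (Z : T' -> 'rV[R]_D).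
Hypothesis mY : forall N p, measurable_fun setT (fun w => Y N w 0 p).
Hypothesis mZ : forall p, measurable_fun setT (fun w => Z w 0 p).
Hypothesis cf : forall (t : 'rV[R]_D) (a : R),
  mean P (fun w => cos ((t *m (Y N w)^T) 0 0 + a)) @[N --> \oo] -->
  mean P' (fun w => cos ((t *m (Z w)^T) 0 0 + a)).
Hypothesis tightY : forall eps : R, 0 < eps -> \forall L \near +oo,
  \forall N \near \oo, forall p, mean P (fun w => Num.min 1 (`|Y N w 0 p| / L)) <= eps.
Hypothesis tightZ : forall eps : R, 0 < eps -> \forall L \near +oo,
  forall p, mean P' (fun w => Num.min 1 (`|Z w 0 p| / L)) <= eps.

Lemma trig_cvg f : trigpoly f ->
  mean P (fun w => f (Y N w)) @[N --> \oo] --> mean P' (fun w => f (Z w)).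
Proof.
elim=> [c t a|f1 f2 t1 h1 t2 h2].
  rewrite meanZ; last exact: integ_cos_dot.
  have E N : mean P (fun w => c * cos ((t *m (Y N w)^T) 0 0 + a)) =
      c * mean P (fun w => cos ((t *m (Y N w)^T) 0 0 + a)).
    by rewrite meanZ//; exact: integ_cos_dot.
  by under eq_fun do rewrite E; apply: cvgM; [exact: cvg_cst|exact: cf].
rewrite meanD; [|exact: integ_trig|exact: integ_trig].
have E N : mean P (fun w => f1 (Y N w) + f2 (Y N w)) =
    mean P (fun w => f1 (Y N w)) + mean P (fun w => f2 (Y N w)).
  by rewrite meanD//; exact: integ_trig.
by under eq_fun do rewrite E; exact: cvgD.
Qed.

(** Inside the cube the error is at most [e1]. Outside it is at most [2 * M], because [f] keeps the
    bound [M] everywhere, and the coordinate exceeding [L] makes the sum of truncated terms at least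
    1. *)
Let approx_bound d0 (T0 : measurableType d0) (P0 : probability T0 R)
  (V : T0 -> 'rV[R]_D) (h f : 'rV[R]_D -> R) (M L e1 e2 : R) :
  (forall p, measurable_fun setT (fun w => V w 0 p)) -> 0 < L ->
  continuous h -> (forall x, `|h x| <= M) -> trigpoly f -> (forall x, `|f x| <= M) ->
  (forall x : 'rV[R]_D, (forall p, `|x 0 p| <= L) -> `|h x - f x| <= e1) ->
  0 <= e1 ->
  (forall p, mean P0 (fun w => Num.min 1 (`|V w 0 p| / L)) <= e2) ->
  `|mean P0 (fun w => h (V w)) - mean P0 (fun w => f (V w))| <= e1 + 2 * M * (D%:R * e2).
Proof.
move=> mV L0 ch hM tf fM hf e10 he2.
have M0 : 0 <= M by apply: le_trans (hM 0).
have ih : integ P0 (fun w => h (V w)).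
  by apply: (@integ_bounded _ _ _ _ _ M) => //; exact: measurable_cont ch hM.
have jf : integ P0 (fun w => f (V w)) by exact: integ_trig.
have im p : integ P0 (fun w => Num.min 1 (`|V w 0 p| / L)) by exact: integ_min1.
have is_ : integ P0 (fun w => \sum_p Num.min 1 (`|V w 0 p| / L)).
  exact: integ_sum.
rewrite -meanB//; apply: le_trans (mean_le_norm (integ_meas (integB ih jf))
  (integD (integ_cst P0 e1) (integZ (2 * M) is_)) _) _ => [w|].
  have [H|H] := pselect (forall p, `|V w 0 p| <= L).
    apply: le_trans (hf _ H) _; rewrite lerDl mulr_ge0 ?mulr_ge0//.
    by apply: sumr_ge0 => p _; exact: min1_ge0.
  have [p /negP] : exists p, ~ (`|V w 0 p| <= L) by apply: contrapT => /forallNP H2; apply: H => p; exact: contrapT.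
  rewrite -ltNge => Lp; apply: ler_wpDl => //.
  apply: le_trans (_ : 2 * M * 1 <= _).
    by apply: le_trans (ler_normB _ _) _; have := hM (V w); have := fM (V w); lra.
  rewrite ler_wpM2l ?mulr_ge0// (bigD1 p)//=; apply: ler_wpDr.
    by apply: sumr_ge0 => q _; exact: min1_ge0.
  by rewrite le_min lexx/= ler_pdivlMr// mul1r ltW.
rewrite meanD; [|exact: integ_cst|exact: integZ].
rewrite mean_cst meanZ// lerD2l ler_wpM2l ?mulr_ge0// mean_sum//.
apply: le_trans (ler_sum _ (fun p _ => he2 p)) _.
by rewrite sumr_const card_ord mulr_natl.
Qed.

Lemma weak_conv : conv_in_distribution P P' Y Z.
Proof.
move=> h ch [M hM].
have M0 : 0 <= M by apply: le_trans (hM 0).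
have iY N : integ P (h \o Y N).
  by apply: (@integ_bounded _ _ _ _ _ M) => [|w]; [exact: measurable_cont ch hM|exact: hM].
have iZ : integ P' (h \o Z).
  by apply: (@integ_bounded _ _ _ _ _ M) => [|w]; [exact: measurable_cont ch hM|exact: hM].
rewrite meanE//; under eq_fun do rewrite meanE//.
apply: cvg_EFin; first exact: nearW.
apply/cvgrPdist_le => eps e0.
(* Each of the two replacements of [h] by [f] then costs at most [3 * eps / 8], which leaves room
   for the convergence error [eps / 8]. The [+ 1] covers the case [M * D = 0]. *)
pose e2 := eps / 8 / (M * D%:R + 1).
have MD : 0 < M * D%:R + 1 by apply: ltr_wpDl => //; exact: mulr_ge0.
have e20 : 0 < e2 by rewrite !divr_gt0.
have e2M : 2 * M * (D%:R * e2) <= eps / 4.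
  have -> : 2 * M * (D%:R * e2) = (M * D%:R) / (M * D%:R + 1) * (eps / 4).
    by rewrite /e2; field; rewrite gt_eqF.
  by rewrite ler_piMl ?divr_ge0 ?(ltW e0)// ler_pdivrMr// mul1r lerDl.
have [L [L0 [hY hZ]]] : exists L : R, 0 < L /\ (\forall N \near \oo, forall p,
    mean P (fun w => Num.min 1 (`|Y N w 0 p| / L)) <= e2) /\
    forall p, mean P' (fun w => Num.min 1 (`|Z w 0 p| / L)) <= e2.
  have /filter_ex[L [[H1 H2] H3]] : \forall L \near +oo, ((\forall N \near \oo, forall p,
      mean P (fun w => Num.min 1 (`|Y N w 0 p| / L)) <= e2) /\
      forall p, mean P' (fun w => Num.min 1 (`|Z w 0 p| / L)) <= e2) /\ 0 < L.
    apply: filterI; last exact: nbhs_pinfty_gt.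
    by apply: filterI; [exact: tightY|exact: tightZ].
  by exists L.
have [|f tf [fM hf]] := trig_approx ch hM L0 (eps := eps / 8).
  by rewrite divr_gt0.
have e8 : 0 <= eps / 8 by rewrite divr_ge0// ltW.
have bZ := approx_bound mZ L0 ch hM tf fM hf e8 hZ.
near=> N.
have hYN : forall p, mean P (fun w => Num.min 1 (`|Y N w 0 p| / L)) <= e2.
  by near: N.
have bY := approx_bound (mY N) L0 ch hM tf fM hf e8 hYN.
have bf : `|mean P' (fun w => f (Z w)) - mean P (fun w => f (Y N w))| <= eps / 8.
  by near: N; move/cvgrPdist_le: (trig_cvg tf); apply; rewrite divr_gt0.
rewrite /comp.
set hz := mean P' _ in bZ *; set hy := mean P _ in bY *.
set fz := mean P' _ in bf bZ; set fy := mean P _ in bf bY.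
have -> : hz - hy = (hz - fz) + (fz - fy) - (hy - fy) by ring.
apply: le_trans (ler_normB _ _) _.
have := ler_normD (hz - fz) (fz - fy); lra.
Unshelve. all: end_near. Qed.

End WeakConv.

(** * Existence of centered Gaussian vectors *)

Section NormalCF.
Context {R : realType}.
Notation mu := (@lebesgue_measure R).
Let e (x : R) := expR (- x ^+ 2 / 2).
Let G := normal_pdf (0 : R) 1.
Let c := normal_peak (1 : R).

Let GE x : G x = c * e x.
Proof.
rewrite /G normal_pdfE ?oner_neq0//; congr (_ * expR _).
by rewrite subr0 expr1n mulr2n.
Qed.

Let c0 : 0 < c. Proof. by rewrite normal_peak_gt0 ?oner_neq0. Qed.

Let ie : mu.-integrable setT (EFin \o e).
Proof.
have := integrableZl measurableT c^-1 (integrable_normal_pdf (0 : R) 1).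
apply: eq_integrable => // x _ /=; rewrite -EFinM; congr EFin.
by rewrite -/(G x) GE mulKf// gt_eqF.
Qed.

Let cont_e : continuous e.
Proof.
move=> x; apply: continuous_comp; last exact: continuous_expR.
apply: cvgM; last exact: cvg_cst.
by apply: cvgN; exact: exprn_continuous.
Qed.

Let me : measurable_fun setT e.
Proof. exact: continuous_measurable_fun. Qed.

(** [|x| <= expR (x ^+ 2 / 4)], so the function is dominated by [expR (- x ^+ 2 / 4)], a multiple of
    the centered normal density with standard deviation sqrt 2. *)
Let ixe : mu.-integrable setT (fun x => (`|x| * e x)%:E).
Proof.
have s2 : Num.sqrt (2 : R) != 0 by rewrite sqrtr_eq0 -ltNge.
have := integrableZl measurableT (normal_peak (Num.sqrt (2 : R)))^-1
  (integrable_normal_pdf (0 : R) (Num.sqrt 2)).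
apply: le_integrable => //.
  by apply/measurable_EFinP; apply: measurable_funM.
move=> x _ /=; rewrite lee_fin normrM normr_id (ger0_norm (expR_ge0 _)).
apply: le_trans _ (ler_norm _).
rewrite normal_pdfE// mulKf ?gt_eqF ?normal_peak_gt0// /normal_fun subr0 sqr_sqrtr//.
rewrite -/(e x); have -> : e x = expR (- x ^+ 2 / 4) * expR (- x ^+ 2 / 4).
  by rewrite -expRD /e; congr expR; field.
rewrite mulrA -[leRHS]mul1r.
have -> : (2 : R) *+ 2 = 4 by ring.
rewrite ler_wpM2r ?expR_ge0// !mulNr expRN ler_pdivrMr ?expR_gt0// mul1r.
apply: le_trans (expR_ge1Dx _).
have := sqr_ge0 (`|x| - 2); rewrite -[x ^+ 2]real_normK ?num_real//; lra.
Qed.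

Variable a : R.
Let f (u x : R) := cos (u * x + a) * e x.
Let I (u : R) := (\int[mu]_x f u x)%R.

Let is_derf (u x : R) : is_derive u (1 : R) (f ^~ x) (- (x * sin (u * x + a) * e x)).
Proof. by apply: is_derive_eq; rewrite /GRing.scale/=; ring. Qed.

Let mlin (u : R) : measurable_fun setT (fun x : R => u * x + a).
Proof. by apply: measurable_funD => //; exact: measurable_funM. Qed.

Let mcos (u : R) : measurable_fun setT (fun x : R => cos (u * x + a)).
Proof. exact (measurableT_comp (continuous_measurable_fun (@continuous_cos R)) (mlin u)). Qed.

Let msin (u : R) : measurable_fun setT (fun x : R => sin (u * x + a)).
Proof. exact (measurableT_comp (continuous_measurable_fun (@continuous_sin R)) (mlin u)). Qed.

Let mf u : measurable_fun setT (f u).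
Proof. exact (measurable_funM (mcos u) me). Qed.

Let mg (u : R) : measurable_fun setT (fun x : R => x * sin (u * x + a) * e x).
Proof. exact (measurable_funM (measurable_funM (@measurable_id _ _ setT) (msin u)) me). Qed.

Let intf u : mu.-integrable setT (EFin \o f u).
Proof.
apply: le_integrable ie => //; first by apply/measurable_EFinP; exact: mf.
move=> x _ /=; rewrite lee_fin normrM ler_piMl//; exact: cos_max.
Qed.

Let intg (u : R) : mu.-integrable setT (fun x : R => (x * sin (u * x + a) * e x)%:E).
Proof.
apply: le_integrable ixe => //; first by apply/measurable_EFinP; exact: mg.
move=> x _ /=; rewrite lee_fin -mulrA mulrCA normrM [leRHS]ger0_norm ?mulr_ge0 ?expR_ge0//.
by rewrite normrM (ger0_norm (expR_ge0 _)) ler_piMl ?mulr_ge0 ?expR_ge0// sin_max.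
Qed.

(* The integral [I] solves [I' = - u * I]: differentiate under the integral sign,
   then integrate by parts. *)
Let dI (u : R) : is_derive u (1 : R) I (- \int[mu]_x (x * sin (u * x + a) * e x))%R.
Proof.
have d1 (v x : R) : partial1of2 f v x = - (x * sin (v * x + a) * e x).
  by rewrite partial1of2E; have := is_derf v x => ?; rewrite derive_val.
have Iu : `]u - 1, u + 1[%classic u.
  by rewrite /= in_itv/=; apply/andP; split; lra.
have H := @cvg_differentiation_under_integral R _ _ mu f setT measurableT u (u - 1) (u + 1)
  Iu (fun v _ => intf v) (fun v x _ _ => @ex_derive _ _ _ _ _ _ _ (is_derf v x))
  (fun x => `|x| * e x) (fun x => mulr_ge0 (normr_ge0 x) (expR_ge0 _)) ixe.
have {}H : h^-1 *: (I (h + u) - I u) @[h --> 0^'] -->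
    - (\int[mu]_x (x * sin (u * x + a) * e x))%R.
  have e1 : (\int[mu]_x (partial1of2 f u x))%R =
      (\int[mu]_x (-1 * (x * sin (u * x + a) * e x)))%R.
    by apply: eq_Rintegral => x _; rewrite d1 mulN1r.
  have e2 : (\int[mu]_x (-1 * (x * sin (u * x + a) * e x)))%R =
      - (\int[mu]_x (x * sin (u * x + a) * e x))%R.
    by rewrite RintegralZl ?mulN1r//; exact: (intg u).
  rewrite -e2 -e1.
  apply: H => v x _ _; rewrite d1 normrN !normrM (ger0_norm (expR_ge0 _)).
  by rewrite -mulrA ler_wpM2l// ler_piMl ?expR_ge0// sin_max.
apply: DeriveDef.
  apply/cvg_ex; eexists.
  by under eq_fun do rewrite scaler1; exact: H.
by rewrite -derive1E; apply/cvg_lim.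
Qed.

(** [k] is the derivative of the boundary term [K], so the claim is that the integral of [k] over
    the line vanishes. *)
Let byparts (u : R) : (\int[mu]_x (x * sin (u * x + a) * e x) = u * I u)%R.
Proof.
pose K x := sin (u * x + a) * e x.
pose k x := u * f u x - x * sin (u * x + a) * e x.
have dk (x : R) : is_derive x (1 : R) K (k x).
  by apply: is_derive_eq; rewrite /GRing.scale/= /k /f /e; field.
have ck : continuous k.
  move=> x; apply/differentiable_continuous/derivable1_diffP.
  by rewrite /k /f /e; exact: ex_derive.
have cK : continuous K.
  by move=> x; apply/differentiable_continuous/derivable1_diffP; exact: ex_derive.
have ik : mu.-integrable setT (EFin \o k).
  have := integrableB measurableT (integrableZl measurableT u (intf u)) (intg u).
  by apply: eq_integrable => // x _ /=; rewrite /k EFinB EFinM.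
have J0 : (\int[mu]_x k x = 0)%R.
  (* The integrals over these intervals converge to the full integral by dominated convergence, and
     equal differences of boundary values of [K], which tend to 0. *)
  pose A (n : nat) : set R := `[- n.+1%:R, n.+1%:R]%classic.
  have mA n : measurable (A n) by exact: measurable_itv.
  have FTC n : (\int[mu]_(x in A n) (k x)%:E = (K n.+1%:R - K (- n.+1%:R))%:E)%E.
    rewrite EFinB; apply: continuous_FTC2.
    - by rewrite -subr_gt0 opprK addr_gt0// ltr0n.
    - exact: continuous_subspaceT.
    - split=> [x _||].
      + exact: ex_derive.
      + by apply: cvg_at_right_filter; exact: cK.
      + by apply: cvg_at_left_filter; exact: cK.
    - by move=> x _; rewrite derive1E derive_val.
  have mk : measurable_fun setT (EFin \o k).
    by apply/measurable_EFinP; exact: continuous_measurable_fun.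
  pose g n := (EFin \o k) \_ (A n).
  have mgn n : measurable_fun setT (g n).
    exact: (proj1 (measurable_restrictT _ (mA n)) (measurable_funTS mk)).
  have gk : {ae mu, forall x, setT x -> g ^~ x @ \oo --> (EFin \o k) x}.
    apply: aeW => x _; apply: cvg_near_cst; near=> n.
    rewrite /g patchE mem_set// /A /= in_itv/= -ler_norml.
    apply: le_trans (_ : n%:R <= _); last by rewrite ler_nat.
    near: n; exact: nbhs_infty_ger.
  have gb : {ae mu, forall x n, setT x -> (`|g n x| <= `|(EFin \o k) x|)%E}.
    apply: aeW => x n _; rewrite /g patchE; case: ifP => // _.
    by rewrite abse0 abse_ge0.
  have [_ _] := @dominated_convergence _ _ R mu setT measurableT g _ _ mgn mk gk (integrable_abse ik) gb.
  have -> : [sequence (\int[mu]_x g n x)%E]_n =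
      fun n => (K n.+1%:R - K (- n.+1%:R))%:E.
    by apply/funext => n; rewrite -FTC integral_mkcond.
  move=> lim1.
  (* [expR (x ^+ 2 / 2) >= 1 + x ^+ 2 / 2 >= |x| / 2], a crude decay that already suffices. *)
  have Kb (n : nat) (x : R) : `|x| = n.+1%:R -> `|K x| <= 2 * n.+1%:R^-1.
    move=> xn; rewrite /K normrM (ger0_norm (expR_ge0 _)).
    apply: le_trans (_ : e x <= _); first by rewrite ler_piMl ?expR_ge0// sin_max.
    rewrite /e mulNr expRN -[leRHS]invrK lef_pV2 ?posrE ?expR_gt0//.
    apply: le_trans (expR_ge1Dx _).
    rewrite invf_div -(real_normK (num_real x)) xn.
    have := sqr_ge0 (n.+1%:R - 1 : R).
    by have : 0 <= n.+1%:R :> R := ler0n _ _; set m := n.+1%:R => ? ?; lra.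
  have l0 : (fun n : nat => `|K n.+1%:R - K (- n.+1%:R)|) @ \oo --> (0 : R).
    apply: (@squeeze_cvgr _ _ _ _ (cst 0) (fun n : nat => 4 * n.+1%:R^-1)).
    - apply: nearW => n; rewrite normr_ge0/=.
      apply: le_trans (ler_normB _ _) _.
      have -> : 4 * n.+1%:R^-1 = 2 * n.+1%:R^-1 + 2 * n.+1%:R^-1 :> R by ring.
      by rewrite lerD// Kb// ?normrN ger0_norm.
    - exact: cvg_cst.
    - rewrite -(mulr0 (4 : R)); apply: cvgM; first exact: cvg_cst.
      exact: cvg_harmonic.
  have lim0 : (K n.+1%:R - K (- n.+1%:R))%:E @[n --> \oo] --> 0%:E.
    by apply: cvg_EFin; [exact: nearW|exact: norm_cvg0 l0].
  by rewrite /Rintegral; have := cvg_unique _ lim1 lim0 => ->.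
have := J0; rewrite /k RintegralB//; last 2 first.
- by have := integrableZl measurableT u (intf u); apply: eq_integrable.
- exact: intg.
by rewrite RintegralZl// => /eqP; rewrite subr_eq0 => /eqP <-.
Unshelve. all: end_near. Qed.

(** Integration against the normal law is expressed by its Radon-Nikodym derivative, which agrees
    almost everywhere with the explicit density. *)
Let integral_normal (h : R -> R) : measurable_fun setT h -> (forall x, `|h x| <= 1) ->
  mean (normal_prob (0 : R) 1) h = c * (\int[mu]_x (h x * e x))%R.
Proof.
move=> mh h1.
have ih : (normal_prob (0 : R) 1).-integrable setT (EFin \o h).
  exact: (integ_bounded (normal_prob (0 : R) 1) mh h1).
have ihe : mu.-integrable setT (fun x => (h x * e x)%:E).
  apply: le_integrable ie => //; first by apply/measurable_EFinP; exact: (measurable_funM mh me).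
  by move=> x _ /=; rewrite lee_fin normrM ler_piMl.
have -> : c * (\int[mu]_x (h x * e x))%R = (\int[mu]_x (h x * G x))%R.
  rewrite -RintegralZl//; apply: eq_Rintegral => x _; rewrite GE; ring.
rewrite /mean /Rintegral; congr fine.
have dom := @normal_prob_dominates R 0 1.
rewrite -(Radon_Nikodym_change_of_variables dom)//=.
under [RHS]eq_integral do rewrite EFinM.
apply: ae_eq_integral => //.
- apply: emeasurable_funM; first exact/measurable_EFinP.
  by apply: (measurable_int mu); apply: Radon_Nikodym_integrable.
- apply: emeasurable_funM; first exact/measurable_EFinP.
  by apply/measurable_EFinP; exact: measurable_normal_pdf.
- apply: ae_eqe_mul2l => /=.
  rewrite Radon_NikodymE//=.
  case: cid => /= rn [h2 h3 h4].
  apply: integral_ae_eq => //=.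
  + by apply/measurable_EFinP; exact: measurable_normal_pdf.
  + by move=> E E01 mE; rewrite -h4.
Qed.

(** [I u * expR (u ^+ 2 / 2)] has zero derivative, hence is constant; its value at 0 is given by the
    total mass 1 of the normal law. *)
Lemma normal_cf (u : R) : mean (normal_prob (0 : R) 1) (fun x => cos (u * x + a)) =
  cos a * expR (- u ^+ 2 / 2).
Proof.
have I0 : c * I 0 = cos a.
  rewrite /I -integral_normal; last 2 first.
  - exact: mcos.
  - by move=> x; exact: cos_max.
  by under eq_mean do rewrite mul0r add0r; exact: mean_cst.
rewrite integral_normal; last 2 first.
- exact: mcos.
- by move=> x; exact: cos_max.
rewrite -/(I u).
have dA (v : R) : is_derive v (1 : R) (fun v => I v * expR (v ^+ 2 / 2)) 0.
  have := dI v; rewrite byparts => ?.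
  by apply: is_derive_eq; rewrite /GRing.scale/=; field.
have := is_derive_0_is_cst u 0 dA.
rewrite expr0n mul0r expR0 mulr1 => h.
have E : expR (u ^+ 2 / 2) * expR (- u ^+ 2 / 2) = 1 by rewrite -expRD mulNr subrr expR0.
by rewrite -I0 -h -[in RHS]mulrA -[in RHS]mulrA E mulr1.
Qed.

End NormalCF.

(** The phase [a] combines the cosine and sine conditions into one formula, in the shape required
    for the convergence of cosine means. *)
Definition char_gaussian (d : measure_display) (T : measurableType d) (R : realType)
  (P : probability T R) (D : nat) (Z : T -> 'rV[R]_D) (S : 'M[R]_D) : Prop :=
  (forall p, measurable_fun setT (fun w => Z w 0 p)) /\
  forall (t : 'rV[R]_D) (a : R), mean P (fun w => cos ((t *m (Z w)^T) 0 0 + a)) =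
    cos a * expR (- ((t *m S *m t^T) 0 0) / 2).

Lemma char_gaussian_centered (d : measure_display) (T : measurableType d) (R : realType)
  (P : probability T R) (D : nat) (Z : T -> 'rV[R]_D) (S : 'M[R]_D) :
  char_gaussian P Z S -> centered_gaussian_vec P Z S.
Proof.
move=> [mZ cZ]; split=> // t; split.
  have := integ_cos_dot P mZ t 0 => /meanE; rewrite cZ cos0 mul1r => <-.
  by congr ('E_P[_])%E; apply/funext => w; rewrite addr0.
have := integ_cos_dot P mZ t (- (pi / 2)) => /meanE; rewrite cZ.
rewrite cosN cos_pihalf mul0r => h; rewrite -[RHS]/(0%:E) -h.
by congr ('E_P[_])%E; apply/funext => w; rewrite cosBpihalf.
Qed.

(** The added angle is [b] times an independent standard normal, with [b = t *m v^T]. In the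
    addition formula the sine mean vanishes by symmetry, and the cosine mean contributes [b ^+ 2],
    the quadratic form of [v^T *m v]. *)
Lemma char_gaussian_add (d : measure_display) (T : measurableType d) (R : realType)
  (P : probability T R) (D : nat) (Z : T -> 'rV[R]_D) (S : 'M[R]_D) (v : 'rV[R]_D) :
  char_gaussian P Z S ->
  char_gaussian (P \x normal_prob (0 : R) 1)%E (fun w => Z w.1 + w.2 *: v) (S + v^T *m v).
Proof.
move=> [mZ cZ]; split=> [p|t a].
  have -> : (fun w : T * R => (Z w.1 + w.2 *: v) 0 p) =
      (fun w => Z w.1 0 p + w.2 * v 0 p) by apply/funext => w; rewrite !mxE.
  apply: measurable_funD; first exact: measurableT_comp (mZ p) measurable_fst.
  by apply: measurable_funM => //; exact: measurable_snd.
pose b : R := (t *m v^T) 0 0.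
pose A w := (t *m (Z w)^T) 0 0 + a.
have E w : (t *m (Z w.1 + w.2 *: v)^T) 0 0 + a = A w.1 + b * w.2.
  by rewrite /A /b linearD linearZ/= mulmxDr -scalemxAr !mxE; ring.
under eq_mean do rewrite E cosD.
pose N := normal_prob (0 : R) 1.
have mlin : measurable_fun setT (fun x : R => b * x) by exact: measurable_funM.
have icN : integ N (fun x => cos (b * x)).
  apply: (@integ_bounded _ _ _ _ _ 1); last by move=> x; exact: cos_max.
  exact (measurableT_comp (continuous_measurable_fun (@continuous_cos R)) mlin).
have isN : integ N (fun x => sin (b * x)).
  apply: (@integ_bounded _ _ _ _ _ 1); last by move=> x; exact: sin_max.
  exact (measurableT_comp (continuous_measurable_fun (@continuous_sin R)) mlin).
have mcN : mean N (fun x => cos (b * x)) = expR (- b ^+ 2 / 2).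
  have := normal_cf (0 : R) b; rewrite cos0 mul1r => <-.
  by apply: eq_mean => x; rewrite addr0.
have msN : mean N (fun x => sin (b * x)) = 0.
  have -> : (fun x : R => sin (b * x)) = (fun x : R => cos (b * x - pi / 2)).
    by apply/funext => x; rewrite cosBpihalf.
  by rewrite /N normal_cf cosN cos_pihalf mul0r.
have icA : integ P (fun w => cos (A w)) by exact: integ_cos_dot.
have isA : integ P (fun w => sin (A w)).
  have := integ_cos_dot P mZ t (a - pi / 2).
  by congr integ; apply/funext => w; rewrite addrA cosBpihalf.
have [i1 e1] := mean_prod icA icN; have [i2 e2] := mean_prod isA isN.
rewrite meanB// e1 e2 msN mulr0 subr0 mcN.
have -> : mean P (fun w => cos (A w)) = cos a * expR (- ((t *m S *m t^T) 0 0) / 2).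
  exact: cZ.
rewrite -mulrA -expRD; congr (_ * expR _).
have -> : (t *m (S + v^T *m v) *m t^T) 0 0 = (t *m S *m t^T) 0 0 + b ^+ 2.
  rewrite mulmxDr mulmxDl [LHS]mxE; congr (_ + _).
  rewrite mulmxA -(mulmxA (t *m v^T)) [LHS]mxE big_ord1 expr2; congr (_ * _).
  by rewrite -[v *m t^T]trmxK trmx_mul trmxK mxE.
by ring.
Qed.

(** * Positive semidefinite matrices and Gaussian vectors *)

Definition psd (R : realType) (D : nat) (S : 'M[R]_D) : Prop :=
  S^T = S /\ forall t : 'rV[R]_D, 0 <= (t *m S *m t^T) 0 0.

Section Psd.
Context {R : realType} {D : nat}.
Implicit Types (S : 'M[R]_D) (t : 'rV[R]_D).

Let B S (s t : 'rV[R]_D) : R := (s *m S *m t^T) 0 0.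
Let dl (i : 'I_D) : 'rV[R]_D := delta_mx 0 i.

Let BE S i j : B S (dl i) (dl j) = S i j.
Proof. by rewrite /B /dl -rowE trmx_delta -colE !mxE. Qed.

Let BDl S s s' t : B S (s + s') t = B S s t + B S s' t.
Proof. by rewrite /B !mulmxDl mxE. Qed.

Let BDr S s t t' : B S s (t + t') = B S s t + B S s t'.
Proof. by rewrite /B linearD mulmxDr mxE. Qed.

Let BZl S (c : R) s t : B S (c *: s) t = c * B S s t.
Proof. by rewrite /B -!scalemxAl mxE. Qed.

Let BZr S (c : R) s t : B S s (c *: t) = c * B S s t.
Proof. by rewrite /B linearZ -scalemxAr mxE. Qed.

Let BC S s t : S^T = S -> B S s t = B S t s.
Proof.
by move=> sS; rewrite /B -[in LHS](trmxK (s *m S *m t^T)) mxE !trmx_mul trmxK sS mulmxA.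
Qed.

(** On the sum and on the difference of two basis vectors the form takes the values [2 * S i j] and
    [- 2 * S i j], both nonnegative. *)
Lemma psd_diag0 S : psd S -> (forall i, S i i = 0) -> S = 0.
Proof.
move=> [sS S0] d0; apply/matrixP => i j; rewrite mxE.
have h1 := S0 (dl i + dl j); have h2 := S0 (dl i + (-1) *: dl j).
rewrite -/(B _ _ _) !(BDl, BDr) !BE !d0 in h1.
rewrite -/(B _ _ _) !(BDl, BDr, BZl, BZr) !BE !d0 in h2.
have : S j i = S i j by rewrite -[in LHS]sS mxE.
lra.
Qed.

(** The new form at [t] is the old one at the translate of [t] along the [p]-th basis vector that
    minimizes it, hence nonnegative. The shrinking set of nonzero diagonal entries is the measure
    for the induction. *)
Lemma psd_schur S p : psd S -> S p p != 0 ->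
  let v := (Num.sqrt (S p p))^-1 *: row p S in
  psd (S - v^T *m v) /\
  [set i | (S - v^T *m v) i i != 0]%SET \proper [set i | S i i != 0]%SET.
Proof.
move=> [sS S0] pp v; set a := S p p.
have a0 : 0 < a by rewrite lt_neqAle eq_sym pp/= /a -BE; exact: S0.
have s2 : (Num.sqrt a)^-1 ^+ 2 = a^-1 by rewrite exprVn sqr_sqrtr// ltW.
have sS' : (S - v^T *m v)^T = S - v^T *m v.
  by rewrite linearB/= trmx_mul trmxK sS.
have tv t : (t *m v^T) 0 0 = (Num.sqrt a)^-1 * B S t (dl p).
  rewrite /v linearZ/= -scalemxAr mxE; congr (_ * _).
  by rewrite rowE trmx_mul sS mulmxA.
have S0' t : 0 <= (t *m (S - v^T *m v) *m t^T) 0 0.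
  have -> : (t *m (S - v^T *m v) *m t^T) 0 0 = B S t t - B S t (dl p) ^+ 2 / a.
    rewrite mulmxBr mulmxBl mxE; congr (_ + _); rewrite mxE; congr (- _).
    rewrite mulmxA -(mulmxA (t *m v^T)) [LHS]mxE big_ord1.
    have -> : (v *m t^T) 0 0 = (t *m v^T) 0 0.
      by rewrite -[v *m t^T]trmxK trmx_mul trmxK mxE.
    by rewrite tv mulrACA -expr2 s2 -expr2 mulrC.
  have := S0 (t + (- (B S t (dl p) / a)) *: dl p).
  rewrite -/(B _ _ _) !(BDl, BDr, BZl, BZr) BE -/a (BC (dl p) t sS).
  set b := B S t (dl p); set q := B S t t.
  suff -> : q + - (b / a) * b + (- (b / a) * b + - (b / a) * (- (b / a) * a)) = q - b ^+ 2 / a by [].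
  by field; rewrite gt_eqF.
have dE i : (S - v^T *m v) i i = S i i - S p i ^+ 2 / a.
  rewrite mxE; congr (_ + _); rewrite mxE; congr (- _).
  by rewrite mxE big_ord1 !mxE mulrACA -expr2 s2 -expr2 mulrC.
split=> //; apply/properP; split.
  (* A zero diagonal entry becomes [- S p i ^+ 2 / a]; nonnegativity of the new form forces it to be
     0 again. *)
  apply/fintype.subsetP => i; rewrite !inE; apply: contra => /eqP Si.
  have := S0' (dl i); rewrite -/(B _ _ _) BE dE Si sub0r oppr_ge0 => h.
  rewrite eq_le oppr_le0 oppr_ge0 h andbT mulr_ge0 ?sqr_ge0// invr_ge0 ltW//.
exists p; rewrite !inE//= negbK dE -/a.
by rewrite expr2 mulfK ?subrr// gt_eqF.
Qed.

(* Each Schur complement step splits off a rank one term [v^T *m v], realized by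
   adding an independent standard normal times [v]. *)
Lemma gaussian_exists S : psd S -> exists (d' : measure_display)
  (T' : measurableType d') (P' : probability T' R) (Z : T' -> 'rV[R]_D),
  char_gaussian P' Z S.
Proof.
have [n] := ubnP #|[set i | S i i != 0]%SET|.
elim: n S => // n IH S; rewrite ltnS => Sn pS.
have [d0|] := pselect (forall i, S i i = 0).
  (* The zero vector realizes the zero covariance on any probability space; the normal law on the
     line is one at hand. *)
  rewrite (psd_diag0 pS d0); do 2 eexists; exists (normal_prob (0 : R) 1), (fun=> 0).
  split=> [p|t a]; first exact: measurable_cst.
  under eq_mean do rewrite linear0 mulmx0 mxE add0r.
  by rewrite mean_cst mulmx0 mul0mx mxE oppr0 mul0r expR0 mulr1.
move=> /existsNP[p /eqP pp]; have [pS' prop] := psd_schur pS pp.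
have [|d' [T' [P' [Z gZ]]]] := IH _ _ pS'.
  exact: leq_trans (proper_card prop) Sn.
do 3 eexists; eexists; have := char_gaussian_add
  ((Num.sqrt (S p p))^-1 *: row p S) gZ.
by rewrite subrK; apply.
Qed.

End Psd.

(** * Approximation of the empirical correlations by sums of lagged products *)

Section Moments.
Context (d : measure_display) (T : measurableType d) (R : realType).
Variables (P : probability T R) (X : nat -> T -> R).
Hypothesis iidX : iid_seq P X.

Lemma iota_cat1 a : uniq (iota 0 a ++ iota a 1).
Proof. by rewrite -[X in iota X 1]add0n -iotaD iota_uniq. Qed.

Lemma smeas_obs s n (u : R -> R) : measurable_fun setT u -> uniq s -> n \in s ->
  smeas X s (fun w => u (X n w)).
Proof. by move=> mu us ns; apply: smeas_comp => //; exact: smeas_X. Qed.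

(** The partial sum belongs to the past of the next term, so the cross term vanishes and second
    moments add. *)
Lemma mds_sum_sqr (k : nat) (xi : nat -> T -> R) (A : R) :
  (forall n, smeas X (iota 0 (n + k).+1) (xi n)) ->
  (forall n, integ P (fun w => xi n w ^+ 2)) ->
  (forall n, mean P (fun w => xi n w ^+ 2) <= A) ->
  (forall n F, smeas X (iota 0 (n + k)) F -> integ P (fun w => F w ^+ 2) ->
     mean P (fun w => F w * xi n w) = 0) ->
  forall N, integ P (fun w => (\sum_(n < N) xi n w) ^+ 2) /\
    mean P (fun w => (\sum_(n < N) xi n w) ^+ 2) <= N%:R * A.
Proof.
move=> wxi ixi Axi md.
have mxi n : measurable_fun setT (xi n) := smeas_meas iidX (wxi n).
have wS N : smeas X (iota 0 (N + k)) (fun w => \sum_(n < N) xi n w).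
  apply: smeas_sum => n _; apply: smeas_sub (wxi n); first exact: iota_uniq.
  by move=> j; have := ltn_ord n; rewrite !mem_iota; lia.
elim=> [|N [iS bS]].
  under eq_fun do rewrite big_ord0 expr0n.
  by rewrite mean_cst mul0r lexx; split=> //; exact: integ_cst.
have mS := smeas_meas iidX (wS N).
have E w : (\sum_(n < N.+1) xi n w) ^+ 2 = (\sum_(n < N) xi n w) ^+ 2 +
    2 * ((\sum_(n < N) xi n w) * xi N w) + xi N w ^+ 2.
  by rewrite big_ord_recr/=; ring.
have iSx : integ P (fun w => (\sum_(n < N) xi n w) * xi N w) by exact: integ_mul.
under eq_fun do rewrite E.
split; first by apply: integD => //; apply: integD => //; exact: integZ.
rewrite meanD//; last by apply: integD => //; exact: integZ.
rewrite meanD//; last exact: integZ.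
rewrite meanZ// md// mulr0 addr0 -natr1 mulrDl mul1r lerD//.
Qed.

(** A square integrable function of the past times a centered function of the fresh observation
    [X a]: independence gives both the second moment and orthogonality to the past. *)
Lemma innovation (a : nat) (V : T -> R) (u : R -> R) :
  smeas X (iota 0 a) V -> integ P (fun w => V w ^+ 2) ->
  measurable_fun setT u -> integ P (fun w => u (X 0%N w) ^+ 2) ->
  mean P (fun w => u (X 0%N w)) = 0 ->
  [/\ smeas X (iota 0 a.+1) (fun w => V w * u (X a w)),
    integ P (fun w => (V w * u (X a w)) ^+ 2),
    mean P (fun w => (V w * u (X a w)) ^+ 2) =
      mean P (fun w => V w ^+ 2) * mean P (fun w => u (X 0%N w) ^+ 2) &
    forall F, smeas X (iota 0 a) F -> integ P (fun w => F w ^+ 2) ->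
      mean P (fun w => F w * (V w * u (X a w))) = 0].
Proof.
move=> wV iV mu iu u0.
have wu : smeas X (iota a 1) (fun w => u (X a w)).
  by apply: smeas_obs => //; rewrite inE.
have mu2 : measurable_fun setT (fun x => u x ^+ 2) by exact: measurable_funX.
have mX0 : measurable_fun setT (X 0%N) by have [] := iidX.
have mu0 : measurable_fun setT (fun w => u (X 0%N w)) by exact: measurableT_comp mX0.
have [iua mua] := ident_int iidX a mu (integ_sqr mu0 iu).
have [iu2a mu2a] := ident_int iidX a mu2 iu.
have wV2 : smeas X (iota 0 a) (fun w => V w ^+ 2).
  by apply: (smeas_comp (f := fun x => x ^+ 2)) => //; exact: measurable_funX.
have wu2 : smeas X (iota a 1) (fun w => u (X a w) ^+ 2).
  by apply: (smeas_comp (f := fun x => x ^+ 2)) => //; exact: measurable_funX.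
have [i2 m2] := mean_window iidX (iota_cat1 a) wV2 wu2 iV iu2a.
split.
- apply: smeasM.
    apply: smeas_sub wV; first exact: iota_uniq.
    by move=> j; rewrite !mem_iota; lia.
  by apply: smeas_obs => //; [exact: iota_uniq|rewrite mem_iota; lia].
- by move: i2; congr integ; apply/funext => w; rewrite exprMn.
- by under eq_mean do rewrite exprMn; rewrite m2 mu2a.
move=> F wF iF; under eq_mean do rewrite mulrA.
have iFV : integ P (fun w => F w * V w).
  have mF := smeas_meas iidX wF; have mV := smeas_meas iidX wV.
  exact: integ_mul.
have [_ ->] := mean_window iidX (iota_cat1 a) (smeasM wF wV) wu iFV iua.
by rewrite mua u0 mulr0.
Qed.

(** Covers all the sums needed: [V = 1] gives sums of observations or of centered squares, and [V n]
    an earlier observation gives lagged products. *)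
Lemma sum_bound (k : nat) (V : nat -> T -> R) (u : R -> R) (A B : R) :
  (forall n, smeas X (iota 0 (n + k)) (V n)) -> (forall n, integ P (fun w => V n w ^+ 2)) ->
  (forall n, mean P (fun w => V n w ^+ 2) <= A) ->
  measurable_fun setT u -> integ P (fun w => u (X 0%N w) ^+ 2) ->
  mean P (fun w => u (X 0%N w)) = 0 -> mean P (fun w => u (X 0%N w) ^+ 2) <= B ->
  forall N, integ P (fun w => (\sum_(n < N) V n w * u (X (n + k)%N w)) ^+ 2) /\
    mean P (fun w => (\sum_(n < N) V n w * u (X (n + k)%N w)) ^+ 2) <= N%:R * (A * B).
Proof.
move=> wV iV AV mu iu u0 uB.
have H n := innovation (wV n) (iV n) mu iu u0.
apply: (mds_sum_sqr (k := k) (xi := fun n w => V n w * u (X (n + k)%N w))) => n.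
- by have [] := H n.
- by have [] := H n.
- have [_ _ -> _] := H n.
  by apply: ler_pM => //; apply: mean_ge0 => w; exact: sqr_ge0.
- by have [_ _ _] := H n.
Qed.

End Moments.

(** Here [r = sqrt N], [W1] is the sum of lagged products, [W2] and [W3] are the incomplete sums,
    [Sy] and [Sz] the full ones, and [E] is a boundary error. All squares have mean of order [N], so
    the prefactor [1 / (N * r)] makes the bound of order [1 / r]. *)
Lemma gamma_algebra (R : realType) (N k K : nat) (r W1 W2 W3 Sy Sz E M : R) :
  (k <= K)%N -> (2 * K < N)%N -> 0 < r -> r ^+ 2 = N%:R -> `|E| <= M ->
  `|r * ((N - k)%:R^-1 * (W1 - N%:R^-1 * Sy * W2 - N%:R^-1 * Sz * W3) +
      (N%:R^-1 * Sy) * (N%:R^-1 * Sz)) - r^-1 * (W1 + E)| <=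
  (N%:R * r)^-1 * (2 * K%:R * (1 + W1 ^+ 2) + (Sy ^+ 2 + W2 ^+ 2) +
    (Sz ^+ 2 + W3 ^+ 2) + (Sy ^+ 2 + Sz ^+ 2)) + r^-1 * M.
Proof.
move=> kK KN r0 r2 hE.
have kN : (k < N)%N by lia.
have kN' : (k <= N)%N by lia.
have N0 : (0 < N)%N by lia.
have KN' : 2 * K%:R <= N%:R :> R by rewrite -natrM ler_nat ltnW.
have N0' : 0 < N%:R :> R by rewrite ltr0n.
have kK' : k%:R <= K%:R :> R by rewrite ler_nat.
have k0' : 0 <= k%:R :> R by [].
have mk : (N - k)%:R = N%:R - k%:R :> R by rewrite natrB.
have m0 : 0 < (N - k)%:R :> R by rewrite ltr0n subn_gt0.
move: (N - k)%:R mk m0 => m mk m0.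
clear kN kN' N0 KN kK.
move: (N%:R : R) (K%:R : R) (k%:R : R) N0' KN' kK' k0' mk r2 => n K' k' N0' KN' kK' k0' mk r2.
(* This is where [2 * K < N] enters: the number [N - k] of products is at least half of [N]. *)
have m2 : n <= 2 * m by rewrite mk; lra.
set io := (n * r)^-1.
have io0 : 0 <= io by rewrite invr_ge0 mulr_ge0//; lra.
have -> : r * (m^-1 * (W1 - n^-1 * Sy * W2 - n^-1 * Sz * W3) +
    (n^-1 * Sy) * (n^-1 * Sz)) - r^-1 * (W1 + E) =
    (k' / (m * r)) * W1 - r^-1 * E - (r / (m * n)) * (Sy * W2)
    - (r / (m * n)) * (Sz * W3) + io * (Sy * Sz).
  (* The normalizations of [W1] differ by [r / m - 1 / r = k' / (m * r)], where [m = N - k]. *)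
  have -> : k' = r ^+ 2 - m by rewrite r2 mk; ring.
  rewrite /io -r2; field; apply/andP; split; lra.
have NB a b c d e : `|a - b - c - d + e : R| <= `|a| + `|b| + `|c| + `|d| + `|e|.
  apply: le_trans (ler_normD _ _) _; rewrite lerD2r.
  do 3 (apply: le_trans (ler_normB _ _) _; rewrite lerD2r).
  by [].
apply: le_trans (NB _ _ _ _ _) _.
have k1 : `|k' / (m * r) * W1| <= io * (2 * K' * (1 + W1 ^+ 2)).
  rewrite normrM ger0_norm; last by rewrite divr_ge0// mulr_ge0 ?ltW.
  rewrite mulrA; apply: ler_pM => //.
  - by rewrite divr_ge0// mulr_ge0 ?ltW.
  - rewrite ler_pdivrMr ?mulr_gt0// /io.
    have -> : (n * r)^-1 * (2 * K') * (m * r) = K' * (2 * m) / n by field; lra.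
    rewrite ler_pdivlMr//; apply: ler_pM => //; exact: ltW.
  - have := sqr_ge0 (`|W1| - 1); rewrite -(real_normK (num_real W1)).
    have : 0 <= `|W1| by []. nra.
have rm : r / (m * n) <= io * 2.
  rewrite ler_pdivrMr; last by rewrite mulr_gt0//; lra.
  rewrite /io -r2 in m2 *.
  have -> : (r ^+ 2 * r)^-1 * 2 * (m * r ^+ 2) = 2 * m / r by field; lra.
  by rewrite ler_pdivlMr// -expr2.
have rm0 : 0 <= r / (m * n).
  by rewrite divr_ge0 ?(ltW r0)// mulr_ge0 ?(ltW m0)// ltW.
have ab (a b : R) : 2 * `|a * b| <= a ^+ 2 + b ^+ 2.
  rewrite normrM -(real_normK (num_real a)) -(real_normK (num_real b)).
  have := sqr_ge0 (`|a| - `|b|); nra.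
have kk (a b : R) : `|r / (m * n) * (a * b)| <= io * (a ^+ 2 + b ^+ 2).
  rewrite normrM (ger0_norm rm0); apply: le_trans (_ : io * 2 * `|a * b| <= _).
    by rewrite ler_wpM2r.
  by rewrite -mulrA ler_wpM2l.
have k5 : `|io * (Sy * Sz)| <= io * (Sy ^+ 2 + Sz ^+ 2).
  rewrite normrM (ger0_norm io0) ler_wpM2l//; have := ab Sy Sz.
  have : 0 <= `|Sy * Sz| by []. lra.
have k2 : `|r^-1 * E| <= r^-1 * M.
  by rewrite normrM ger0_norm ?invr_ge0 ?(ltW r0)// ler_wpM2l// invr_ge0 ltW.
have k3 := kk Sy W2; have k4 := kk Sz W3.
rewrite !mulrDr; rewrite !mulrDr in k1 k3 k4 k5; lra.
Qed.

(** * Sample variances and sample autocovariances *)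

Section SampleMoments.
Context (d : measure_display) (T : measurableType d) (R : realType).
Variables (P : probability T R) (X : nat -> T -> R).
Hypothesis iidX : iid_seq P X.

Definition standardized (g : R -> R) :=
  [/\ measurable_fun setT g, integ P (fun w => g (X 0%N w) ^+ 4),
    mean P (fun w => g (X 0%N w)) = 0 & mean P (fun w => g (X 0%N w) ^+ 2) = 1].

Let mX n : measurable_fun setT (X n). Proof. by have [] := iidX. Qed.

Section OneFunction.
Variable g : R -> R.
Hypothesis sg : standardized g.

Let mg : measurable_fun setT g. Proof. by case: sg. Qed.
Let mgX n : measurable_fun setT (fun w => g (X n w)). Proof. exact: measurableT_comp (mX n). Qed.
Let ig2 : integ P (fun w => g (X 0%N w) ^+ 2).
Proof. by apply: integ_pow4 => //; case: sg. Qed.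

Lemma sum_obs_sqr (k N : nat) : integ P (fun w => (\sum_(n < N) g (X (n + k)%N w)) ^+ 2) /\
  mean P (fun w => (\sum_(n < N) g (X (n + k)%N w)) ^+ 2) <= N%:R.
Proof.
case: (sg) => _ _ g1 g2.
have [||||i b] := sum_bound iidX (k := k) (V := fun _ _ => 1) (A := 1) (B := 1) _ _ _ mg ig2 g1 _ N.
- by move=> n; exact: smeas_cst.
- by move=> n; exact: integ_cst.
- by move=> n; rewrite mean_cst expr1n.
- by rewrite g2.
have E w : \sum_(n < N) 1 * g (X (n + k)%N w) = \sum_(n < N) g (X (n + k)%N w).
  by apply: eq_bigr => n _; rewrite mul1r.
by move: i b; under eq_fun do rewrite E; rewrite !mulr1.
Qed.

Lemma hat_s2E N (y : nat -> R) : (0 < N)%N ->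
  hat_s2 N y - 1 = N%:R^-1 * (\sum_(n < N) (y n ^+ 2 - 1)) - (N%:R^-1 * \sum_(n < N) y n) ^+ 2.
Proof.
move=> N0; have N1 : N%:R != 0 :> R by rewrite pnatr_eq0 -lt0n.
rewrite /hat_s2; set m := hat_m N y; set S := \sum_(n < N) y n.
have mE : m = N%:R^-1 * S by [].
have -> : \sum_(i < N) (y i - m) ^+ 2 = \sum_(i < N) (y i ^+ 2 - 1) + N%:R - 2 * m * S + N%:R * m ^+ 2.
  have -> : 2 * m * S = \sum_(i < N) 2 * m * y i by rewrite mulr_sumr.
  have eN c : N%:R * c = \sum_(i < N) c by rewrite sumr_const card_ord mulr_natl.
  rewrite eN -[X in _ + X - _](mulr1 N%:R) eN -big_split -sumrB -big_split/=.
  by apply: eq_bigr => i _; ring.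
by rewrite mE; field.
Qed.

(** Both the centered squares and the observations have sums with second moment of order [N]; the
    fourth moment of [g] is needed for the former. *)
Lemma hat_s2_bound : exists2 C : R, 0 <= C & forall N, (0 < N)%N ->
  integ P (fun w => hat_s2 N (fun n => g (X n w)) - 1) /\
  mean P (fun w => `|hat_s2 N (fun n => g (X n w)) - 1|) <= C / Num.sqrt N%:R.
Proof.
case: (sg) => _ i4 g1 g2.
pose u x := g x ^+ 2 - 1.
have mu : measurable_fun setT u by apply: measurable_funB => //; exact: measurable_funX.
have iu : integ P (fun w => u (X 0%N w) ^+ 2).
  apply: integ_sqrD (_ : measurable_fun setT (fun w => g (X 0%N w) ^+ 2)) _ _ _.
  - exact: measurable_funX.
  - exact: measurable_cst.
  - by under eq_fun do rewrite -exprM.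
  - exact: integ_cst.
have u0 : mean P (fun w => u (X 0%N w)) = 0.
  by rewrite /u meanB//; [rewrite g2 mean_cst subrr|exact: integ_cst].
pose c := mean P (fun w => u (X 0%N w) ^+ 2).
have c0 : 0 <= c by apply: mean_ge0 => w; exact: sqr_ge0.
exists (2 + c); first by rewrite addr_ge0.
move=> N N0; have N1 : 1 <= N%:R :> R by rewrite ler1n.
set r := Num.sqrt (N%:R : R).
have r1 : 1 <= r by rewrite -[leLHS]sqrtr1 ler_wsqrtr.
have r2 : r ^+ 2 = N%:R by rewrite sqr_sqrtr//; lra.
have r0 : 0 < r by lra.
have [||||iQ bQ] := sum_bound iidX (k := 0) (V := fun _ _ => 1) (A := 1) (B := c) _ _ _ mu iu u0 _ N.
- by move=> n; exact: smeas_cst.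
- by move=> n; exact: integ_cst.
- by move=> n; rewrite mean_cst expr1n.
- by [].
pose Q w := \sum_(n < N) (g (X n w) ^+ 2 - 1).
have QE w : \sum_(n < N) 1 * u (X (n + 0)%N w) = Q w.
  by apply: eq_bigr => n _; rewrite mul1r addn0.
move: iQ bQ; under eq_fun do rewrite QE; rewrite mul1r => iQ bQ.
have [iS bS] := sum_obs_sqr 0 N.
pose S w := \sum_(n < N) g (X n w).
have SE w : \sum_(n < N) g (X (n + 0)%N w) = S w.
  by apply: eq_bigr => n _; rewrite addn0.
move: iS bS; under eq_fun do rewrite SE; move=> iS bS.
have mQ : measurable_fun setT Q.
  by apply: measurable_sum => n; apply: measurable_funB => //; exact: measurable_funX.
have mS : measurable_fun setT S by exact: measurable_sum.
have mF : measurable_fun setT (fun w => hat_s2 N (fun n => g (X n w)) - 1).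
  under eq_fun do rewrite hat_s2E//.
  apply: measurable_funB; first exact: measurable_funM.
  by apply: measurable_funX; exact: measurable_funM.
(* [|Q| <= r + Q ^+ 2 / r] bounds the first absolute moment linearly by the second one, without a
   square root of a mean. *)
pose G w := N%:R^-1 * (r + r^-1 * Q w ^+ 2) + N%:R^-1 ^+ 2 * S w ^+ 2.
have iG1 : integ P (fun w => r + r^-1 * Q w ^+ 2).
  by apply: integD; [exact: integ_cst|exact: integZ].
have iG : integ P G by apply: integD; exact: integZ.
have FG w : `|hat_s2 N (fun n => g (X n w)) - 1| <= G w.
  rewrite hat_s2E// -/(Q w) -/(S w); apply: le_trans (ler_normB _ _) _.
  rewrite /G lerD//; last by rewrite exprMn ger0_norm// mulr_ge0 ?sqr_ge0.
  rewrite normrM ger0_norm ?invr_ge0// ler_wpM2l ?invr_ge0//.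
  have -> : r + r^-1 * Q w ^+ 2 = r^-1 * (r ^+ 2 + `|Q w| ^+ 2).
    by rewrite real_normK ?num_real//; field; lra.
  rewrite mulrC ler_pdivlMr//; have := sqr_ge0 (r - `|Q w|).
  have : 0 <= `|Q w| by []. nra.
split; first exact: integ_le mF iG FG.
apply: le_trans (mean_le (integ_norm (integ_le mF iG FG)) iG FG) _.
rewrite /G meanD; [|exact: integZ|exact: integZ].
rewrite !meanZ// meanD; [|exact: integ_cst|exact: integZ].
rewrite mean_cst meanZ//.
have h1 : r^-1 * mean P (fun w => Q w ^+ 2) <= r^-1 * (r ^+ 2 * c).
  by rewrite ler_wpM2l ?invr_ge0 ?(ltW r0)// r2.
have h2 : N%:R^-1 ^+ 2 * mean P (fun w => S w ^+ 2) <= r^-1.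
  apply: le_trans (_ : N%:R^-1 ^+ 2 * N%:R <= _).
    by rewrite ler_wpM2l// exprn_ge0// invr_ge0.
  have -> : N%:R^-1 ^+ 2 * N%:R = r^-1 * r^-1 :> R.
    by rewrite -r2; field; lra.
  by rewrite ler_piMr ?invr_ge0 ?(ltW r0)// invf_le1.
have -> : (2 + c) / r = N%:R^-1 * (r + r^-1 * (r ^+ 2 * c)) + r^-1.
  by rewrite -r2; field; lra.
by rewrite lerD// ler_wpM2l ?invr_ge0// lerD2l.
Qed.

End OneFunction.

Section TwoFunctions.
Variables (g h : R -> R) (k K : nat).
Hypotheses (sg : standardized g) (sh : standardized h) (k0 : (0 < k)%N) (kK : (k <= K)%N).

(* Shifted by [K], so that sums for different lags [k <= K] share the same last
   observation [X (n + K)] in their [n]-th terms. *)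
Definition lag_sum (N : nat) (w : T) :=
  (Num.sqrt N%:R)^-1 * \sum_(n < N) g (X (n + K - k)%N w) * h (X (n + K)%N w).

Let mg : measurable_fun setT g. Proof. by case: sg. Qed.
Let mh : measurable_fun setT h. Proof. by case: sh. Qed.
Let mgX n : measurable_fun setT (fun w => g (X n w)). Proof. exact: measurableT_comp (mX n). Qed.
Let mhX n : measurable_fun setT (fun w => h (X n w)). Proof. exact: measurableT_comp (mX n). Qed.
Let ig2 : integ P (fun w => g (X 0%N w) ^+ 2).
Proof. by apply: integ_pow4 => //; case: sg. Qed.
Let ih2 : integ P (fun w => h (X 0%N w) ^+ 2).
Proof. by apply: integ_pow4 => //; case: sh. Qed.
Let mx2 (f : R -> R) : measurable_fun setT f -> measurable_fun setT (fun x => f x ^+ 2).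
Proof. by move=> mf; exact: measurable_funX. Qed.

(** As [l] is positive, the factor [h] in each term is a fresh observation and the factor [g]
    belongs to its past, so the terms are orthogonal. *)
Lemma sum_lag_sqr (a l N : nat) : (0 < l)%N ->
  integ P (fun w => (\sum_(n < N) g (X (n + a)%N w) * h (X (n + (a + l))%N w)) ^+ 2) /\
  mean P (fun w => (\sum_(n < N) g (X (n + a)%N w) * h (X (n + (a + l))%N w)) ^+ 2) <= N%:R.
Proof.
move=> l0; case: (sg) (sh) => _ _ g1 g2 [_ _ h1 h2].
have [||||i b] := sum_bound iidX (k := a + l) (V := fun n w => g (X (n + a)%N w))
  (A := 1) (B := 1) _ _ _ mh ih2 h1 _ N.
- by move=> n; apply: smeas_obs => //; [exact: iota_uniq|rewrite mem_iota; lia].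
- by move=> n; have [] := ident_int iidX (n + a) (mx2 mg) ig2.
- by move=> n; have [_ ->] := ident_int iidX (n + a) (mx2 mg) ig2; rewrite g2.
- by rewrite h2.
by move: b; rewrite !mulr1.
Qed.

Lemma lag_term (n : nat) : integ P (fun w => g (X n w) * h (X (n + k)%N w)) /\
  mean P (fun w => `|g (X n w) * h (X (n + k)%N w)|) <= 1.
Proof.
have [i b] := sum_lag_sqr n 1 k0.
have E w : \sum_(i < 1) g (X (i + n)%N w) * h (X (i + (n + k))%N w) =
    g (X n w) * h (X (n + k)%N w) by rewrite big_ord1.
move: i b; under eq_fun do rewrite E; move=> i b.
have m1 : measurable_fun setT (fun w => g (X n w) * h (X (n + k)%N w)).
  exact: measurable_funM.
split; first exact: integ_sqr.
have := mean_normr_le m1 i; rewrite -[X in _ -> _ <= X]/1%R.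
have : 0 <= mean P (fun w => `|g (X n w) * h (X (n + k)%N w)|) by exact: mean_ge0.
by move: b; rewrite -[X in _ <= X]/1%R; set a := mean P _; set b := mean P _; nra.
Qed.

Lemma hat_gammaE N (y z : nat -> R) : (k < N)%N ->
  hat_gamma N k y z = (N - k)%:R^-1 * (\sum_(n < N - k) y n * z (n + k)%N
   - N%:R^-1 * (\sum_(n < N) y n) * (\sum_(n < N - k) z (n + k)%N)
   - N%:R^-1 * (\sum_(n < N) z n) * (\sum_(n < N - k) y n))
   + (N%:R^-1 * (\sum_(n < N) y n)) * (N%:R^-1 * (\sum_(n < N) z n)).
Proof.
move=> kN; have m0 : (N - k)%:R != 0 :> R by rewrite pnatr_eq0 subn_eq0 -ltnNge.
rewrite /hat_gamma /hat_m; set a := N%:R^-1 * _; set b := N%:R^-1 * \sum_(i < N) z i.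
have -> : \sum_(i < N - k) (y i - a) * (z (i + k)%N - b) =
   \sum_(n < N - k) y n * z (n + k)%N - a * (\sum_(n < N - k) z (n + k)%N)
   - b * (\sum_(n < N - k) y n) + (N - k)%:R * (a * b).
  have -> : (N - k)%:R * (a * b) = \sum_(i < N - k) a * b.
    by rewrite sumr_const card_ord mulr_natl.
  rewrite !mulr_sumr -!sumrB -big_split/=; apply: eq_bigr => i _; ring.
by rewrite mulrDr mulKf.
Qed.

Lemma gamma_approx : exists2 B : R, 0 <= B & forall N, (2 * K < N)%N ->
  integ P (fun w => Num.sqrt N%:R *
    hat_gamma N k (fun n => g (X n w)) (fun n => h (X n w)) - lag_sum N w) /\
  mean P (fun w => `|Num.sqrt N%:R *
    hat_gamma N k (fun n => g (X n w)) (fun n => h (X n w)) - lag_sum N w|) <= B / Num.sqrt N%:R.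
Proof.
(* [4 * K + 6] comes from the quadratic terms, each with mean at most [N], and [2 * K] from the
   boundary terms. *)
exists (6 * K%:R + 6); first by rewrite addr_ge0// mulr_ge0.
move=> N KN; have kN : (k < N)%N by lia.
have N1 : 1 <= N%:R :> R by rewrite ler1n; lia.
set r := Num.sqrt (N%:R : R).
have r1 : 1 <= r by rewrite -[leLHS]sqrtr1 ler_wsqrtr.
have r2 : r ^+ 2 = N%:R by rewrite sqr_sqrtr//; lra.
have r0 : 0 < r by lra.
pose F w l := g (X l w) * h (X (l + k)%N w).
pose W1 w := \sum_(n < N - k) F w n.
pose W2 w := \sum_(n < N - k) h (X (n + k)%N w).
pose W3 w := \sum_(n < N - k) g (X n w).
pose Sy w := \sum_(n < N) g (X n w).
pose Sz w := \sum_(n < N) h (X n w).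
(* The sum [W1] runs over [[0, N - k)] and the sum in [lag_sum] over [[K - k, N + K - k)]; the two
   ranges differ by [K] indices at the end and [K - k] at the start. *)
pose Rm w := \sum_(N - k <= l < N + (K - k)) `|F w l| + \sum_(0 <= l < K - k) `|F w l|.
have mN : (N - k)%:R <= N%:R :> R by rewrite ler_nat; lia.
have [i1 b1] : integ P (fun w => W1 w ^+ 2) /\ mean P (fun w => W1 w ^+ 2) <= N%:R.
  have [i b] := sum_lag_sqr 0 (N - k) k0.
  have E w : \sum_(n < N - k) g (X (n + 0)%N w) * h (X (n + (0 + k))%N w) = W1 w.
    by apply: eq_bigr => n _; rewrite addn0.
  move: i b; under eq_fun do rewrite E; move=> i b; split=> //; exact: le_trans b mN.
have [i2 b2] : integ P (fun w => W2 w ^+ 2) /\ mean P (fun w => W2 w ^+ 2) <= N%:R.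
  by have [i b] := sum_obs_sqr sh k (N - k); split=> //; exact: le_trans b mN.
have obs0 (f : R -> R) n w : \sum_(i < n) f (X (i + 0)%N w) = \sum_(i < n) f (X i w).
  by apply: eq_bigr => i _; rewrite addn0.
have [i3 b3] : integ P (fun w => W3 w ^+ 2) /\ mean P (fun w => W3 w ^+ 2) <= N%:R.
  have [] := sum_obs_sqr sg 0 (N - k); under eq_fun do rewrite obs0.
  by move=> i b; split=> //; exact: le_trans b mN.
have [iy b_y] : integ P (fun w => Sy w ^+ 2) /\ mean P (fun w => Sy w ^+ 2) <= N%:R.
  by have := sum_obs_sqr sg 0 N; under eq_fun do rewrite obs0.
have [iz bz] : integ P (fun w => Sz w ^+ 2) /\ mean P (fun w => Sz w ^+ 2) <= N%:R.
  by have := sum_obs_sqr sh 0 N; under eq_fun do rewrite obs0.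
have iF l : integ P (fun w => `|F w l|) by apply: integ_norm; have [] := lag_term l.
have [iR bR] : integ P Rm /\ mean P Rm <= 2 * K%:R.
  have j1 : integ P (fun w => \sum_(N - k <= l < N + (K - k)) `|F w l|) by exact: integ_sum.
  have j2 : integ P (fun w => \sum_(0 <= l < K - k) `|F w l|) by exact: integ_sum.
  split; first exact: integD.
  rewrite meanD// !mean_sum//.
  have bnd p q : \sum_(p <= l < q) mean P (fun w => `|F w l|) <= (q - p)%:R.
    apply: le_trans (_ : \sum_(p <= l < q) 1 <= _); last by rewrite sumr_const_nat.
    by apply: ler_sum => l _; have [] := lag_term l.
  apply: le_trans (lerD (bnd _ _) (bnd _ _)) _.
  by rewrite -natrD -natrM ler_nat; lia.
pose io : R := (N%:R * r)^-1.
have io0 : 0 <= io by rewrite invr_ge0 mulr_ge0//; lra.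
pose G w := io * (2 * K%:R * (1 + W1 w ^+ 2) + (Sy w ^+ 2 + W2 w ^+ 2)
  + (Sz w ^+ 2 + W3 w ^+ 2) + (Sy w ^+ 2 + Sz w ^+ 2)) + r^-1 * Rm w.
have j1 : integ P (fun w => 1 + W1 w ^+ 2) by apply: integD => //; exact: integ_cst.
have j2 : integ P (fun w => Sy w ^+ 2 + W2 w ^+ 2) by exact: integD.
have j3 : integ P (fun w => Sz w ^+ 2 + W3 w ^+ 2) by exact: integD.
have j4 : integ P (fun w => Sy w ^+ 2 + Sz w ^+ 2) by exact: integD.
have j5 : integ P (fun w => 2 * K%:R * (1 + W1 w ^+ 2) + (Sy w ^+ 2 + W2 w ^+ 2)).
  by apply: integD => //; exact: integZ.
have j6 : integ P (fun w => 2 * K%:R * (1 + W1 w ^+ 2) + (Sy w ^+ 2 + W2 w ^+ 2)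
  + (Sz w ^+ 2 + W3 w ^+ 2)) by exact: integD.
have j7 : integ P (fun w => 2 * K%:R * (1 + W1 w ^+ 2) + (Sy w ^+ 2 + W2 w ^+ 2)
  + (Sz w ^+ 2 + W3 w ^+ 2) + (Sy w ^+ 2 + Sz w ^+ 2)) by exact: integD.
have iG : integ P G by apply: integD; exact: integZ.
pose Df w := r * hat_gamma N k (fun n => g (X n w)) (fun n => h (X n w)) - lag_sum N w.
have lagE w : lag_sum N w = r^-1 * (W1 w + (\sum_(N - k <= l < N + (K - k)) F w l -
    \sum_(0 <= l < K - k) F w l)).
  rewrite /lag_sum; congr (_ * _).
  have -> : \sum_(n < N) g (X (n + K - k)%N w) * h (X (n + K)%N w) =
      \sum_(K - k <= l < N + (K - k)) F w l.
    rewrite -[X in \sum_(X <= _ < _) _]add0n big_addn addnK big_mkord.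
    apply: eq_bigr => n _; rewrite /F addnBA//.
    by rewrite subnK// (leq_trans kK)// leq_addl.
  have W1E : W1 w = \sum_(0 <= l < N - k) F w l by rewrite big_mkord.
  have e1 : \sum_(0 <= l < N + (K - k)) F w l =
      W1 w + \sum_(N - k <= l < N + (K - k)) F w l.
    by rewrite W1E -big_cat_nat// (leq_trans (leq_subr _ _))// leq_addr.
  have e2 : \sum_(0 <= l < N + (K - k)) F w l = \sum_(0 <= l < K - k) F w l +
      \sum_(K - k <= l < N + (K - k)) F w l.
    by rewrite -big_cat_nat// leq_addl.
  by rewrite addrA -e1 e2 addrC addrA addNr add0r.
have mDf : measurable_fun setT Df.
  have -> : Df = fun w => r * ((N - k)%:R^-1 * (W1 w - N%:R^-1 * Sy w * W2 w -
    N%:R^-1 * Sz w * W3 w) + (N%:R^-1 * Sy w) * (N%:R^-1 * Sz w)) - lag_sum N w.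
    by apply/funext => w; rewrite /Df hat_gammaE.
  have mW1 : measurable_fun setT W1 by apply: measurable_sum => n; exact: measurable_funM.
  have mW2 : measurable_fun setT W2 by exact: measurable_sum.
  have mW3 : measurable_fun setT W3 by exact: measurable_sum.
  have mSy : measurable_fun setT Sy by exact: measurable_sum.
  have mSz : measurable_fun setT Sz by exact: measurable_sum.
  apply: measurable_funB; last first.
    by apply: measurable_funM => //; apply: measurable_sum => n; exact: measurable_funM.
  apply: measurable_funM => //; apply: measurable_funD; last first.
    by apply: measurable_funM; exact: measurable_funM.
  apply: measurable_funM => //; apply: measurable_funB.
    by apply: measurable_funB => //; apply: measurable_funM => //; exact: measurable_funM.
  by apply: measurable_funM => //; exact: measurable_funM.
have DG w : `|Df w| <= G w.
  rewrite /Df hat_gammaE// -/(W1 w) -/(W2 w) -/(W3 w) -/(Sy w) -/(Sz w) lagE.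
  apply: gamma_algebra => //.
  by apply: le_trans (ler_normB _ _) _; rewrite lerD// ler_norm_sum.
have iDf : integ P Df := integ_le mDf iG DG.
split; first exact: iDf.
apply: le_trans (mean_le (integ_norm iDf) iG DG) _.
rewrite /G meanD; [|exact: integZ|exact: integZ].
rewrite !meanZ// meanD// meanD// meanD//; last exact: integZ.
rewrite meanZ// meanD//; last exact: integ_cst.
rewrite mean_cst (meanD iy i2) (meanD iz i3) (meanD iy iz).
set a1 := mean P (fun w => W1 w ^+ 2) in b1 *; set a2 := mean P (fun w => W2 w ^+ 2) in b2 *.
set a3 := mean P (fun w => W3 w ^+ 2) in b3 *; set ay := mean P (fun w => Sy w ^+ 2) in b_y *.
set az := mean P (fun w => Sz w ^+ 2) in bz *.
have -> : (6 * K%:R + 6) / r = io * (2 * K%:R * (N%:R + N%:R) + (N%:R + N%:R) + (N%:R + N%:R)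
   + (N%:R + N%:R)) + r^-1 * (2 * K%:R).
  by rewrite /io -r2; field; lra.
rewrite lerD//; last by rewrite ler_wpM2l// invr_ge0 ltW.
rewrite ler_wpM2l//.
do 3 (apply: lerD; last exact: lerD).
by rewrite ler_wpM2l ?mulr_ge0// lerD.
Qed.

Lemma lag_sum_sqr N : (0 < N)%N -> integ P (lag_sum N) /\
  mean P (fun w => `|lag_sum N w|) <= 2.
Proof.
move=> N0; have [i b] := sum_lag_sqr (K - k) N k0.
have N1 : 1 <= N%:R :> R by rewrite ler1n.
have E w : (\sum_(n < N) g (X (n + (K - k))%N w) * h (X (n + (K - k + k))%N w)) ^+ 2 =
    N%:R * lag_sum N w ^+ 2.
  rewrite /lag_sum exprMn exprVn sqr_sqrtr// mulVKf; last by lra.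
  by congr (_ ^+ 2); apply: eq_bigr => n _; rewrite subnK// addnBA.
move: i b; under eq_fun do rewrite E; move=> i b.
have iS : integ P (fun w => lag_sum N w ^+ 2).
  have := integZ (N%:R)^-1 i; congr integ; apply/funext => w.
  by rewrite mulKf//; lra.
have mS : measurable_fun setT (lag_sum N).
  by apply: measurable_funM => //; apply: measurable_sum => n; exact: measurable_funM.
split; first exact: integ_sqr.
move: b; rewrite meanZ// => b.
have b' : mean P (fun w => lag_sum N w ^+ 2) <= 1.
  by rewrite -(ler_pM2l (_ : 0 < N%:R)) ?mulr1//; lra.
have := mean_normr_le mS iS.
have : 0 <= mean P (fun w => `|lag_sum N w|) by exact: mean_ge0.
move: b'; set a := mean P _; set c := mean P _; nra.
Qed.

End TwoFunctions.
End SampleMoments.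

(** * Slutsky's theorem *)

Section Slutsky.
Context (d : measure_display) (T : measurableType d) (R : realType).
Variables (P : probability T R) (D : nat) (Y S : nat -> T -> 'rV[R]_D).
Hypothesis mY : forall N p, measurable_fun setT (fun w => Y N w 0 p).
Hypothesis mS : forall N p, measurable_fun setT (fun w => S N w 0 p).
Hypothesis YS : forall (eps : R) p, 0 < eps ->
  \forall N \near \oo, mean P (fun w => Num.min 1 `|Y N w 0 p - S N w 0 p|) <= eps.

Let imin N p : integ P (fun w => Num.min 1 `|Y N w 0 p - S N w 0 p|).
Proof.
under eq_fun do rewrite -[`|_|]divr1; apply: integ_min1 => //.
exact: measurable_funB.
Qed.

(** If all coordinates differ by at most 1, the Lipschitz bound of the cosine applies; otherwise
    some truncated difference equals 1 and the trivial bound 2 is enough. The weight [2 + |t 0 p|]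
    covers both cases. *)
Lemma slutsky_cos (t : 'rV[R]_D) (a l : R) :
  mean P (fun w => cos ((t *m (S N w)^T) 0 0 + a)) @[N --> \oo] --> l ->
  mean P (fun w => cos ((t *m (Y N w)^T) 0 0 + a)) @[N --> \oo] --> l.
Proof.
move=> cS; pose c := \sum_p (2 + `|t 0 p|).
have c0 : 0 <= c by apply: sumr_ge0 => p _; exact: addr_ge0.
have bnd N (e : R) : (forall p, mean P (fun w => Num.min 1 `|Y N w 0 p - S N w 0 p|) <= e) ->
    `|mean P (fun w => cos ((t *m (S N w)^T) 0 0 + a)) -
      mean P (fun w => cos ((t *m (Y N w)^T) 0 0 + a))| <= c * e.
  move=> he.
  have iS := integ_cos_dot P (mS N) t a; have iY := integ_cos_dot P (mY N) t a.
  have iM p : integ P (fun w => (2 + `|t 0 p|) * Num.min 1 `|Y N w 0 p - S N w 0 p|).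
    exact: integZ.
  have iG : integ P (fun w => \sum_p (2 + `|t 0 p|) * Num.min 1 `|Y N w 0 p - S N w 0 p|).
    exact: integ_sum.
  rewrite -meanB//; apply: le_trans (mean_le_norm (integ_meas (integB iS iY)) iG _) _.
    move=> w; have m0 p : 0 <= (2 + `|t 0 p|) * Num.min 1 `|Y N w 0 p - S N w 0 p|.
      by rewrite mulr_ge0 ?addr_ge0// le_min ler01/=.
    have [H|] := pselect (forall p, `|Y N w 0 p - S N w 0 p| <= 1).
      apply: le_trans (norm_cosB _ _) _; rewrite opprD addrACA subrr addr0 !mxE -sumrB.
      apply: le_trans (ler_norm_sum _ _ _) _; apply: ler_sum => p _.
      rewrite !mxE -mulrBr normrM distrC ler_pM// ?lerDr//.
      by rewrite le_min lexx H.
    move=> /existsNP[p /negP]; rewrite -ltNge => H.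
    apply: le_trans (_ : 2 <= _).
      apply: le_trans (ler_normB _ _) _.
      apply: le_trans (lerD (cos_max _) (cos_max _)) _; lra.
    rewrite (bigD1 p)//=; apply: ler_wpDr; first exact: sumr_ge0.
    by rewrite min_l ?(ltW H)// mulr1 lerDl.
  rewrite mean_sum// mulr_suml; apply: ler_sum => p _.
  by rewrite meanZ// ler_wpM2l// addr_ge0.
apply/cvgrPdist_le => eps e0.
pose e := eps / 2 / (c + 1).
have e1 : 0 < e by rewrite !divr_gt0//; lra.
near=> N.
have h1 : `|l - mean P (fun w => cos ((t *m (S N w)^T) 0 0 + a))| <= eps / 2.
  by near: N; move/cvgrPdist_le: cS; apply; rewrite divr_gt0.
have h2 : forall p, mean P (fun w => Num.min 1 `|Y N w 0 p - S N w 0 p|) <= e.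
  by near: N; apply: filter_forall => p; exact: YS.
have h3 := bnd _ _ h2.
have h4 : c * e <= eps / 2.
  have -> : c * e = c / (c + 1) * (eps / 2) by rewrite /e; field; lra.
  by rewrite ler_piMl ?divr_ge0 ?(ltW e0)// ler_pdivrMr ?mul1r; lra.
rewrite -(subrKA (mean P (fun w => cos ((t *m (S N w)^T) 0 0 + a)))).
by apply: le_trans (ler_normD _ _) _; lra.
Unshelve. all: end_near. Qed.

(** For [L >= 1] the truncated size of [Y] is at most the truncated difference plus [|S| / L], and
    the first moment of [S] is bounded. *)
Lemma slutsky_tight (B : R) :
  (forall N p, (0 < N)%N -> integ P (fun w => S N w 0 p) /\
    mean P (fun w => `|S N w 0 p|) <= B) ->
  forall eps : R, 0 < eps -> \forall L \near +oo, \forall N \near \oo,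
    forall p, mean P (fun w => Num.min 1 (`|Y N w 0 p| / L)) <= eps.
Proof.
move=> SB eps e0; 
have HL : \forall L \near +oo, B / (eps / 2) <= L by apply: nbhs_pinfty_ge; exact: num_real.
near=> L.
have L1 : 1 <= L by near: L; exact: nbhs_pinfty_ge.
have L0 : 0 < L by lra.
have LB : B / L <= eps / 2.
  have : B / (eps / 2) <= L by near: L; exact: HL.
  by rewrite !ler_pdivrMr// ?divr_gt0// mulrC.
near=> N.
have N0 : (0 < N)%N by near: N; exact: nbhs_infty_gt.
have h : forall p, mean P (fun w => Num.min 1 `|Y N w 0 p - S N w 0 p|) <= eps / 2.
  by near: N; apply: filter_forall => p; apply: YS; rewrite divr_gt0.
move=> p; have [iS bS] := SB N p N0.
have iSL : integ P (fun w => L^-1 * `|S N w 0 p|) by apply: integZ; exact: integ_norm.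
have iG : integ P (fun w => Num.min 1 `|Y N w 0 p - S N w 0 p| + L^-1 * `|S N w 0 p|).
  exact: integD.
apply: le_trans (mean_le _ iG _) _; first exact: integ_min1.
  move=> w; set y := Y N w 0 p; set s := S N w 0 p.
  have sL : 0 <= L^-1 * `|s| by rewrite mulr_ge0// invr_ge0 ltW.
  have [H|H] := leP 1 `|y - s|.
    by rewrite ge_min lerDl sL.
  rewrite ge_min; apply/orP; right.
  have := ler_normD (y - s) s; rewrite subrK => hy.
  rewrite ler_pdivrMr// mulrDl mulrAC mulVf ?gt_eqF// mul1r.
  apply: le_trans hy _; rewrite lerD2r ler_peMr//.
rewrite meanD//= meanZ; last exact: integ_norm.
have : L^-1 * mean P (fun w => `|S N w 0 p|) <= B / L.
  by rewrite mulrC ler_wpM2r// invr_ge0 ltW.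
by have := h p; lra.
Unshelve. all: end_near. Qed.

End Slutsky.

(** If some [s1] or [s2] is farther than [eta] from 1, the last term is at least 1 and the
    truncation settles the claim. Otherwise the denominator lies in [[1 - eta, 1 + eta]], and its
    inverse is at most 2 as [eta <= 1 / 2]. *)
Lemma ratio_bound (R : realType) (A S s1 s2 eta : R) : 0 <= s1 -> 0 <= s2 ->
  0 < eta -> eta <= 2^-1 ->
  Num.min 1 `|A / (Num.sqrt s1 * Num.sqrt s2) - S| <=
  2 * `|A - S| + 2 * eta * `|S| + eta^-1 * (`|s1 - 1| + `|s2 - 1|).
Proof.
move=> s10 s20 e0 e2.
have p1 : 0 <= 2 * `|A - S| by rewrite mulr_ge0.
have p2 : 0 <= 2 * eta * `|S| by rewrite mulr_ge0// mulr_ge0// ltW.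
have big u v : eta < `|u : R| -> 1 <= eta^-1 * (`|u| + `|v : R|).
  by move=> hu; rewrite mulrC ler_pdivlMr// mul1r ler_wpDr// ltW.
have [h1|/big h1] := leP `|s1 - 1| eta; last first.
  by rewrite ge_min; apply/orP; left; have := h1 (s2 - 1); lra.
have [h2|/big h2] := leP `|s2 - 1| eta; last first.
  by rewrite ge_min; apply/orP; left; have := h2 (s1 - 1); rewrite addrC; lra.
rewrite ge_min; apply/orP; right; apply: ler_wpDr.
  by rewrite mulr_ge0 ?addr_ge0// invr_ge0 ltW.
rewrite -sqrtrM//; set c := Num.sqrt _.
have c0 : 0 <= c by exact: sqrtr_ge0.
have cE : c ^+ 2 = s1 * s2 by rewrite sqr_sqrtr// mulr_ge0.
move: h1; rewrite (ler_norml (s1 - 1)) => /andP[a1 a2].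
move: h2; rewrite (ler_norml (s2 - 1)) => /andP[b1 b2].
have l : (1 - eta) ^+ 2 <= c ^+ 2 by rewrite cE expr2 ler_pM//; lra.
have u : c ^+ 2 <= (1 + eta) ^+ 2 by rewrite cE expr2 ler_pM//; lra.
have {}l : 1 - eta <= c by rewrite -(ler_pXn2r (n := 2))// nnegrE; lra.
have {}u : c <= 1 + eta by rewrite -(ler_pXn2r (n := 2))// nnegrE; lra.
have c1 : 0 < c by lra.
have -> : A / c - S = c^-1 * (A - S) + c^-1 * ((1 - c) * S) by field; lra.
have ci : c^-1 <= 2 by rewrite invf_ple ?posrE//; lra.
have ci0 : 0 <= c^-1 by rewrite invr_ge0.
apply: le_trans (ler_normD _ _) _; rewrite !normrM (ger0_norm ci0).
apply: lerD; first by rewrite ler_wpM2r.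
rewrite mulrA ler_wpM2r// ler_pM// ler_norml; apply/andP; split; lra.
Qed.

(** * Sample correlations *)

Section SampleCorrelation.
Context (d : measure_display) (T : measurableType d) (R : realType).
Variables (P : probability T R) (X : nat -> T -> R).
Hypothesis iidX : iid_seq P X.
Let mX n : measurable_fun setT (X n). Proof. by have [] := iidX. Qed.

(* No case distinction is needed, since [x / 0 = 0]. *)
Lemma hat_rhoE N k (y z : nat -> R) :
  hat_rho N k y z = hat_gamma N k y z / (hat_s N y * hat_s N z).
Proof. by rewrite /hat_rho; case: eqP => // ->; rewrite invr0 mulr0. Qed.

Lemma hat_s2_ge0 N (y : nat -> R) : 0 <= hat_s2 N y.
Proof. by rewrite mulr_ge0 ?invr_ge0// sumr_ge0// => i _; exact: sqr_ge0. Qed.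

Lemma measurable_hat_m (g : R -> R) N : measurable_fun setT g ->
  measurable_fun setT (fun w => hat_m N (fun n => g (X n w))).
Proof.
move=> mg; apply: measurable_funM => //; apply: measurable_sum => n.
exact: measurableT_comp (mX n).
Qed.

(** The inverse square root is a real power of the sample variance, also where the variance vanishes
    and both sides are 0; real powers are measurable. *)
Lemma measurable_hat_s_inv (g : R -> R) N : measurable_fun setT g ->
  measurable_fun setT (fun w => (hat_s N (fun n => g (X n w)))^-1).
Proof.
move=> mg.
have mgX n : measurable_fun setT (fun w => g (X n w)) by exact: measurableT_comp (mX n).
have -> : (fun w => (hat_s N (fun n => g (X n w)))^-1) =
    (fun w => hat_s2 N (fun n => g (X n w)) `^ (2^-1 * -1)).
  apply/funext => w; rewrite powRrM powR_inv1 ?powR_ge0//.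
  by rewrite powR12_sqrt// hat_s2_ge0.
have mp : measurable_fun setT (fun x : R => x `^ (2^-1 * -1)) := measurable_powR _.
apply: (measurableT_comp mp).
apply: measurable_funM => //; apply: measurable_sum => n.
by apply: measurable_funX; apply: measurable_funB => //; exact: measurable_hat_m.
Qed.

Lemma measurable_hat_rho (g h : R -> R) N k : measurable_fun setT g -> measurable_fun setT h ->
  measurable_fun setT (fun w => hat_rho N k (fun n => g (X n w)) (fun n => h (X n w))).
Proof.
move=> mg mh.
have mfX (f : R -> R) n : measurable_fun setT f -> measurable_fun setT (fun w => f (X n w)).
  by move=> mf; exact: measurableT_comp (mX n).
under eq_fun do rewrite hat_rhoE invfM.
apply: measurable_funM; last by apply: measurable_funM; exact: measurable_hat_s_inv.
apply: measurable_funM => //; apply: measurable_sum => n.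
by apply: measurable_funM; apply: measurable_funB; (exact: mfX || exact: measurable_hat_m).
Qed.

Lemma rho_approx (g h : R -> R) (k K : nat) (eps : R) : standardized P X g ->
  standardized P X h -> (0 < k)%N -> (k <= K)%N -> 0 < eps ->
  \forall N \near \oo, mean P (fun w => Num.min 1
    `|Num.sqrt N%:R * hat_rho N k (fun n => g (X n w)) (fun n => h (X n w)) -
      lag_sum X g h k K N w|) <= eps.
Proof.
move=> sg sh k0 kK e0.
have [B B0 HB] := gamma_approx iidX sg sh k0 kK.
have [C1 C10 H1] := hat_s2_bound iidX sg.
have [C2 C20 H2] := hat_s2_bound iidX sh.
(* Since the lag sum has first moment at most 2, its term costs at most [4 * eta <= eps / 2]; [eta]
   is fixed before [N] grows and removes the rest. *)
pose eta := Num.min 2^-1 (eps / 8).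
have eta0 : 0 < eta by rewrite lt_min invr_gt0 ltr0n divr_gt0.
have eta1 : eta <= 2^-1 by rewrite ge_min lexx.
have eta2 : eta <= eps / 8 by rewrite ge_min lexx orbT.
have [mg _ _ _] := sg; have [mh _ _ _] := sh.
near=> N.
have KN : (2 * K < N)%N by near: N; exact: nbhs_infty_gt.
have N0 : (0 < N)%N by apply: leq_ltn_trans KN.
have hN : (2 * B + eta^-1 * (C1 + C2)) / Num.sqrt N%:R < eps / 2.
  by near: N; apply: cvg_lt_sqrt; rewrite divr_gt0.
have [iA bA] := HB N KN; have [i1 b1] := H1 N N0; have [i2 b2] := H2 N N0.
have [iS bS] := lag_sum_sqr iidX sg sh k0 kK N0.
set A := fun w => Num.sqrt N%:R * hat_gamma N k (fun n => g (X n w)) (fun n => h (X n w)) -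
  lag_sum X g h k K N w in iA bA.
have j12 : integ P (fun w => `|hat_s2 N (fun n => g (X n w)) - 1| +
    `|hat_s2 N (fun n => h (X n w)) - 1|) by apply: integD; exact: integ_norm.
have jAS : integ P (fun w => 2 * `|A w| + 2 * eta * `|lag_sum X g h k K N w|).
  by apply: integD; apply: integZ; exact: integ_norm.
have iG : integ P (fun w => 2 * `|A w| + 2 * eta * `|lag_sum X g h k K N w| +
    eta^-1 * (`|hat_s2 N (fun n => g (X n w)) - 1| + `|hat_s2 N (fun n => h (X n w)) - 1|)).
  by apply: integD => //; exact: integZ.
apply: le_trans (mean_le _ iG _) _.
- under eq_fun do rewrite -[`|_|]divr1; apply: integ_min1 => //.
  apply: measurable_funB; last exact: integ_meas iS.
  by apply: measurable_funM => //; exact: measurable_hat_rho.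
- by move=> w; rewrite hat_rhoE mulrA; apply: ratio_bound => //; exact: hat_s2_ge0.
rewrite meanD//; last exact: integZ.
rewrite meanD; [|by apply: integZ; exact: integ_norm|by apply: integZ; exact: integ_norm].
rewrite !meanZ//; [|exact: integ_norm|exact: integ_norm].
rewrite meanD; [|exact: integ_norm|exact: integ_norm].
have hA : 2 * mean P (fun w => `|A w|) <= 2 * (B / Num.sqrt N%:R) by rewrite ler_wpM2l.
have hS : 2 * eta * mean P (fun w => `|lag_sum X g h k K N w|) <= eps / 2.
  apply: le_trans (_ : 2 * eta * 2 <= _); last lra.
  by rewrite ler_wpM2l// mulr_ge0// ltW.
have h12 := ler_wpM2l (ltW (_ : 0 < eta^-1)) (lerD b1 b2).
rewrite invr_gt0 in h12; have {}h12 := h12 eta0.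
rewrite -!mulrDl mulrA in h12; rewrite mulrDl -mulrA in hN.
lra.
Unshelve. all: end_near. Qed.

End SampleCorrelation.

(** * The limit theorem *)

Section LagCLT.
Context (d : measure_display) (T : measurableType d) (R : realType).
Variables (P : probability T R) (X : nat -> T -> R).
Hypothesis iidX : iid_seq P X.
Let mX n : measurable_fun setT (X n). Proof. by have [] := iidX. Qed.

(** Induction on the number of components with (a + b)^4 <= 8 a^4 + 8 b^4; only the independence of
    the bound from [n] matters, not its size. *)
Lemma pow4_sum (D : nat) (F : 'I_D -> nat -> T -> R) :
  (forall p n, measurable_fun setT (F p n)) ->
  (forall p, exists M : R, forall n, integ P (fun w => F p n w ^+ 4) /\
    mean P (fun w => F p n w ^+ 4) <= M) ->
  exists M : R, forall n, integ P (fun w => (\sum_p F p n w) ^+ 4) /\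
    mean P (fun w => (\sum_p F p n w) ^+ 4) <= M.
Proof.
elim: D F => [|D IH] F mF FM.
  exists 0 => n; under eq_fun do rewrite big_ord0 expr0n.
  by rewrite mean_cst lexx; split=> //; exact: integ_cst.
have [M1 H1] := FM ord0.
have [||M2 H2] := IH (fun p => F (lift ord0 p)).
- by move=> p n; exact: mF.
- by move=> p; exact: FM.
exists (8 * M1 + 8 * M2) => n; under eq_fun do rewrite big_ord_recl.
have [i1 b1] := H1 n; have [i2 b2] := H2 n.
set F2 := fun w => \sum_(i < D) F (lift ord0 i) n w in i2 b2.
have ab (a b : R) : (a + b) ^+ 4 <= 8 * a ^+ 4 + 8 * b ^+ 4.
  have h1 : (a + b) ^+ 2 <= 2 * (a ^+ 2 + b ^+ 2) by have := sqr_ge0 (a - b); lra.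
  have h2 : ((a + b) ^+ 2) ^+ 2 <= (2 * (a ^+ 2 + b ^+ 2)) ^+ 2.
    by rewrite lerXn2r// nnegrE ?sqr_ge0// mulr_ge0// addr_ge0// sqr_ge0.
  rewrite -[X in _ ^+ X <= _]/(2 * 2)%N exprM; apply: le_trans h2 _.
  by have := sqr_ge0 (a ^+ 2 - b ^+ 2); lra.
have iG : integ P (fun w => 8 * F ord0 n w ^+ 4 + 8 * F2 w ^+ 4).
  by apply: integD; exact: integZ.
have iS : integ P (fun w => (F ord0 n w + F2 w) ^+ 4).
  apply: integ_le iG _.
    apply: measurable_funX; apply: measurable_funD => //; exact: measurable_sum.
  by move=> w; rewrite ger0_norm ?exprn_even_ge0.
split => //; apply: le_trans (mean_le iS iG _) _ => //.
rewrite meanD; [|exact: integZ|exact: integZ].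
by rewrite !meanZ// lerD// ler_wpM2l.
Qed.

Variables (D K : nat) (g h : 'I_D -> R -> R) (lag : 'I_D -> nat).
Hypothesis sg : forall p, standardized P X (g p).
Hypothesis sh : forall p, standardized P X (h p).
Hypothesis lag0 : forall p, (0 < lag p)%N.
Hypothesis lagK : forall p, (lag p <= K)%N.

Let mg p : measurable_fun setT (g p). Proof. by case: (sg p). Qed.
Let mh p : measurable_fun setT (h p). Proof. by case: (sh p). Qed.

(** The covariance matrix of a single vector of lagged products. Different lags use different older
    observations, which are independent and centered, hence the indicator. *)
Definition lag_cov : 'M[R]_D := \matrix_(p, q)
  ((lag p == lag q)%:R * (mean P (fun w => g p (X 0%N w) * g q (X 0%N w)) *
    mean P (fun w => h p (X 0%N w) * h q (X 0%N w)))).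

Lemma lag_cov_sym : lag_cov^T = lag_cov.
Proof.
have C (u v : T -> R) : mean P (fun w => u w * v w) = mean P (fun w => v w * u w).
  by apply: eq_mean => w; rewrite mulrC.
by apply/matrixP => p q; rewrite !mxE eq_sym C (C (fun w => h q (X 0%N w))).
Qed.

(** The older factor of the lagged product; the newer one, [U p n], is a function of [X (n + K)] for
    every component [p], so that each linear combination is a martingale difference. *)
Let V p n w := g p (X (n + K - lag p)%N w).
Let U p n w := h p (X (n + K)%N w).

Let wV p n : smeas X (iota 0 (n + K)) (V p n).
Proof.
apply: smeas_obs => //; first exact: iota_uniq.
by rewrite mem_iota/= add0n ltn_subrL lag0 (leq_trans (lag0 p))// (leq_trans (lagK p))// leq_addl.
Qed.

Let wU p n : smeas X (iota (n + K) 1) (U p n).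
Proof. by apply: smeas_obs => //; rewrite inE. Qed.

Let mV p n : measurable_fun setT (V p n). Proof. exact: measurableT_comp (mX _). Qed.
Let mU p n : measurable_fun setT (U p n). Proof. exact: measurableT_comp (mX _). Qed.

Let sq0 (f : R -> R) : standardized P X f -> integ P (fun w => f (X 0%N w) ^+ 2).
Proof.
by move=> [mf i4 _ _]; apply: integ_pow4 => //; exact: measurableT_comp (mX _).
Qed.

Let prod_obs (f1 f2 : R -> R) n : standardized P X f1 -> standardized P X f2 ->
  integ P (fun w => f1 (X n w) * f2 (X n w)) /\
  mean P (fun w => f1 (X n w) * f2 (X n w)) = mean P (fun w => f1 (X 0%N w) * f2 (X 0%N w)).
Proof.
move=> s1 s2; have [m1 _ _ _] := s1; have [m2 _ _ _] := s2.
apply: (ident_int iidX n (f := fun x => f1 x * f2 x)); first exact: measurable_funM.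
apply: integ_mul; [exact: measurableT_comp (mX _)|exact: measurableT_comp (mX _)| |];
  exact: sq0.
Qed.

Let prod_V p q n : integ P (fun w => V p n w * V q n w) /\
  mean P (fun w => V p n w * V q n w) =
  (lag p == lag q)%:R * mean P (fun w => g p (X 0%N w) * g q (X 0%N w)).
Proof.
have [e|ne] := eqVneq (lag p) (lag q).
  by rewrite mul1r /V -e; exact: prod_obs.
have ns : uniq ([:: (n + K - lag p)%N] ++ [:: (n + K - lag q)%N]).
  rewrite /= inE andbT; apply: contraNneq ne.
  have l1 : (lag p <= n + K)%N by rewrite (leq_trans (lagK p))// leq_addl.
  have l2 : (lag q <= n + K)%N by rewrite (leq_trans (lagK q))// leq_addl.
  by move=> /(congr1 (fun j => n + K - j)%N); rewrite !subKn// => ->.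
have w1 : smeas X [:: (n + K - lag p)%N] (V p n) by apply: smeas_obs => //; rewrite inE.
have w2 : smeas X [:: (n + K - lag q)%N] (V q n) by apply: smeas_obs => //; rewrite inE.
have obs r a : integ P (fun w => g r (X a w)) /\ mean P (fun w => g r (X a w)) = 0.
  have [mr _ r0 _] := sg r.
  have i1 : integ P (fun w => g r (X 0%N w)).
    by apply: integ_sqr (sq0 (sg r)); exact: measurableT_comp (mX _).
  by have [i ->] := ident_int iidX a mr i1.
have [ip p0] := obs p (n + K - lag p)%N; have [iq q0] := obs q (n + K - lag q)%N.
have [i ->] := mean_window iidX ns w1 w2 ip iq.
by rewrite p0 !mul0r.
Qed.

Let prod_term p q n :
  integ P (fun w => (V p n w * U p n w) * (V q n w * U q n w)) /\
  mean P (fun w => (V p n w * U p n w) * (V q n w * U q n w)) = lag_cov p q.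
Proof.
have [iV mVV] := prod_V p q n.
have [iU mUU] := prod_obs (n + K) (sh p) (sh q).
have E w : (V p n w * U p n w) * (V q n w * U q n w) = (V p n w * V q n w) * (U p n w * U q n w).
  by rewrite mulrACA.
have [i m] := mean_window iidX (iota_cat1 (n + K)) (smeasM (@wV p n) (@wV q n))
  (smeasM (@wU p n) (@wU q n)) iV iU.
under eq_fun do rewrite E; split; first exact: i.
by rewrite m mVV mUU mxE mulrA.
Qed.

Variable t : 'rV[R]_D.
Let xi n w := \sum_p t 0 p * (V p n w * U p n w).

Let xi_sqr n : integ P (fun w => xi n w ^+ 2) /\
  mean P (fun w => xi n w ^+ 2) = (t *m lag_cov *m t^T) 0 0.
Proof.
have E w : xi n w ^+ 2 = \sum_q \sum_p
    (t 0 p * t 0 q) * ((V p n w * U p n w) * (V q n w * U q n w)).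
  rewrite expr2 /xi mulr_sumr; apply: eq_bigr => q _; rewrite mulr_suml.
  by apply: eq_bigr => p _; rewrite mulrACA.
have i1 p q : integ P (fun w => (t 0 p * t 0 q) * ((V p n w * U p n w) * (V q n w * U q n w))).
  by apply: integZ; have [] := prod_term p q n.
have i2 q : integ P (fun w => \sum_p (t 0 p * t 0 q) * ((V p n w * U p n w) * (V q n w * U q n w))).
  exact: integ_sum.
under eq_fun do rewrite E; split; first exact: integ_sum.
rewrite mean_sum// mxE; apply: eq_bigr => q _.
rewrite mean_sum// !mxE mulr_suml; apply: eq_bigr => p _.
have [i m] := prod_term p q n.
by rewrite meanZ// m mulrAC.
Qed.

Lemma lag_cov_ge0 : 0 <= (t *m lag_cov *m t^T) 0 0.
Proof. by have [_ <-] := xi_sqr 0; apply: mean_ge0 => w; exact: sqr_ge0. Qed.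

(** Each component is a product of functions of independent observations, so its fourth moment is a
    product of fourth moments, the same for all [n]. *)
Let xi_pow4 : exists M : R, forall n, integ P (fun w => xi n w ^+ 4) /\
  mean P (fun w => xi n w ^+ 4) <= M.
Proof.
apply: (@pow4_sum D (fun p n w => t 0 p * (V p n w * U p n w))) => [p n|p].
  by apply: measurable_funM => //; exact: measurable_funM.
exists (t 0 p ^+ 4 * (mean P (fun w => g p (X 0%N w) ^+ 4) *
  mean P (fun w => h p (X 0%N w) ^+ 4))) => n.
have p4 (f : R -> R) a : standardized P X f -> integ P (fun w => f (X a w) ^+ 4) /\
    mean P (fun w => f (X a w) ^+ 4) = mean P (fun w => f (X 0%N w) ^+ 4).
  move=> [mf i4 _ _]; apply: (ident_int iidX a (f := fun x => f x ^+ 4)) => //.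
  exact: measurable_funX.
have [iV mV4] := p4 _ (n + K - lag p)%N (sg p).
have [iU mU4] := p4 _ (n + K)%N (sh p).
have x4 : measurable_fun setT (fun x : R => x ^+ 4) by exact: measurable_funX.
have [i m] := mean_window iidX (iota_cat1 (n + K)) (smeas_comp x4 (@wV p n))
  (smeas_comp x4 (@wU p n)) iV iU.
under eq_fun do rewrite !exprMn.
by split; [exact: integZ|rewrite meanZ// m mV4 mU4].
Qed.

Let xi_win n : smeas X (iota n K.+1) (xi n).
Proof.
apply: smeas_sum => p _; apply: smeasM; first exact: smeas_cst.
apply: smeasM; apply: smeas_obs => //; try exact: iota_uniq.
  rewrite mem_iota -addnBA// leq_addr/= ltn_add2l ltnS.
  exact: leq_subr.
by rewrite mem_iota leq_addr/= addnS ltnS.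
Qed.

Let xi_md n F (c : R) : smeas X (iota 0 (n + K)) F -> (forall w, `|F w| <= c) ->
  mean P (fun w => F w * xi n w) = 0.
Proof.
move=> wF Fc; have mF := smeas_meas iidX wF.
have iF2 : integ P (fun w => F w ^+ 2).
  apply: (@integ_bounded _ _ _ P _ (c ^+ 2)); first exact: measurable_funX.
  by move=> w; rewrite normrX lerXn2r// nnegrE (le_trans _ (Fc w)).
have iV2 p : integ P (fun w => V p n w ^+ 2).
  have [] := ident_int iidX (n + K - lag p) (f := fun x => g p x ^+ 2) _ (sq0 (sg p)) => //.
  exact: measurable_funX.
have H p : integ P (fun w => F w * (V p n w * U p n w)) /\
    mean P (fun w => F w * (V p n w * U p n w)) = 0.
  have [mhp _ h0 _] := sh p.
  have [_ i2 _ md] := innovation iidX (@wV p n) (iV2 p) mhp (sq0 (sh p)) h0.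
  by split; [apply: integ_mul => //; exact: measurable_funM|exact: md].
have E w : F w * xi n w = \sum_p t 0 p * (F w * (V p n w * U p n w)).
  by rewrite mulr_sumr; apply: eq_bigr => p _; rewrite mulrCA.
under eq_fun do rewrite E; rewrite mean_sum; last first.
  by move=> p _; apply: integZ; have [] := H p.
by apply: big1 => p _; have [i m] := H p; rewrite meanZ// m mulr0.
Qed.

Lemma lag_clt (a : R) :
  mean P (fun w => cos ((t *m (\row_p lag_sum X (g p) (h p) (lag p) K N w)^T) 0 0 + a))
    @[N --> \oo] --> cos a * expR (- ((t *m lag_cov *m t^T) 0 0) / 2).
Proof.
have [M HM] := xi_pow4.
have [B HB] : exists B : R, forall (alpha : R) (N : nat), (0 < N)%N ->
  `|mean P (fun w => cos ((Num.sqrt N%:R)^-1 * (\sum_(0 <= l < N) xi l w) + alpha)) -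
    cos alpha * expR (- ((t *m lag_cov *m t^T) 0 0) / 2)| <= B / Num.sqrt N%:R.
  apply: (char_clt iidX xi_win _ _ _ xi_md) => n.
  - by have [] := HM n.
  - by have [_ /le_trans] := HM n; apply.
  - by have [] := xi_sqr n.
apply/cvgrPdist_le => eps e0; near=> N.
have N0 : (0 < N)%N by near: N; exact: nbhs_infty_gt.
have hB : B / Num.sqrt N%:R < eps by near: N; exact: cvg_lt_sqrt.
rewrite distrC; apply: le_trans _ (ltW hB); apply: le_trans _ (HB a N N0).
rewrite le_eqVlt; apply/orP; left; apply/eqP; congr `|_ - _|.
apply: eq_mean => w; congr (cos (_ + _)).
rewrite mxE big_mkord /xi exchange_big mulr_sumr; apply: eq_bigr => p _.
by rewrite !mxE /lag_sum mulrCA mulr_sumr.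
Unshelve. all: end_near. Qed.

End LagCLT.

(** * Invariance of sample correlations under increasing affine maps *)

Section AffineInvariance.
Context {R : realType}.
Implicit Types (y z : nat -> R) (a b c e : R).

Lemma hat_m_affine N y a b : (0 < N)%N ->
  hat_m N (fun n => a * y n + b) = a * hat_m N y + b.
Proof.
move=> N0; have N1 : N%:R != 0 :> R by rewrite pnatr_eq0 -lt0n.
rewrite /hat_m big_split/= -mulr_sumr sumr_const card_ord mulrDr mulrCA.
by rewrite -[b *+ N]mulr_natl mulKf.
Qed.

Lemma hat_s_affine N y a b : (0 < N)%N -> 0 < a ->
  hat_s N (fun n => a * y n + b) = a * hat_s N y.
Proof.
move=> N0 a0; rewrite /hat_s; have -> : hat_s2 N (fun n => a * y n + b) = a ^+ 2 * hat_s2 N y.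
  rewrite /hat_s2 mulrCA; congr (_ * _); rewrite mulr_sumr; apply: eq_bigr => n _.
  by rewrite hat_m_affine//; ring.
by rewrite sqrtrM ?sqr_ge0// sqrtr_sqr gtr0_norm.
Qed.

(** The factor [a * c] of the covariance cancels against that of the deviations, also when a sample
    deviation is 0, where both correlations are 0. *)
Lemma hat_rho_affine N k y z a b c e : (0 < N)%N -> 0 < a -> 0 < c ->
  hat_rho N k (fun n => a * y n + b) (fun n => c * z n + e) = hat_rho N k y z.
Proof.
move=> N0 a0 c0; rewrite !hat_rhoE !hat_s_affine//.
have -> : hat_gamma N k (fun n => a * y n + b) (fun n => c * z n + e) =
    (a * c) * hat_gamma N k y z.
  rewrite /hat_gamma mulrCA; congr (_ * _); rewrite mulr_sumr; apply: eq_bigr => n _.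
  by rewrite !hat_m_affine//; ring.
by rewrite [X in _ / X]mulrACA -mulf_div divff ?mul1r// gt_eqF// mulr_gt0.
Qed.

End AffineInvariance.

(** * Standardized functions and population correlations *)

Section Standardization.
Context (d : measure_display) (T : measurableType d) (R : realType).
Variable P : probability T R.

Lemma popcovE (Y Z : T -> R) :
  popcov P Y Z = mean P (fun w => (Y w - mean P Y) * (Z w - mean P Z)).
Proof. by rewrite /popcov covariance.unlock expectation.unlock. Qed.

Lemma popsdE (Y : T -> R) : popsd P Y = Num.sqrt (mean P (fun w => (Y w - mean P Y) ^+ 2)).
Proof. exact: (congr1 Num.sqrt (popcovE Y Y)). Qed.

Lemma integ_expectation (F : T -> R) : measurable_fun setT F -> (forall w, 0 <= F w) ->
  ('E_P[F] < +oo)%E -> integ P F.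
Proof.
move=> mF F0 Foo; apply/integrableP; split; first exact/measurable_EFinP.
move: Foo; rewrite unlock; congr (_ < _)%E; apply: eq_integral => w _.
by rewrite /= ger0_norm.
Qed.

Definition standardize (Y : T -> R) (f : R -> R) (x : R) : R :=
  (popsd P (f \o Y))^-1 * (f x - mean P (f \o Y)).

Variable X : nat -> T -> R.
Hypothesis iidX : iid_seq P X.
Let mX0 : measurable_fun setT (X 0%N). Proof. by have [] := iidX. Qed.

Section OneFunction.
Variable f : R -> R.
Hypothesis mf : measurable_fun setT f.
Hypothesis f4 : ('E_P[fun w => (f (X 0%N w) ^+ 4)%R] < +oo)%E.
Hypothesis fsd : 0 < popsd P (f \o X 0%N).

Let mfX : measurable_fun setT (f \o X 0%N). Proof. exact: measurableT_comp mX0. Qed.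

Lemma standardize_standardized : standardized P X (standardize (X 0%N) f).
Proof.
have i4 : integ P (fun w => f (X 0%N w) ^+ 4).
  by apply: integ_expectation => //; [exact: measurable_funX|move=> w; exact: exprn_even_ge0].
have i2 := integ_pow4 mfX i4; have i1 := integ_sqr mfX i2.
set mu := mean P (f \o X 0%N); set s := popsd P (f \o X 0%N).
have s0 : 0 < s by [].
have sE : s ^+ 2 = mean P (fun w => (f (X 0%N w) - mu) ^+ 2).
  by rewrite /s popsdE sqr_sqrtr//; apply: mean_ge0 => w; exact: sqr_ge0.
have ic : integ P (fun w => f (X 0%N w) - mu) by apply: integB => //; exact: integ_cst.
have ic2 : integ P (fun w => (f (X 0%N w) - mu) ^+ 2).
  by apply: (integ_sqrD (G := fun=> - mu)) => //; exact: integ_cst.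
split.
- by apply: measurable_funM => //; exact: measurable_funB.
(* The squared centered function is [F + G], so its fourth power is the square of a sum of two
   square integrable functions. *)
- pose F w := f (X 0%N w) ^+ 2; pose G w := - (2 * mu) * f (X 0%N w) + mu ^+ 2.
  have mF : measurable_fun setT F by exact: measurable_funX.
  have mG : measurable_fun setT G.
    by apply: measurable_funD => //; exact: measurable_funM.
  have iF2 : integ P (fun w => F w ^+ 2) by under eq_fun do rewrite -exprM.
  have iG2 : integ P (fun w => G w ^+ 2).
    apply: (integ_sqrD (F := fun w => - (2 * mu) * f (X 0%N w)) (G := fun=> mu ^+ 2)) => //.
    - exact: measurable_funM.
    - by under eq_fun do rewrite exprMn; exact: integZ.
    - exact: integ_cst.
  have E w : standardize (X 0%N) f (X 0%N w) ^+ 4 = s^-1 ^+ 4 * (F w + G w) ^+ 2.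
    by rewrite /standardize -/s -/mu /F /G; ring.
  under eq_fun do rewrite E.
  by apply: integZ; exact: integ_sqrD.
- rewrite /standardize meanZ// meanB//; last exact: integ_cst.
  by rewrite mean_cst -/mu subrr mulr0.
- under eq_mean do rewrite exprMn.
  by rewrite meanZ// -sE -exprMn mulVf ?expr1n// gt_eqF.
Qed.

Lemma standardizeK (x : R) :
  popsd P (f \o X 0%N) * standardize (X 0%N) f x + mean P (f \o X 0%N) = f x.
Proof. by rewrite /standardize mulVKf ?subrK// gt_eqF. Qed.

End OneFunction.

Lemma mean_standardize (f1 f2 : R -> R) :
  standardized P X (standardize (X 0%N) f1) -> standardized P X (standardize (X 0%N) f2) ->
  0 < popsd P (f1 \o X 0%N) -> 0 < popsd P (f2 \o X 0%N) ->
  mean P (fun w => standardize (X 0%N) f1 (X 0%N w) * standardize (X 0%N) f2 (X 0%N w)) =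
  popcorr P (f1 \o X 0%N) (f2 \o X 0%N).
Proof.
move=> [m1 i1 _ _] [m2 i2 _ _] s1 s2.
have iG : integ P (fun w => standardize (X 0%N) f1 (X 0%N w) * standardize (X 0%N) f2 (X 0%N w)).
  apply: integ_mul; [exact: measurableT_comp mX0|exact: measurableT_comp mX0| |].
    by apply: integ_pow4 => //; exact: measurableT_comp mX0.
  by apply: integ_pow4 => //; exact: measurableT_comp mX0.
rewrite /popcorr popcovE; apply: (canRL (mulfK _)); first by rewrite gt_eqF// mulr_gt0.
rewrite mulrC -meanZ//; apply: eq_mean => w.
by rewrite mulrACA /standardize !mulVKf// gt_eqF.
Qed.

End Standardization.

Theorem theorem2 (d : measure_display) (T : measurableType d) (R : realType)
  (P : probability T R) (X : nat -> T -> R) (m K : nat)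
  (f : 'I_m -> R -> R) :
  iid_seq P X ->
  (forall i, measurable_fun setT (f i)) ->
  (forall i, ('E_P[fun w => (f i (X 0%N w) ^+ 4)%R] < +oo)%E) ->
  (forall i, 0 < popsd P (f i \o X 0%N)) ->
  (1 <= K)%N ->
  exists (d' : measure_display) (T' : measurableType d')
         (P' : probability T' R) (Z : T' -> 'rV[R]_(K * (m * m))),
    centered_gaussian_vec P' Z
      (tensmx (1%:M : 'M[R]_K)
              (tensmx (corr_matrix P X f) (corr_matrix P X f))) /\
    conv_in_distribution P P'
      (fun N w => Num.sqrt (N%:R) *: @hat_C_vec d T R X m K f N w) Z.
Proof.
move=> iidX mf f4 fsd _; have [mX _] := iidX.
pose g i := standardize P (X 0%N) (f i).
have sg i : standardized P X (g i) by exact: standardize_standardized.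
pose lag (p : 'I_(K * (m * m))) := (mxtens_unindex p).1.+1.
pose gi (p : 'I_(K * (m * m))) := g (mxtens_unindex (mxtens_unindex p).2).1.
pose hj (p : 'I_(K * (m * m))) := g (mxtens_unindex (mxtens_unindex p).2).2.
have lag0 p : (0 < lag p)%N by [].
have lagK p : (lag p <= K)%N by exact: ltn_ord.
have sgi p : standardized P X (gi p) by exact: sg.
have shj p : standardized P X (hj p) by exact: sg.
(* [lag] is the block index plus one, so equality of lags is exactly the entry of the identity
   matrix; the other two factors are correlations written as means of products of standardized
   functions. *)
have covE : tensmx (1%:M : 'M[R]_K) (tensmx (corr_matrix P X f) (corr_matrix P X f)) =
    lag_cov P X gi hj lag.
  apply/matrixP => p q; rewrite !mxE; congr (_ * (_ * _)); rewrite /gi /hj /g.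
  - by apply/esym; apply: mean_standardize => //; exact: sg.
  - by apply/esym; apply: mean_standardize => //; exact: sg.
have psdS : psd (lag_cov P X gi hj lag).
  by split=> [|t]; [exact: lag_cov_sym|exact: lag_cov_ge0 lagK t].
have [d' [T' [P' [Z [mZ cZ]]]]] := gaussian_exists psdS.
exists d', T', P', Z; rewrite covE; split; first exact: char_gaussian_centered.
pose S N w := \row_p lag_sum X (gi p) (hj p) (lag p) K N w.
pose Y N w := Num.sqrt (N%:R : R) *: @hat_C_vec d T R X m K f N w.
have mY N p : measurable_fun setT (fun w => Y N w 0 p).
  under eq_fun do rewrite !mxE; apply: measurable_funM => //.
  exact: (measurable_hat_rho iidX).
have iS N p : (0 < N)%N -> integ P (fun w => S N w 0 p) /\ mean P (fun w => `|S N w 0 p|) <= 2.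
  have -> : (fun w => S N w 0 p) = lag_sum X (gi p) (hj p) (lag p) K N.
    by apply/funext => w; rewrite mxE.
  under eq_mean do rewrite mxE.
  exact: (lag_sum_sqr iidX (sgi p) (shj p) (lag0 p) (lagK p)).
have mS N p : measurable_fun setT (fun w => S N w 0 p).
  under eq_fun do rewrite mxE; apply: measurable_funM => //; apply: measurable_sum => n.
  have [[mg _ _ _] [mh _ _ _]] := (sgi p, shj p).
  by apply: measurable_funM; exact: measurableT_comp (mX _).
have YS (eps : R) p : 0 < eps ->
    \forall N \near \oo, mean P (fun w => Num.min 1 `|Y N w 0 p - S N w 0 p|) <= eps.
  move=> e0; near=> N.
  have N0 : (0 < N)%N by near: N; exact: nbhs_infty_gt.
  have E w : Y N w 0 p - S N w 0 p = Num.sqrt N%:R *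
      hat_rho N (lag p) (fun n => gi p (X n w)) (fun n => hj p (X n w)) -
      lag_sum X (gi p) (hj p) (lag p) K N w.
    rewrite !mxE; congr (_ * _ - _); rewrite -/(lag p).
    set i := (mxtens_unindex (mxtens_unindex p).2).1.
    set j := (mxtens_unindex (mxtens_unindex p).2).2.
    (* Affine invariance is read backwards: [f i] is recovered from its standardization with slope
       the positive deviation and intercept the mean. *)
    rewrite -[RHS](hat_rho_affine _ _ _ (mean P (f i \o X 0%N)) (mean P (f j \o X 0%N))
      N0 (fsd i) (fsd j)).
    by congr hat_rho; apply/funext => n; rewrite standardizeK.
  under eq_mean do rewrite E.
  by near: N; exact: (rho_approx iidX).
have tZ : forall eps : R, 0 < eps -> \forall L \near +oo,
    forall p, mean P' (fun w => Num.min 1 (`|Z w 0 p| / L)) <= eps.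
  by move=> eps e0; apply: filter_forall => p; exact: tight1.
have cY (t : 'rV[R]_(K * (m * m))) (a : R) :
    mean P (fun w => cos ((t *m (Y N w)^T) 0 0 + a)) @[N --> \oo] -->
    mean P' (fun w => cos ((t *m (Z w)^T) 0 0 + a)).
  by rewrite cZ; apply: (slutsky_cos mY mS YS); exact: lag_clt.
exact: (weak_conv mY mZ cY (slutsky_tight mY mS YS iS) tZ).
Unshelve. all: end_near. Qed.
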